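(* Let $h,n\ge 1$, let $\Bbbk$ be a field of characteristic $p>h$ (with $p\geq 3$), and let $\lambda,\mu$ be partitions of $n$ with at most $h$ columns. Then the graded decomposition numbers of the symmetric group satisfy, for every $k\in\mathbb{Z}$, $$[S(\lambda):D(\mu)\langle k\rangle]\;\le\;\bigl|\{\mathsf{s}\in \mathrm{Path}^+_n(\lambda,\mathsf{t}^\mu)\mid \deg(\mathsf{s})=k\}\bigr| .$$ In particular, if $[S(\lambda):D(\mu)]\neq 0$ (that is, if $[S(\lambda):D(\mu)\langle k\rangle]\ne0$ for some $k$), then $\lambda$ and $\mu$ are strongly linked with $\lambda\uparrow\mu$.
   Context: Graded symmetric group algebra. Put $I=\mathbb{Z}/p\mathbb{Z}$. Let $H_n$ be the cyclotomic quiver Hecke algebra: the $\Bbbk$-algebra generated by $e(\underline{i})$ ($\underline i\in I^n$), $y_1,\dots,y_n$, $\psi_1,\dots,\psi_{n-1}$ with relations: $e(\underline i)e(\underline j)=\delta_{\underline i,\underline j}e(\underline i)$; $\sum_{\underline i} e(\underline i)=1$; $y_re(\underline i)=e(\underline i)y_r$; $\psi_re(\underline i)=e(s_r\underline i)\psi_r$; $y_ry_s=y_sy_r$; $\psi_ry_s=y_s\psi_r$ if $s\ne r,r+1$; $\psi_r\psi_s=\psi_s\psi_r$ if $|r-s|>1$; $y_r\psi_re(\underline i)=(\psi_ry_{r+1}+\delta_{i_r,i_{r+1}})e(\underline i)$; $y_{r+1}\psi_re(\underline i)=(\psi_ry_r-\delta_{i_r,i_{r+1}})e(\underline i)$; $\psi_r^2e(\underline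 i)$ equals $0$ if $i_r=i_{r+1}$, $(y_{r+1}-y_r)e(\underline i)$ if $i_{r+1}=i_r-1$, $(y_r-y_{r+1})e(\underline i)$ if $i_{r+1}=i_r+1$, and $e(\underline i)$ otherwise; $(\psi_r\psi_{r+1}\psi_r-\psi_{r+1}\psi_r\psi_{r+1})e(\underline i)$ equals $-e(\underline i)$ if $i_r=i_{r+2}=i_{r+1}+1$, $+e(\underline i)$ if $i_r=i_{r+2}=i_{r+1}-1$, and $0$ otherwise; and $y_1^{\delta_{i_1,0}}e(\underline i)=0$. It is graded by $\deg e(\underline i)=0$, $\deg y_r=2$, and $\deg\psi_re(\underline i)=-2,1,0$ according as $i_r=i_{r+1}$, $i_r=i_{r+1}\pm1$, or otherwise. It is known (Brundan–Kleshchev) that $H_n\cong\Bbbk\mathfrak S_n$, which makes $\Bbbk\mathfrak{S}_n$ a graded algebra. Specht and simple modules. Let $Q$ be the quotient of $H_n$ by the two-sided ideal generated by all $e(\underline i)$ with $i_{k+1}=i_k+1$ for $1\le k\le h$. Let $\mathscr{P}_n(h)$ be the set of partitions of $n$ with at most $h$ columns; the box in row $r$ and column $c$ has residue $c-r\in I$. A box $(r,c)$ is more dominant than $(r',c')$ if $r-c<r'-c'$, or if equality holds and $r+c<r'+c'$. For partitions, $\nu$ dominates $\lambda$ if for each box $b$ of $\lambda$, of residue $i$ say, the number of $i$-boxes of $\nu$ that equal or are more dominant than $b$ is at least the number of such boxes of $\lambda$. Let $t^\lambda$ be the standard $\lambda$-tableau obtained by putting $n$ in the least dominant removable box of $\lambda$,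 $n-1$ in the least dominant removable box of what remains, and so on; let $\underline i_\lambda$ be its residue sequence. For a standard $\lambda$-tableau $s$ fix a reduced expression $s_{i_1}\cdots s_{i_k}$ of the permutation taking $t^\lambda$ to $s$ and put $\psi_s=\psi_{i_1}\cdots\psi_{i_k}$; let $*$ be the anti-automorphism fixing the generators. Then $Q$ is a graded cellular algebra with cellular basis $\psi_{st}=\psi_se(\underline i_\lambda)\psi_t^*$ ($\lambda\in\mathscr P_n(h)$, $s,t$ standard $\lambda$-tableaux) for the dominance order on $\mathscr P_n(h)$ in which $\nu$ is at least as dominant as $\lambda$ precisely when, for every $i\in I$ and every $i$-box $b$ of $\lambda$, the number of $i$-boxes of $\nu$ that equal or are more dominant than $b$ is at least the number of $i$-boxes of $\lambda$ that equal or are more dominant than $b$ (lower terms are those of strictly more dominant shape). $S(\lambda)$ denotes the resulting graded (left) cell module, with basis $\{\psi_s\}$, inflated to $H_n$, and $D(\mu)=S(\mu)/\mathrm{rad}$ is the quotient by the radical of its cellular bilinear form, a graded simple module for each $\mu\in\mathscr P_n(h)$. $M\langle k\rangle_i=M_{i-k}$, and $[S(\lambda):D(\mu)\langle k\rangle]$ is a graded composition multiplicity. Geometry. Let $\mathbb E=\mathbb R^h$ with orthonormal basis $\varepsilon_1,\dots,\varepsilon_h$; identify $\lambda\in\mathscr P_n(h)$ with $\sum_c\lambda^T_c\varepsilon_c$, where $\lambda^T_c$ is the length of column $c$. Put $\rho=\sum_c(p-c+1)\varepsilon_c$, $\Phi=\{\varepsilon_a-\varepsilon_b\mid a\ne b\}$,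 $\Phi^+=\{\varepsilon_a-\varepsilon_b\mid a<b\}$. For $\alpha\in\Phi$, $r\in\mathbb Z$ let $s_{\alpha,rp}(x)=x-(\langle x,\alpha\rangle-rp)\alpha$, acting by the dot action $w\cdot x=w(x+\rho)-\rho$; let $\mathbb E(\alpha,rp)=\{x\mid\langle x+\rho,\alpha\rangle=rp\}$ and let $\mathbb E^<(\alpha,rp)$, $\mathbb E^>(\alpha,rp)$ be the two open half-spaces it bounds, with the origin $\circledcirc=0\in\mathbb E^<(\alpha,rp)$. The dominant chamber is $\mathbb E^\circledcirc=\bigcap_{\alpha\in\Phi}\mathbb E^<(\alpha,0)$. Paths. A path of length $n$ is $\mathsf s=(\mathsf s(0),\dots,\mathsf s(n))$ with $\mathsf s(0)=\circledcirc$ and $\mathsf s(k)-\mathsf s(k-1)\in\{\varepsilon_1,\dots,\varepsilon_h\}$. Its degree is $\deg(\mathsf s)=\sum_{k=1}^n\sum_{\alpha\in\Phi^+}d_\alpha(\mathsf s(k-1),\mathsf s(k))$, where $d_\alpha=+1$ if for some $r$ we have $\mathsf s(k-1)\in\mathbb E(\alpha,rp)$ and $\mathsf s(k)\in\mathbb E^<(\alpha,rp)$; $d_\alpha=-1$ if for some $r$ we have $\mathsf s(k-1)\in\mathbb E^>(\alpha,rp)$ and $\mathsf s(k)\in\mathbb E(\alpha,rp)$; and $d_\alpha=0$ otherwise. If $\mathsf s(k)\in\mathbb E(\alpha,rp)$, the reflection of $\mathsf s$ at $k$ is the path agreeing with $\mathsf s$ up to $k$ and with $i$-th point $s_{\alpha,rp}\cdot\mathsf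 s(i)$ for $i\ge k$; write $\mathsf s\sim\mathsf t$ if $\mathsf t$ is obtained from $\mathsf s$ by a finite series of such reflections. The path $\mathsf t^\mu$ from $\circledcirc$ to $\mu$ has $k$-th step $\varepsilon_c$, where $c$ is the column of the box containing $k$ in the tableau $t^\mu$. $\mathrm{Path}_n^+(\lambda,\mathsf t^\mu)$ is the set of paths $\mathsf s\sim\mathsf t^\mu$ with $\mathsf s(n)=\lambda$ and $\mathsf s(k)\in\mathbb E^\circledcirc$ for all $k$. Strong linkage. Write $x\uparrow_{\alpha,mp}y$ if $x=s_{\alpha,mp}\cdot y$, $x\in\mathbb E^<(\alpha,mp)$, $y\in\mathbb E^>(\alpha,mp)$; write $x\uparrow y$ if there is a finite chain (possibly of length zero) of such relations from $x$ to $y$. *)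

(* Defs.v *)
From HB Require Import structures.
From mathcomp Require Import all_boot all_order all_algebra perm.
From mathcomp Require Import boolp reals.
From mathcomp Require Import monalg.
From Stdlib Require Relation_Operators.

Set Implicit Arguments.
Unset Strict Implicit.
Unset Printing Implicit Defensive.

Import Order.TTheory GRing.Theory Num.Theory.

Local Open Scope ring_scope.
Local Open Scope quotient_scope.

Section Ideal.
Variable A : pzRingType.

Inductive ideal_gen (G : A -> Prop) : A -> Prop :=
| ideal_gen0 : ideal_gen G 0
| ideal_genD a g b x : G g -> ideal_gen G x -> ideal_gen G (a * g * b + x).

Variable G : A -> Prop.

Lemma ideal_gen_add x y : ideal_gen G x -> ideal_gen G y -> ideal_gen G (x + y).
Proof.
move=> hx hy; elim: hx => [|a g b x' hg _ ih]; first by rewrite add0r.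
by rewrite -addrA; apply: ideal_genD.
Qed.

Lemma ideal_gen_mull c x : ideal_gen G x -> ideal_gen G (c * x).
Proof.
elim=> [|a g b x' hg _ ih]; first by rewrite mulr0; apply: ideal_gen0.
by rewrite mulrDr !mulrA; apply: ideal_genD.
Qed.

Lemma ideal_gen_mulr c x : ideal_gen G x -> ideal_gen G (x * c).
Proof.
elim=> [|a g b x' hg _ ih]; first by rewrite mul0r; apply: ideal_gen0.
by rewrite mulrDl -mulrA; apply: ideal_genD.
Qed.

Lemma ideal_gen_opp x : ideal_gen G x -> ideal_gen G (- x).
Proof. by move=> hx; rewrite -mulN1r; apply: ideal_gen_mull. Qed.

Lemma ideal_gen_sub x y : ideal_gen G x -> ideal_gen G y -> ideal_gen G (x - y).
Proof. by move=> hx hy; apply: ideal_gen_add => //; apply: ideal_gen_opp. Qed.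

End Ideal.

Section QuotientAlgebra.
Variables (kk : fieldType) (A : algType kk) (G : A -> Prop).

Definition ideal_equiv : rel A := fun x y => `[< ideal_gen G (x - y) >].

Lemma ideal_equiv_class : equiv_class_of ideal_equiv.
Proof.
split=> [x|x y|y x z].
- by apply/asboolP; rewrite subrr; apply: ideal_gen0.
- by apply/asboolP/asboolP => h; rewrite -opprB; apply: ideal_gen_opp.
move=> /asboolP hxy /asboolP hyz; apply/asboolP.
by rewrite -[x](subrK y) -addrA; apply: ideal_gen_add.
Qed.

Canonical ideal_equiv_rel := EquivRelPack ideal_equiv_class.
Canonical ideal_equiv_encModRel := defaultEncModRel ideal_equiv.

Definition quot_alg := {eq_quot ideal_equiv}.

HB.instance Definition _ : EqQuotient A ideal_equiv quot_alg :=
  EqQuotient.on quot_alg.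
HB.instance Definition _ := Choice.on quot_alg.

Definition quot_pi (x : A) : quot_alg := \pi x.

Lemma quot_piP x y : ideal_gen G (x - y) <-> quot_pi x = quot_pi y.
Proof.
split=> [h|/eqP]; first by apply/eqP; rewrite eqmodE /=; apply/asboolP.
by rewrite eqmodE /= => /asboolP.
Qed.

Lemma quot_piK (u : quot_alg) : quot_pi (repr u) = u.
Proof. exact: reprK. Qed.

Lemma quot_repr x : ideal_gen G (repr (quot_pi x) - x).
Proof. by apply/quot_piP; rewrite quot_piK. Qed.

Definition quot_add (u v : quot_alg) := quot_pi (repr u + repr v).
Definition quot_opp (u : quot_alg) := quot_pi (- repr u).
Definition quot_mul (u v : quot_alg) := quot_pi (repr u * repr v).
Definition quot_scale (c : kk) (u : quot_alg) := quot_pi (c *: repr u).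

Lemma quot_addE x y : quot_add (quot_pi x) (quot_pi y) = quot_pi (x + y).
Proof.
by apply/quot_piP; rewrite opprD addrACA; apply: ideal_gen_add; apply: quot_repr.
Qed.

Lemma quot_oppE x : quot_opp (quot_pi x) = quot_pi (- x).
Proof. by apply/quot_piP; rewrite -opprD; apply/ideal_gen_opp/quot_repr. Qed.

Lemma quot_mulE x y : quot_mul (quot_pi x) (quot_pi y) = quot_pi (x * y).
Proof.
apply/quot_piP; set x' := repr _; set y' := repr _.
have -> : x' * y' - x * y = (x' - x) * y' + x * (y' - y).
  by rewrite mulrBl mulrBr addrA subrK.
by apply: ideal_gen_add; [apply: ideal_gen_mulr | apply: ideal_gen_mull];
  apply: quot_repr.
Qed.

Lemma quot_scaleE c x : quot_scale c (quot_pi x) = quot_pi (c *: x).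
Proof.
apply/quot_piP; rewrite -scalerBr -[_ - _]mul1r scalerAl.
by apply: ideal_gen_mull; apply: quot_repr.
Qed.

Fact quot_addA : associative quot_add.
Proof.
move=> u v w; rewrite -[u]quot_piK -[v]quot_piK -[w]quot_piK.
by rewrite !quot_addE addrA.
Qed.
Fact quot_addC : commutative quot_add.
Proof.
by move=> u v; rewrite -[u]quot_piK -[v]quot_piK !quot_addE addrC.
Qed.
Fact quot_add0 : left_id (quot_pi 0) quot_add.
Proof. by move=> u; rewrite -[u]quot_piK quot_addE add0r. Qed.
Fact quot_addN : left_inverse (quot_pi 0) quot_opp quot_add.
Proof. by move=> u; rewrite -[u]quot_piK quot_oppE quot_addE addNr. Qed.

HB.instance Definition _ :=
  GRing.isZmodule.Build quot_alg quot_addA quot_addC quot_add0 quot_addN.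

Fact quot_mulA : associative quot_mul.
Proof.
move=> u v w; rewrite -[u]quot_piK -[v]quot_piK -[w]quot_piK.
by rewrite !quot_mulE mulrA.
Qed.
Fact quot_mul1l : left_id (quot_pi 1) quot_mul.
Proof. by move=> u; rewrite -[u]quot_piK quot_mulE mul1r. Qed.
Fact quot_mul1r : right_id (quot_pi 1) quot_mul.
Proof. by move=> u; rewrite -[u]quot_piK quot_mulE mulr1. Qed.
Fact quot_mulDl : left_distributive quot_mul quot_add.
Proof.
move=> u v w; rewrite -[u]quot_piK -[v]quot_piK -[w]quot_piK.
by rewrite !(quot_addE, quot_mulE) mulrDl.
Qed.
Fact quot_mulDr : right_distributive quot_mul quot_add.
Proof.
move=> u v w; rewrite -[u]quot_piK -[v]quot_piK -[w]quot_piK.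
by rewrite !(quot_addE, quot_mulE) mulrDr.
Qed.

(* The quotient may be the zero ring, hence only a [pzRingType]; the library's
   algebra structures assume [1 != 0], so the [kk]-algebra structure is given
   by the ring structure, the [kk]-module structure and the two compatibility
   lemmas [quot_scaleAl] and [quot_scaleAr]. *)
HB.instance Definition _ := GRing.Zmodule_isPzRing.Build quot_alg
  quot_mulA quot_mul1l quot_mul1r quot_mulDl quot_mulDr.

Fact quot_scaleA a b u : quot_scale a (quot_scale b u) = quot_scale (a * b) u.
Proof. by rewrite -[u]quot_piK !quot_scaleE scalerA. Qed.
Fact quot_scale1 : left_id 1 quot_scale.
Proof. by move=> u; rewrite -[u]quot_piK quot_scaleE scale1r. Qed.
Fact quot_scaleDr : right_distributive quot_scale +%R.
Proof.
move=> c u v; rewrite -[u]quot_piK -[v]quot_piK.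
by rewrite [_ + _]quot_addE !quot_scaleE [RHS]quot_addE scalerDr.
Qed.
Fact quot_scaleDl u : {morph quot_scale^~ u : a b / a + b}.
Proof.
by move=> a b; rewrite -[u]quot_piK !quot_scaleE [RHS]quot_addE scalerDl.
Qed.

HB.instance Definition _ := GRing.Zmodule_isLmodule.Build kk quot_alg
  quot_scaleA quot_scale1 quot_scaleDr quot_scaleDl.

Lemma quot_scaleAl c (u v : quot_alg) : c *: (u * v) = (c *: u) * v.
Proof.
rewrite -[u]quot_piK -[v]quot_piK.
rewrite [_ * _]quot_mulE [LHS]quot_scaleE [c *: _]quot_scaleE.
by rewrite [RHS]quot_mulE scalerAl.
Qed.

Lemma quot_scaleAr c (u v : quot_alg) : c *: (u * v) = u * (c *: v).
Proof.
rewrite -[u]quot_piK -[v]quot_piK.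
rewrite [_ * _]quot_mulE [LHS]quot_scaleE [c *: _]quot_scaleE.
by rewrite [RHS]quot_mulE scalerAr.
Qed.

End QuotientAlgebra.

Section FreeAlgebra.
Variables (kk : fieldType) (X : choiceType).

Definition free_alg := {malg kk[{fmonom X}]}.

HB.instance Definition _ := GRing.Lalgebra.on free_alg.

Fact free_alg_scaleAr (c : kk) (x y : free_alg) : c *: (x * y) = x * (c *: y).
Proof.
have comm (g : {malg kk[{fmonom X}]}) : g * malgC c = malgC c * g.
  rewrite [LHS]fgmulgU [RHS]fgmulUg; apply: eq_bigr => m _.
  by rewrite mulrC mulm1 mul1m.
suff : forall u v : {malg kk[{fmonom X}]}, c *: (u * v) = u * (c *: v) by exact.
by move=> u v; rewrite -!mul_malgC !mulrA comm.
Qed.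

HB.instance Definition _ :=
  GRing.Lalgebra_isAlgebra.Build kk free_alg free_alg_scaleAr.

Definition free_var (x : X) : free_alg := << fmu x >>.

End FreeAlgebra.

Section Tableaux.
Local Open Scope nat_scope.

(* A box is (row, column), both counted from 0; contents and residues are those
   of the 1-based convention, and so is the dominance order. *)
Definition box := (nat * nat)%type.

Definition is_partition (n h : nat) (la : seq nat) : bool :=
  [&& sorted geq la, 0 \notin la, sumn la == n & all (fun r => r <= h) la].

Definition boxes (la : seq nat) : seq box :=
  [seq (r, c) | r <- iota 0 (size la), c <- iota 0 (nth 0 la r)].

Definition column_length (la : seq nat) (c : nat) : nat :=
  count (fun row => c < row) la.

Definition more_dominant (b b' : box) : bool :=
  let diff (x : box) := (x.1%:Z - x.2%:Z)%R in
  (diff b < diff b')%R || (diff b == diff b') && (b.1 + b.2 < b'.1 + b'.2).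

Definition residue (p : nat) (b : box) : 'Z_p := (b.2%:R - b.1%:R)%R.

Definition count_dominant (p : nat) (la : seq nat) (b : box) : nat :=
  count (fun b' => (residue p b' == residue p b) &&
                   ((b' == b) || more_dominant b' b)) (boxes la).

Definition dominates (p : nat) (nu la : seq nat) : bool :=
  all (fun b => count_dominant p la b <= count_dominant p nu b) (boxes la).

Definition strictly_dominates (p : nat) (nu la : seq nat) : bool :=
  (nu != la) && dominates p nu la.

(* A tableau is the sequence of its boxes: the box of index [k] contains
   [k + 1]. *)
Definition tableau := seq box.

Definition is_standard (t : tableau) : bool :=
  all (fun b => all (fun b' =>
    ((b.1 == b'.1) && (b.2 < b'.2) || (b.2 == b'.2) && (b.1 < b'.1))
      ==> (index b t < index b' t)) t) t.

Definition std (la : seq nat) : seq tableau :=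
  [seq t <- permutations (boxes la) | is_standard t].

Definition removable_boxes (D : seq box) : seq box :=
  [seq b <- D | ((b.1.+1, b.2) \notin D) && ((b.1, b.2.+1) \notin D)].

Definition least_dominant (s : seq box) : box :=
  head (0, 0) [seq b <- s | all (fun b' => (b' == b) || more_dominant b' b) s].

Fixpoint fill_least_dominant (m : nat) (D : seq box) : tableau :=
  if m is m'.+1 then
    let b := least_dominant (removable_boxes D) in
    rcons (fill_least_dominant m' (rem b D)) b
  else [::].

Definition dom_tab (la : seq nat) : tableau :=
  fill_least_dominant (size (boxes la)) (boxes la).

End Tableaux.

Section SimpleTranspositions.
Variable n : nat.

Definition pos (r : 'I_n.-1) : 'I_n := widen_ord (leq_pred n) r.

Lemma pos_succ_proof (r : 'I_n.-1) : (r.+1 < n)%N.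
Proof. by case: r => r /=; rewrite -ltnS; case: n. Qed.

Definition pos_succ (r : 'I_n.-1) : 'I_n := Ordinal (pos_succ_proof r).

(* The value at [k] of s_(r_1) o ... o s_(r_m), for w = [:: r_1; ...; r_m]. *)
Definition word_act (w : seq 'I_n.-1) (k : 'I_n) : 'I_n :=
  foldr (fun r x => tperm (pos r) (pos_succ r) x) k w.

(* [w] is a reduced expression of the permutation of the entries that takes
   [t] to [s]. *)
Definition reduced_expr (t s : tableau) (w : seq 'I_n.-1) : Prop :=
  (forall k : 'I_n, nth (0, 0)%N s (word_act w k) = nth (0, 0)%N t k) /\
  (forall w', word_act w' =1 word_act w -> (size w <= size w')%N).

End SimpleTranspositions.

Section QuiverHecke.
Variables (kk : fieldType) (p n h : nat).

Definition res_seq := {ffun 'I_n -> 'Z_p}.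

Definition swap_res (r : 'I_n.-1) (i : res_seq) : res_seq :=
  [ffun k => i (tperm (pos r) (pos_succ r) k)].

Definition generator := (res_seq + 'I_n + 'I_n.-1)%type.

Local Notation F := (free_alg kk generator).
Definition free_e (i : res_seq) : F := free_var kk (inl (inl i) : generator).
Definition free_y (r : 'I_n) : F := free_var kk (inl (inr r) : generator).
Definition free_psi (r : 'I_n.-1) : F := free_var kk (inr r : generator).

Local Notation fe := free_e.
Local Notation fy := free_y.
Local Notation fpsi := free_psi.

Inductive qH_rel : F -> F -> Prop :=
| rel_idem i j : qH_rel (fe i * fe j) (if i == j then fe i else 0)
| rel_one : qH_rel (\sum_(i : res_seq) fe i) 1
| rel_y_e r i : qH_rel (fy r * fe i) (fe i * fy r)
| rel_psi_e r i : qH_rel (fpsi r * fe i) (fe (swap_res r i) * fpsi r)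
| rel_y_y r s : qH_rel (fy r * fy s) (fy s * fy r)
| rel_psi_y r s : s != pos r -> s != pos_succ r ->
    qH_rel (fpsi r * fy s) (fy s * fpsi r)
| rel_psi_psi (r s : 'I_n.-1) : (r.+1 < s)%N || (s.+1 < r)%N ->
    qH_rel (fpsi r * fpsi s) (fpsi s * fpsi r)
| rel_y_psi r (i : res_seq) :
    qH_rel (fy (pos r) * fpsi r * fe i)
      ((fpsi r * fy (pos_succ r) + (i (pos r) == i (pos_succ r))%:R) * fe i)
| rel_ysucc_psi r (i : res_seq) :
    qH_rel (fy (pos_succ r) * fpsi r * fe i)
      ((fpsi r * fy (pos r) - (i (pos r) == i (pos_succ r))%:R) * fe i)
| rel_psi_sq r (i : res_seq) :
    qH_rel (fpsi r ^+ 2 * fe i)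
      (if i (pos r) == i (pos_succ r) then 0
       else if i (pos_succ r) == i (pos r) - 1 then
         (fy (pos_succ r) - fy (pos r)) * fe i
       else if i (pos_succ r) == i (pos r) + 1 then
         (fy (pos r) - fy (pos_succ r)) * fe i
       else fe i)
| rel_braid (r s : 'I_n.-1) (i : res_seq) : s = r.+1 :> nat ->
    qH_rel ((fpsi r * fpsi s * fpsi r - fpsi s * fpsi r * fpsi s) * fe i)
      (if (i (pos r) == i (pos_succ s)) &&
          (i (pos r) == i (pos_succ r) + 1) then - fe i
       else if (i (pos r) == i (pos_succ s)) &&
               (i (pos r) == i (pos_succ r) - 1) then fe i
       else 0)
| rel_cyclotomic (r : 'I_n) (i : res_seq) : r = 0%N :> nat ->
    qH_rel (fy r ^+ (i r == 0) * fe i) 0.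

Definition qH : Type :=
  quot_alg (fun x : F => exists a b, qH_rel a b /\ x = a - b).

HB.instance Definition _ := GRing.PzRing.on qH.
HB.instance Definition _ := GRing.Lmodule.on qH.

Definition e_ (i : res_seq) : qH := quot_pi _ (fe i).
Definition y_ (r : 'I_n) : qH := quot_pi _ (fy r).
Definition psi_ (r : 'I_n.-1) : qH := quot_pi _ (fpsi r).

Definition psi_deg (r : 'I_n.-1) (i : res_seq) : int :=
  if i (pos r) == i (pos_succ r) then - 2
  else if (i (pos r) == i (pos_succ r) + 1) || (i (pos r) == i (pos_succ r) - 1)
  then 1 else 0.

Inductive homogeneous : int -> qH -> Prop :=
| homog_e i : homogeneous 0 (e_ i)
| homog_y r : homogeneous 2 (y_ r)
| homog_psi r i : homogeneous (psi_deg r i) (psi_ r * e_ i)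
| homog_0 d : homogeneous d 0
| homog_lin d (c : kk) x y : homogeneous d x -> homogeneous d y ->
    homogeneous d (c *: x + y)
| homog_mul d d' x y : homogeneous d x -> homogeneous d' y ->
    homogeneous (d + d') (x * y).

Inductive lin_span (B : qH -> Prop) : qH -> Prop :=
| lin_span0 : lin_span B 0
| lin_spanD (c : kk) b x : B b -> lin_span B x -> lin_span B (c *: b + x).

Section Modules.

(* All graded modules needed are subquotients [num / den] of the left regular
   module, with the grading induced by that of the algebra: the component of
   degree [d] is the image of the elements of [num] homogeneous of degree [d]. *)
Record subquo := SubQuo { num : qH -> Prop ; den : qH -> Prop }.

Definition included (V W : qH -> Prop) : Prop := forall x, V x -> W x.

Definition graded_submodule (V : qH -> Prop) : Prop :=
  [/\ V 0, forall x y, V x -> V y -> V (x + y),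
      forall a x, V x -> V (a * x) &
      forall x, V x -> lin_span (fun y => V y /\ exists d, homogeneous d y) x].

Definition graded_simple (M : subquo) : Prop :=
  [/\ included (den M) (num M), ~ included (num M) (den M) &
      forall X, graded_submodule X -> included (den M) X -> included X (num M) ->
        included X (den M) \/ included (num M) X].

(* [f] lifts an isomorphism of graded modules M -> N<k>, where
   N<k>_d = N_(d - k). *)
Definition graded_iso_shift (M N : subquo) (k : int) : Prop :=
  exists f : {linear qH -> qH | @GRing.scale kk qH},
    [/\ forall x, num M x -> num N (f x) /\ (den N (f x) <-> den M x),
        forall a x, num M x -> den N (f (a * x) - a * f x),
        forall y, num N y -> exists2 x, num M x & den N (y - f x) &
        forall d x, num M x -> homogeneous d x ->
          exists y, [/\ num N y, homogeneous (d - k) y & den N (f x - y)]].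

Definition composition_series (M : subquo) (l : nat) (V : nat -> qH -> Prop) :=
  [/\ forall x, V 0%N x <-> den M x, forall x, V l x <-> num M x,
      forall j, (j <= l)%N -> graded_submodule (V j) &
      forall j, (j < l)%N -> graded_simple (SubQuo (V j.+1) (V j))].

(* [graded_mult M N k m] : the multiplicity [M : N<k>], computed from a graded
   composition series of M, is m. *)
Definition graded_mult (M N : subquo) (k : int) (m : nat) : Prop :=
  exists l V, composition_series M l V /\
    m = #|[set j : 'I_l |
             `[< graded_iso_shift (SubQuo (V j.+1) (V j)) N k >]]|.

End Modules.

Definition tab_res (t : tableau) : res_seq :=
  [ffun k : 'I_n => residue p (nth (0, 0)%N t k)].

Definition killed_idem (i : res_seq) : Prop :=
  (h < n)%N /\
  forall k l : 'I_n, l = k.+1 :> nat -> (l <= h)%N -> i l = i k + 1.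

(* The kernel of the projection from [qH] onto Q, which is 0 when n <= h. *)
Definition ker_Q : qH -> Prop :=
  ideal_gen (fun x => exists2 i, killed_idem i & x = e_ i).

Section CellModules.
Variable rex : tableau -> seq 'I_n.-1.

Definition valid_red : Prop :=
  forall la s, is_partition n h la -> s \in std la ->
    reduced_expr (dom_tab la) s (rex s).

Definition psi_tab (s : tableau) : qH := \prod_(r <- rex s) psi_ r.

Definition psi_tab_star (s : tableau) : qH := \prod_(r <- rev (rex s)) psi_ r.

Definition psi_cell (la : seq nat) (s t : tableau) : qH :=
  psi_tab s * e_ (tab_res (dom_tab la)) * psi_tab_star t.

(* The inverse image in [qH] of the span in Q of the cellular basis elements of
   shape strictly more dominant than [la]. *)
Definition cell_lower (la : seq nat) : qH -> Prop :=
  lin_span (fun x => ker_Q x \/ exists nu s t,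
    [/\ is_partition n h nu, strictly_dominates p nu la,
        s \in std nu, t \in std nu & x = psi_cell nu s t]).

Definition cell_upper (la : seq nat) : qH -> Prop :=
  lin_span (fun x => cell_lower la x \/
    exists2 s, s \in std la & x = psi_cell la s (dom_tab la)).

(* S(la) is realised by the classes of psi_(s t) = psi_s e(i_la), t = t^la. *)
Definition Specht (la : seq nat) : subquo :=
  SubQuo (cell_upper la) (cell_lower la).

Definition is_cell_form (mu : seq nat) (B : tableau -> tableau -> kk) : Prop :=
  forall s t u v,
    s \in std mu -> t \in std mu -> u \in std mu -> v \in std mu ->
    cell_lower mu
      (psi_cell mu u s * psi_cell mu t v - B s t *: psi_cell mu u v).

Definition cell_radical (mu : seq nat) : qH -> Prop := fun x =>
  exists (B : tableau -> tableau -> kk) (a : tableau -> kk),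
    [/\ is_cell_form mu B,
        cell_lower mu
          (x - \sum_(s <- std mu) a s *: psi_cell mu s (dom_tab mu)) &
        forall t, t \in std mu -> \sum_(s <- std mu) a s * B s t = 0].

Definition simple_module (mu : seq nat) : subquo :=
  SubQuo (cell_upper mu) (cell_radical mu).

End CellModules.
End QuiverHecke.

Section Geometry.
Variables (R : realType) (p n h : nat).

Local Notation E := 'rV[R]_h.

Definition inner (x y : E) : R := \sum_c x 0 c * y 0 c.

Definition eps (c : 'I_h) : E := delta_mx 0 c.

Definition root_vec (a b : 'I_h) : E := eps a - eps b.

(* Columns are counted from 0, so p - c + 1 becomes p - c. *)
Definition rho : E := \row_c (p%:R - c%:R).

Definition weight (la : seq nat) : E := \row_c (column_length la c)%:R.

Definition wall_level (r : int) : R := (r * p%:Z)%:~R.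

Definition dot_refl (al : E) (r : int) (x : E) : E :=
  let z := x + rho in z - (inner z al - wall_level r) *: al - rho.

Definition wall_form (al : E) (r : int) (x : E) : R :=
  inner (x + rho) al - wall_level r.

Definition on_wall (al : E) (r : int) (x : E) : Prop := wall_form al r x = 0.

(* The two open half-spaces are distinguished by the origin, which lies below
   every wall as soon as h <= p. *)
Definition below_wall (al : E) (r : int) (x : E) : Prop :=
  0 < wall_form al r x * wall_form al r 0.

Definition above_wall (al : E) (r : int) (x : E) : Prop :=
  wall_form al r x * wall_form al r 0 < 0.

Definition dominant (x : E) : Prop :=
  forall a b : 'I_h, a != b -> below_wall (root_vec a b) 0 x.

(* A path is given by its steps: the [j]-th step is [eps (s j)]. *)
Definition lattice_path := {ffun 'I_n -> 'I_h}.

Definition point (s : lattice_path) (k : nat) : E :=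
  \sum_(j < n | (j < k)%N) eps (s j).

Definition step_degree (al x y : E) : int :=
  if `[< exists r, on_wall al r x /\ below_wall al r y >] then 1
  else if `[< exists r, above_wall al r x /\ on_wall al r y >] then - 1
  else 0.

Definition path_degree (s : lattice_path) : int :=
  \sum_(k < n) \sum_(a < h) \sum_(b < h | (a < b)%N)
    step_degree (root_vec a b) (point s k) (point s k.+1).

Definition path_reflection (s t : lattice_path) : Prop :=
  exists (k : nat) (a b : 'I_h) (r : int),
    [/\ (k <= n)%N, a != b, on_wall (root_vec a b) r (point s k),
        forall i, (i <= k)%N -> point t i = point s i &
        forall i, (k <= i <= n)%N ->
          point t i = dot_refl (root_vec a b) r (point s i)].

Definition path_equiv : rel lattice_path :=
  connect (fun s t => `[< path_reflection s t >]).

Definition is_dom_path (mu : seq nat) (t : lattice_path) : Prop :=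
  forall k : 'I_n, t k = (nth (0, 0)%N (dom_tab mu) k).2 :> nat.

Definition dom_paths (la mu : seq nat) : {set lattice_path} :=
  [set s : lattice_path |
    `[< [/\ exists2 t, is_dom_path mu t & path_equiv s t,
            point s n = weight la &
            forall k, (k <= n)%N -> dominant (point s k)] >]].

Definition linked_step (x y : E) : Prop :=
  exists (a b : 'I_h) (m : int),
    [/\ a != b, x = dot_refl (root_vec a b) m y, below_wall (root_vec a b) m x &
        above_wall (root_vec a b) m y].

Definition strongly_linked : E -> E -> Prop :=
  Relation_Operators.clos_refl_trans E linked_step.

End Geometry.

Arguments Specht kk p {n} h rex la.
Arguments simple_module kk p {n} h rex mu.
Arguments dom_paths R p n h la mu : clear implicits.
Arguments path_degree R p {n h} s.
Arguments weight R h la : clear implicits.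
Arguments strongly_linked {R} p {h} x y.
Arguments valid_red n h rex : clear implicits.

(* Main.v *)
(** Let [e] be the idempotent of the residue sequence of [t^mu]. If [u] lies in
    the radical of the cellular form, then the congruences defining the form,
    together with the anti-involution, put [e u] in the span [L] of the cells
    of shape more dominant than [mu]. Hence a factor [D(mu)<k>] of [S(la)]
    contributes a homogeneous vector of degree [k] fixed by [e], provided that
    [e] is not in [L], and the multiplicity is at most the number of standard
    [la]-tableaux of degree [k] with the residue sequence of [t^mu]. Reading
    off the columns of the entries turns such a tableau into a dominant path
    with the same degree; and two paths with the same residues are related by
    reflections, as one sees by reflecting the tail at the first step where
    they differ.

    That [e] is not in [L] rests on a deformation of Young's seminormal form
    over [kk(X)]: functions on the content sequences of the standard
    [mu]-tableaux, on which the defining relations hold up to multiples of [X]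
    on the [kk[X]]-lattice generated by the delta function of [t^mu]. This
    lattice has bounded denominators, because words in the [psi]'s reduce to
    boundedly many normal forms, so that [e] acts on it by a nonzero map modulo
    [X], while the idempotent of a sequence that is not the residue sequence of
    a standard [mu]-tableau acts by zero. Finally, the residue sequence of
    [t^nu], for [nu] strictly more dominant than [mu], is not the one of a
    standard [mu]-tableau: otherwise [mu] would be strongly linked to [nu],
    and [|nu + rho|^2] would be at least [|mu + rho|^2], whereas strict
    dominance makes it smaller. *)

From HB Require Import structures.
Require Import Defs.
From mathcomp Require Import all_boot all_order all_algebra perm.
From mathcomp Require Import finmap boolp reals functions monalg.
From mathcomp Require Import zify ring.
From Stdlib Require Import Relation_Operators.

Set Implicit Arguments.
Unset Strict Implicit.
Unset Printing Implicit Defensive.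

Import Order.TTheory GRing.Theory Num.Theory.

Local Open Scope ring_scope.

(** * Anti-involution and grading of the quiver Hecke algebra *)

(** The algebra is known by a presentation only: no basis is available, and the spanning vectors of
    the cells are not known to be independent. An upper bound on a multiplicity needs spanning sets
    only, but the separation of degrees and the nonvanishing of an idempotent have to be read off
    explicit modules, on which the free algebra acts and each relation is checked. Degrees are
    separated on functions from the integers to [qH]. For the idempotent, Young's coefficients 1/(c
    - c') make no sense in characteristic p, since boxes of equal residue have congruent contents; a
    content c is therefore replaced by (1 + X)^c. As the relations then hold only modulo X, the
    module is a lattice modulo X, which might be zero, the lattice not being finitely generated by
    construction. If e belonged to the ideal generated by the idempotents acting by zero, the delta
    function would be divisible in the lattice by every power of X, and this is what bounded
    denominators exclude. *)

Section FreeAction.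
Variables (kk : fieldType) (X : choiceType) (K : fieldType).
Variable iota : {rmorphism kk -> K}.
Variable V : lmodType K.
Variable op : X -> {linear V -> V}.
Local Notation F := (free_alg kk X).

Definition word_op (w : seq X) (v : V) : V := foldr (fun x u => op x u) v w.

Lemma word_op_cat w w' v : word_op (w ++ w') v = word_op w (word_op w' v).
Proof. by rewrite /word_op foldr_cat. Qed.

Lemma word_op_linear w : linear (word_op w).
Proof. by move=> c u v; elim: w => //= x w ->; rewrite linearP. Qed.

Lemma word_opD w u v : word_op w (u + v) = word_op w u + word_op w v.
Proof. by rewrite -[u]scale1r word_op_linear !scale1r. Qed.

Lemma word_opZ w c u : word_op w (c *: u) = c *: word_op w u.
Proof.
have /= h := word_op_linear w c u 0.
have h0 : word_op w 0 = 0 by elim: (w) => //= x w' ->; rewrite linear0.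
by move: h; rewrite h0 !addr0.
Qed.

(** Scalars pass through [iota] because the same action is used with [K] equal to [kk], on [qH] and
    on graded functions, and with [K] equal to kk(X), on the deformed module. *)
Definition act (x : F) (v : V) : V :=
  \sum_(m <- msupp (x : {malg kk[{fmonom X}]}))
    iota (mcoeff m x) *: word_op (fmonom_val m) v.

Lemma actEw (x : F) (d : {fset {fmonom X}}) v :
  (msupp (x : {malg kk[{fmonom X}]}) `<=` d)%fset ->
  act x v = \sum_(m <- d) iota (mcoeff m x) *: word_op (fmonom_val m) v.
Proof.
move=> le; rewrite /act (big_fset_incl _ le) // => m _ /mcoeff_outdom ->.
by rewrite rmorph0 scale0r.
Qed.

Lemma actDl (x y : F) v : act (x + y) v = act x v + act y v.
Proof.
rewrite (@actEw (x + y) _ _ (msuppD_le x y)) (@actEw x _ _ (fsubsetUl _ (msupp (y : {malg kk[{fmonom X}]})))).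
rewrite (@actEw y _ _ (fsubsetUr (msupp (x : {malg kk[{fmonom X}]})) _)) -big_split /=.
by apply: eq_bigr => m _; rewrite mcoeffD rmorphD scalerDl.
Qed.

Lemma actZl c (x : F) v : act (c *: x) v = iota c *: act x v.
Proof.
rewrite (@actEw (c *: x) _ _ (msuppZ_le c x)) /act scaler_sumr.
by apply: eq_bigr => m _; rewrite mcoeffZ rmorphM scalerA.
Qed.

Lemma act0l v : act 0 v = 0.
Proof. by apply: (addIr (act 0 v)); rewrite -actDl !add0r. Qed.

Lemma actNl x v : act (- x) v = - act x v.
Proof. by apply: (addIr (act x v)); rewrite -actDl !addNr act0l. Qed.

Lemma actBl x y v : act (x - y) v = act x v - act y v.
Proof. by rewrite actDl actNl. Qed.

Lemma act_suml I (r : seq I) (P : pred I) (f : I -> F) v :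
  act (\sum_(i <- r | P i) f i) v = \sum_(i <- r | P i) act (f i) v.
Proof.
apply: (big_morph (fun x => act x v)) => [x y|]; [exact: actDl | exact: act0l].
Qed.

Lemma actU (c : kk) m v :
  act (<< c *g m >> : {malg kk[{fmonom X}]}) v =
  iota c *: word_op (fmonom_val m) v.
Proof. by rewrite (actEw _ msuppU_le) big_seq_fset1 mcoeffUU. Qed.

Lemma act_var x v : act (free_var kk x) v = op x v.
Proof. by rewrite /free_var actU rmorph1 scale1r fmuE. Qed.

Lemma act1l v : act 1 v = v.
Proof.
have -> : (1 : F) = (<< fmone X >> : {malg kk[{fmonom X}]}) by [].
by rewrite actU rmorph1 scale1r fmoneE.
Qed.

Lemma actM (x y : F) v : act (x * y) v = act x (act y v).
Proof.
have -> : x * y = \sum_(m1 <- msupp (x : {malg kk[{fmonom X}]}))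
   \sum_(m2 <- msupp (y : {malg kk[{fmonom X}]}))
   (<< mcoeff m1 x * mcoeff m2 y *g fmmul m1 m2 >> : F) by exact: malgME.
rewrite act_suml [in RHS]/act; apply: eq_bigr => m1 _.
rewrite act_suml.
have hsum (s : seq {fmonom X}) f :
    word_op m1 (\sum_(m <- s) f m) = \sum_(m <- s) word_op m1 (f m).
  elim: s => [|m s ih]; last by rewrite !big_cons word_opD ih.
  by rewrite !big_nil -(scale0r 0) word_opZ !scale0r.
rewrite hsum scaler_sumr; apply: eq_bigr => m2 _.
rewrite actU rmorphM word_opZ scalerA.
by rewrite fmmulE /= word_op_cat.
Qed.

(* [L'] plays the part of a submodule of [L]: an ideal generated by elements
   mapping [L] into [L'] does the same. *)
Lemma act_ideal_gen (G : F -> Prop) (L L' : V -> Prop) :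
  (forall x u, L u -> L (op x u)) -> (forall x u, L' u -> L' (op x u)) ->
  L 0 -> (forall c u v, L u -> L v -> L (iota c *: u + v)) ->
  L' 0 -> (forall c u v, L' u -> L' v -> L' (iota c *: u + v)) ->
  (forall g u, G g -> L u -> L' (act g u)) ->
  forall x u, ideal_gen G x -> L u -> L' (act x u).
Proof.
move=> opL opL' L0 LP L0' LP' GL.
have wL w u : L u -> L (word_op w u) by move=> hu; elim: w => //= x w /opL.
have wL' w u : L' u -> L' (word_op w u) by move=> hu; elim: w => //= x w /opL'.
have aL x u : L u -> L (act x u).
  move=> hu; rewrite /act; elim: (finmap.enum_fset _) => [|m s ih].
    by rewrite big_nil.
  by rewrite big_cons; apply: LP => //; apply: wL.
have aL' x u : L' u -> L' (act x u).
  move=> hu; rewrite /act; elim: (finmap.enum_fset _) => [|m s ih].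
    by rewrite big_nil.
  by rewrite big_cons; apply: LP' => //; apply: wL'.
move=> x u hx hu; elim: hx => [|a g b y hg _ ih]; first by rewrite act0l.
rewrite actDl !actM -[act a _]scale1r -(rmorph1 iota); apply: LP' => //.
by apply/aL'/GL => //; apply: aL.
Qed.

End FreeAction.

(** * Sequences under simple transpositions *)

Section FunSwap.
Variables (n : nat) (T : Type).
Implicit Types (i : {ffun 'I_n -> T}) (r s : 'I_n.-1).

(** One operation serves residue sequences, where it is [swap_res], content sequences, lattice paths
    and tableaux. *)
Definition fswap r i : {ffun 'I_n -> T} :=
  [ffun k => i (tperm (pos r) (pos_succ r) k)].

Lemma fswapK r : involutive (fswap r).
Proof. by move=> i; apply/ffunP => k; rewrite !ffunE tpermK. Qed.

Lemma fswap_pos r i : fswap r i (pos r) = i (pos_succ r).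
Proof. by rewrite ffunE tpermL. Qed.

Lemma fswap_pos_succ r i : fswap r i (pos_succ r) = i (pos r).
Proof. by rewrite ffunE tpermR. Qed.

Lemma fswap_other r i k : k != pos r -> k != pos_succ r -> fswap r i k = i k.
Proof. by move=> h1 h2; rewrite ffunE tpermD // eq_sym. Qed.

Lemma fswap_far r s i : (r.+1 < s)%N || (s.+1 < r)%N ->
  [/\ fswap r i (pos s) = i (pos s), fswap r i (pos_succ s) = i (pos_succ s) &
      fswap r (fswap s i) = fswap s (fswap r i)].
Proof.
move=> h.
have E k : tperm (pos r) (pos_succ r) (tperm (pos s) (pos_succ s) k) =
           tperm (pos s) (pos_succ s) (tperm (pos r) (pos_succ r) k).
  have [n1 n2 n3 n4] : [/\ pos s != pos r, pos s != pos_succ r,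
                       pos_succ s != pos r & pos_succ s != pos_succ r].
    by split; rewrite -(inj_eq val_inj) /=; apply/eqP; lia.
  have [->|k1] := eqVneq k (pos s).
    by rewrite tpermL !(tpermD (x := pos r)) 1?eq_sym // tpermL.
  have [->|k2] := eqVneq k (pos_succ s).
    by rewrite tpermR !(tpermD (x := pos r)) 1?eq_sym // tpermR.
  rewrite [tperm (pos s) _ k]tpermD 1?eq_sym //.
  by case: (tpermP (pos r) (pos_succ r) k) => *; rewrite tpermD // eq_sym.
split; [apply: fswap_other|apply: fswap_other|];
  try by rewrite -(inj_eq val_inj) /=; apply/eqP; lia.
by apply/ffunP => k; rewrite !ffunE E.
Qed.

Lemma fswap_braid r s i : s = r.+1 :> nat ->
  fswap r (fswap s (fswap r i)) = fswap s (fswap r (fswap s i)).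
Proof.
move=> h.
have prs : pos s = pos_succ r by apply: val_inj.
have [n1 n2 n3] : [/\ pos_succ r != pos r, pos_succ s != pos_succ r &
                   pos_succ s != pos r].
  by split; rewrite -(inj_eq val_inj) /=; apply/eqP; lia.
have TE : (tperm (pos r) (pos_succ r) (pos r) = pos_succ r) *
  (tperm (pos r) (pos_succ r) (pos_succ r) = pos r) *
  (tperm (pos r) (pos_succ r) (pos_succ s) = pos_succ s) *
  (tperm (pos_succ r) (pos_succ s) (pos_succ r) = pos_succ s) *
  (tperm (pos_succ r) (pos_succ s) (pos_succ s) = pos_succ r) *
  (tperm (pos_succ r) (pos_succ s) (pos r) = pos r).
  by do !split; rewrite ?tpermL ?tpermR ?tpermD // eq_sym.
apply/ffunP => k; rewrite !ffunE prs; congr (i _).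
have [->|k1] := eqVneq k (pos r); first by rewrite !TE.
have [->|k2] := eqVneq k (pos_succ r).
  by rewrite !TE.
have [->|k3] := eqVneq k (pos_succ s); first by rewrite !TE.
by rewrite !tpermD // eq_sym.
Qed.

End FunSwap.

Section SwapRes.
Variables (p n : nat).

Lemma swap_resK r : involutive (@swap_res p n r).
Proof. exact: fswapK. Qed.

Lemma swap_res_pos r (i : res_seq p n) : swap_res r i (pos r) = i (pos_succ r).
Proof. exact: fswap_pos. Qed.

Lemma swap_res_pos_succ r (i : res_seq p n) :
  swap_res r i (pos_succ r) = i (pos r).
Proof. exact: fswap_pos_succ. Qed.

Lemma swap_res_other r (i : res_seq p n) k :
  k != pos r -> k != pos_succ r -> swap_res r i k = i k.
Proof. exact: fswap_other. Qed.

Lemma swap_res_id r (i : res_seq p n) :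
  i (pos r) = i (pos_succ r) -> swap_res r i = i.
Proof.
by move=> h; apply/ffunP => k; rewrite ffunE; case: tpermP => [->|->|].
Qed.

Lemma psi_deg_swap r (i : res_seq p n) : psi_deg r (swap_res r i) = psi_deg r i.
Proof.
rewrite /psi_deg swap_res_pos swap_res_pos_succ eq_sym.
case: eqP => // _; rewrite orbC.
have E (a b : 'Z_p) : (b == a - 1) = (a == b + 1) by rewrite eq_sym subr_eq.
by rewrite !E.
Qed.

Lemma swap_res_pos_neq (r s : 'I_n.-1) (i : res_seq p n) :
  (r.+1 < s)%N || (s.+1 < r)%N ->
  [/\ swap_res r i (pos s) = i (pos s),
      swap_res r i (pos_succ s) = i (pos_succ s) &
      swap_res r (swap_res s i) = swap_res s (swap_res r i)].
Proof. exact: fswap_far. Qed.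

Lemma swap_res_braid (r s : 'I_n.-1) (i : res_seq p n) : s = r.+1 :> nat ->
  swap_res r (swap_res s (swap_res r i)) = swap_res s (swap_res r (swap_res s i)).
Proof. exact: fswap_braid. Qed.

End SwapRes.

(** * The defining relations in a ring and in its opposite *)

Section Klr.
Variables (p n : nat).

Section Def.
Variables (A : pzRingType) (e : res_seq p n -> A) (y : 'I_n -> A).
Variable psi : 'I_n.-1 -> A.

Definition klr_quad r (i : res_seq p n) : A :=
  if i (pos r) == i (pos_succ r) then 0
  else if i (pos_succ r) == i (pos r) - 1 then (y (pos_succ r) - y (pos r)) * e i
  else if i (pos_succ r) == i (pos r) + 1 then (y (pos r) - y (pos_succ r)) * e i
  else e i.

Definition klr_braid (r s : 'I_n.-1) (i : res_seq p n) : A :=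
  if (i (pos r) == i (pos_succ s)) && (i (pos r) == i (pos_succ r) + 1) then - e i
  else if (i (pos r) == i (pos_succ s)) && (i (pos r) == i (pos_succ r) - 1)
  then e i else 0.

(** Stated over any ring, so that it can be asserted of the opposite ring [A^c], where products are
    reversed. *)
Record klr : Prop := Klr {
  klr_eM : forall i j, e i * e j = if i == j then e i else 0;
  klr_sum_e : \sum_i e i = 1;
  klr_ye : forall r i, y r * e i = e i * y r;
  klr_psie : forall r i, psi r * e i = e (swap_res r i) * psi r;
  klr_yy : forall r s, y r * y s = y s * y r;
  klr_psiy : forall r s, s != pos r -> s != pos_succ r ->
    psi r * y s = y s * psi r;
  klr_psipsi : forall r s : 'I_n.-1, (r.+1 < s)%N || (s.+1 < r)%N ->
    psi r * psi s = psi s * psi r;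
  klr_ypsi : forall r (i : res_seq p n), y (pos r) * psi r * e i =
    (psi r * y (pos_succ r) + (i (pos r) == i (pos_succ r))%:R) * e i;
  klr_ySpsi : forall r (i : res_seq p n), y (pos_succ r) * psi r * e i =
    (psi r * y (pos r) - (i (pos r) == i (pos_succ r))%:R) * e i;
  klr_psi_sq : forall r i, psi r * psi r * e i = klr_quad r i;
  klr_braidE : forall (r s : 'I_n.-1) i, s = r.+1 :> nat ->
    (psi r * psi s * psi r - psi s * psi r * psi s) * e i = klr_braid r s i;
  klr_cyclotomic : forall (r : 'I_n) (i : res_seq p n), r = 0%N :> nat ->
    y r ^+ (i r == 0) * e i = 0
}.
End Def.

Section Theory.
Variables (A : pzRingType) (e : res_seq p n -> A) (y : 'I_n -> A).
Variable psi : 'I_n.-1 -> A.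
Hypothesis K : klr e y psi.

Lemma klr_eE i : e i * e i = e i.
Proof. by rewrite (klr_eM K) eqxx. Qed.

Lemma klr_eM0 i j : i != j -> e i * e j = 0.
Proof. by rewrite (klr_eM K) => /negbTE->. Qed.

Lemma klr_epsi r i : e i * psi r = psi r * e (swap_res r i).
Proof. by rewrite (klr_psie K) swap_resK. Qed.

Lemma klr_ypsi_l r (i : res_seq p n) :
  e i * (psi r * y (pos r)) =
  e i * (y (pos_succ r) * psi r + (i (pos r) == i (pos_succ r))%:R).
Proof.
have := klr_ySpsi K r (swap_res r i); rewrite swap_res_pos swap_res_pos_succ mulrBl.
move/eqP; rewrite eq_sym subr_eq => /eqP E.
rewrite mulrA klr_epsi -[LHS]mulrA -(klr_ye K) mulrA E -mulrA -klr_epsi mulrA (klr_ye K) -mulrA.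
rewrite mulrDr eq_sym; case: eqP => [h|_]; last by rewrite mul0r mulr0.
by rewrite swap_res_id // mulr1 mul1r.
Qed.

Lemma klr_ySpsi_l r (i : res_seq p n) :
  e i * (psi r * y (pos_succ r)) =
  e i * (y (pos r) * psi r - (i (pos r) == i (pos_succ r))%:R).
Proof.
have := klr_ypsi K r (swap_res r i); rewrite swap_res_pos swap_res_pos_succ mulrDl.
move/eqP; rewrite -subr_eq => /eqP E.
rewrite mulrA klr_epsi -[LHS]mulrA -(klr_ye K) mulrA -E -mulrA -klr_epsi mulrA (klr_ye K) -mulrA.
rewrite mulrBr eq_sym; case: eqP => [h|_]; last by rewrite mul0r mulr0.
by rewrite swap_res_id // mulr1 mul1r.
Qed.

Lemma klr_psi_sq_l r i : e i * (psi r * psi r) = klr_quad (A := A^c) e y r i.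
Proof.
rewrite mulrA klr_epsi -mulrA klr_epsi swap_resK mulrA (klr_psi_sq K) /klr_quad.
case: ifP => // _.
case: ifP => _; first by rewrite mulrBl !(klr_ye K) -mulrBr.
case: ifP => _; first by rewrite mulrBl !(klr_ye K) -mulrBr.
by [].
Qed.

Lemma klr_braid_l (r s : 'I_n.-1) i : s = r.+1 :> nat ->
  e i * (psi r * (psi s * psi r) - psi s * (psi r * psi s)) =
  klr_braid (A := A^c) e r s i.
Proof.
move=> h.
have tr a b : e i * (psi a * (psi b * psi a)) =
    psi a * psi b * psi a * e (swap_res a (swap_res b (swap_res a i))).
  by rewrite mulrA klr_epsi -mulrA [e _ * _]mulrA klr_epsi -[_ * _ * psi a]mulrA klr_epsi !mulrA.
rewrite mulrBr !tr (swap_res_braid _ h).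
set j := swap_res s _; rewrite -mulrBl (klr_braidE K _ h) /klr_braid.
have prs : pos s = pos_succ r by apply: val_inj.
have [n1 n2 n3] : [/\ pos_succ r != pos r, pos_succ s != pos_succ r &
                   pos_succ s != pos r].
  by split; rewrite -(inj_eq val_inj) /=; apply/eqP; lia.
have T : (tperm (pos r) (pos_succ r) (pos r) = pos_succ r) *
  (tperm (pos r) (pos_succ r) (pos_succ r) = pos r) *
  (tperm (pos r) (pos_succ r) (pos_succ s) = pos_succ s) *
  (tperm (pos_succ r) (pos_succ s) (pos_succ r) = pos_succ s) *
  (tperm (pos_succ r) (pos_succ s) (pos_succ s) = pos_succ r) *
  (tperm (pos_succ r) (pos_succ s) (pos r) = pos r).
  by do !split; rewrite ?tpermL ?tpermR ?tpermD // eq_sym.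
have jE k : j k = i (tperm (pos s) (pos_succ s) (tperm (pos r) (pos_succ r)
              (tperm (pos s) (pos_succ s) k))) by rewrite !ffunE.
have j1 : j (pos r) = i (pos_succ s) by rewrite jE prs !T.
have j2 : j (pos_succ r) = i (pos_succ r).
  by rewrite jE prs !T.
have j3 : j (pos_succ s) = i (pos r) by rewrite jE prs !T.
(* The sequence [j] is [i] with its two outer entries exchanged, and the right side vanishes unless
   these agree. *)
have ij : i (pos r) == i (pos_succ s) -> j = i.
  move=> /eqP hi; apply/ffunP => k.
  case: (altP (k =P pos r)) => [->|k1]; first by rewrite j1.
  case: (altP (k =P pos_succ r)) => [->|k2]; first by rewrite j2.
  case: (altP (k =P pos_succ s)) => [->|k3]; first by rewrite j3.
  by rewrite jE prs !tpermD // eq_sym.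
rewrite j1 j2 j3 eq_sym.
by case: eqP => [hi|] //=; rewrite ij ?hi.
Qed.

(** Moving the idempotent from the right of a word in the [psi] to its left permutes the residue
    sequence, and each relation for the permuted sequence is the relation for the original one read
    backwards. This symmetry is what makes the anti-involution exist. *)
Lemma klr_converse : klr (A := A^c) e y psi.
Proof.
split=> //.
- by move=> i j; rewrite [LHS](klr_eM K) eq_sym; case: eqP => [->|].
- exact: klr_sum_e K.
- by move=> r i; rewrite [LHS](esym (klr_ye K r i)).
- by move=> r i; rewrite [LHS]klr_epsi.
- by move=> r s; rewrite [LHS](klr_yy K).
- by move=> r s h1 h2; rewrite [RHS](klr_psiy K).
- by move=> r s h; rewrite [RHS](klr_psipsi K h).
- by move=> r i; rewrite [LHS]klr_ypsi_l.
- by move=> r i; rewrite [LHS]klr_ySpsi_l.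
- by move=> r i; rewrite [LHS]klr_psi_sq_l.
- by move=> r s i h; rewrite [LHS]klr_braid_l.
- move=> r i h; have := klr_cyclotomic K i h.
  case: (i r == 0) => E; last by move: E; rewrite !expr0 !mul1r.
  by move: E; rewrite !expr1 => E; rewrite [LHS](esym (klr_ye K r i)).
Qed.

End Theory.
End Klr.

Lemma eq_through (T : Type) (a b u v : T) : a = u -> b = v -> u = v -> a = b.
Proof. by move=> -> ->. Qed.

(** * The relations in [qH] and its anti-involution *)

Section QuiverHeckeRelations.
Variables (kk : fieldType) (p n : nat).
Local Notation F := (free_alg kk (generator p n)).
Local Notation H := (qH kk p n).

Local Opaque free_e free_y free_psi quot_mul quot_add quot_opp quot_scale.

Definition piH (x : F) : H := quot_pi _ x.

Local Notation e := (@e_ kk p n).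
Local Notation y := (@y_ kk p n).
Local Notation psi := (@psi_ kk p n).

Lemma piHK u : exists x, piH x = u.
Proof. by exists (repr u); exact: quot_piK. Qed.

Lemma piHD x z : piH (x + z) = piH x + piH z.
Proof. by symmetry; exact: quot_addE. Qed.

Lemma piHN x : piH (- x) = - piH x.
Proof. by symmetry; exact: quot_oppE. Qed.

Lemma piHB x z : piH (x - z) = piH x - piH z.
Proof. by rewrite piHD piHN. Qed.

Lemma piHM x z : piH (x * z) = piH x * piH z.
Proof. by symmetry; exact: quot_mulE. Qed.

Lemma piHZ c x : piH (c *: x) = c *: piH x.
Proof. by symmetry; exact: quot_scaleE. Qed.

Lemma piH0 : piH 0 = 0. Proof. by []. Qed.
Lemma piH1 : piH 1 = 1. Proof. by []. Qed.

Lemma piH_sum I (r : seq I) P (f : I -> F) :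
  piH (\sum_(i <- r | P i) f i) = \sum_(i <- r | P i) piH (f i).
Proof. exact: (big_morph piH piHD piH0). Qed.

Lemma piH_nat b : piH b%:R = b%:R.
Proof. by elim: b => // b ih; rewrite !mulrSr piHD ih. Qed.

Lemma piH_rel a b : qH_rel a b -> piH a = piH b.
Proof.
move=> ab; apply/quot_piP; rewrite -[a - b]addr0 -[a - b]mul1r -[1 * _]mulr1.
by apply: ideal_genD; [exists a, b | apply: ideal_gen0].
Qed.

Lemma piH_eq0 x :
  piH x = 0 -> ideal_gen (fun x : F => exists a b, qH_rel a b /\ x = a - b) x.
Proof. by move=> h; have /quot_piP := (h : quot_pi _ x = quot_pi _ 0); rewrite subr0. Qed.

Lemma qHZl c (u v : H) : c *: (u * v) = (c *: u) * v.
Proof. exact: quot_scaleAl. Qed.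

Lemma qHZr c (u v : H) : c *: (u * v) = u * (c *: v).
Proof. exact: quot_scaleAr. Qed.

Lemma piH_mulE x z u v : piH x = u -> piH z = v -> piH (x * z) = u * v.
Proof. by move=> <- <-; exact: piHM. Qed.

Lemma piH_addE x z u v : piH x = u -> piH z = v -> piH (x + z) = u + v.
Proof. by move=> <- <-; exact: piHD. Qed.

Lemma piH_subE x z u v : piH x = u -> piH z = v -> piH (x - z) = u - v.
Proof. by move=> <- <-; exact: piHB. Qed.

Lemma piH_oppE x u : piH x = u -> piH (- x) = - u.
Proof. by move=> <-; exact: piHN. Qed.

Lemma piH_relE a b u v : qH_rel a b -> piH a = u -> piH b = v -> u = v.
Proof. by move=> /piH_rel E <- <-. Qed.

Lemma qH_eM i j : e i * e j = if i == j then e i else 0.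
Proof.
apply: (piH_relE (rel_idem kk i j)); first exact: piH_mulE.
by case: ifP.
Qed.

Lemma qH_sum_e : \sum_i e i = 1.
Proof. by apply: (piH_relE (rel_one kk p n)) => //; exact: piH_sum. Qed.

Lemma qH_ye r i : y r * e i = e i * y r.
Proof. by apply: (piH_relE (rel_y_e kk r i)); exact: piH_mulE. Qed.

Lemma qH_psie r i : psi r * e i = e (swap_res r i) * psi r.
Proof. by apply: (piH_relE (rel_psi_e kk r i)); exact: piH_mulE. Qed.

Lemma qH_yy r s : y r * y s = y s * y r.
Proof. by apply: (piH_relE (rel_y_y kk p r s)); exact: piH_mulE. Qed.

Lemma qH_psiy r s : s != pos r -> s != pos_succ r -> psi r * y s = y s * psi r.
Proof. by move=> h h'; apply: (piH_relE (rel_psi_y kk p h h')); exact: piH_mulE. Qed.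

Lemma qH_psipsi (r s : 'I_n.-1) : (r.+1 < s)%N || (s.+1 < r)%N ->
  psi r * psi s = psi s * psi r.
Proof. by move=> h; apply: (piH_relE (rel_psi_psi kk p h)); exact: piH_mulE. Qed.

Lemma qH_ypsi r (i : res_seq p n) :
  y (pos r) * psi r * e i =
  (psi r * y (pos_succ r) + (i (pos r) == i (pos_succ r))%:R) * e i.
Proof.
exact: (piH_relE (rel_y_psi kk r i)
  (piH_mulE (piH_mulE erefl erefl) erefl)
  (piH_mulE (piH_addE (piH_mulE erefl erefl) (piH_nat _)) erefl)).
Qed.

Lemma qH_ySpsi r (i : res_seq p n) :
  y (pos_succ r) * psi r * e i =
  (psi r * y (pos r) - (i (pos r) == i (pos_succ r))%:R) * e i.
Proof.
exact: (piH_relE (rel_ysucc_psi kk r i)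
  (piH_mulE (piH_mulE erefl erefl) erefl)
  (piH_mulE (piH_subE (piH_mulE erefl erefl) (piH_nat _)) erefl)).
Qed.

Lemma qH_psi_sq r (i : res_seq p n) : psi r * psi r * e i = klr_quad e y r i.
Proof.
apply: (piH_relE (rel_psi_sq kk r i)).
  exact: (piH_mulE (piH_mulE erefl erefl) erefl).
rewrite /klr_quad; case: ifP => _; first exact: piH0.
case: ifP => _; first exact: (piH_mulE (piH_subE erefl erefl) erefl).
case: ifP => _; first exact: (piH_mulE (piH_subE erefl erefl) erefl).
exact: erefl.
Qed.

Lemma qH_braid (r s : 'I_n.-1) (i : res_seq p n) : s = r.+1 :> nat ->
  (psi r * psi s * psi r - psi s * psi r * psi s) * e i = klr_braid e r s i.
Proof.
move=> h; apply: (piH_relE (rel_braid kk i h)).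
  exact: (piH_mulE (piH_subE (piH_mulE (piH_mulE erefl erefl) erefl)
                             (piH_mulE (piH_mulE erefl erefl) erefl)) erefl).
rewrite /klr_braid; case: ifP => _; first exact: (piH_oppE erefl).
by case: ifP => _; [exact: erefl | exact: piH0].
Qed.

Lemma qH_cyclotomic (r : 'I_n) (i : res_seq p n) : r = 0%N :> nat ->
  y r ^+ (i r == 0) * e i = 0.
Proof.
move=> h; apply: (piH_relE (rel_cyclotomic kk i h)); last exact: piH0.
by apply: (piH_mulE _ erefl); case: (i r == 0); [exact: erefl | exact: piH1].
Qed.

Lemma piH_e i : piH (free_e kk i) = e i. Proof. by []. Qed.

Lemma klr_qH : klr e y psi.
Proof.
exact: (Klr qH_eM qH_sum_e qH_ye qH_psie qH_yy qH_psiy qH_psipsi qH_ypsi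
  qH_ySpsi qH_psi_sq qH_braid qH_cyclotomic).
Qed.

Definition rmulgen (g : generator p n) (u : H) : H := u * piH (free_var kk g).

Fact rmulgen_linear g : linear (rmulgen g).
Proof. by move=> c u v; rewrite /rmulgen mulrDl -qHZl. Qed.

HB.instance Definition _ g :=
  GRing.isLinear.Build kk H H _ (rmulgen g) (rmulgen_linear g).

Local Notation ract := (@act kk (generator p n) kk idfun H (fun g => rmulgen g)).

(** Letting the generators act by right multiplication reverses products, so the value at 1 is an
    anti-morphism from the free algebra that sends generators to generators. *)
Definition star0 (x : F) : H := ract x 1.

Lemma ractE x u : ract x u = u * star0 x.
Proof.
have hw w v : word_op (fun g => rmulgen g) w v = v * word_op (fun g => rmulgen g) w 1.
  elim: w v => [|g w ih] v; first by rewrite [RHS]mulr1.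
  rewrite -cat1s !word_op_cat /= [word_op _ w v]ih.
  exact: (esym (mulrA v _ _)).
rewrite /star0 /act big_distrr /=; apply: eq_bigr => m _.
by rewrite hw; exact: qHZr.
Qed.

Lemma star0M x z : star0 (x * z) = star0 z * star0 x.
Proof. by rewrite [LHS]actM ractE. Qed.
Lemma star0D x z : star0 (x + z) = star0 x + star0 z.
Proof. exact: actDl. Qed.
Lemma star0B x z : star0 (x - z) = star0 x - star0 z.
Proof. exact: actBl. Qed.
Lemma star0N x : star0 (- x) = - star0 x.
Proof. exact: actNl. Qed.
Lemma star0_0 : star0 0 = 0. Proof. exact: act0l. Qed.
Lemma star0_1 : star0 1 = 1. Proof. exact: act1l. Qed.
Lemma star0_nat b : star0 b%:R = b%:R.
Proof.
elim: b => [|b ih]; first exact: star0_0.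
by rewrite mulrSr star0D ih star0_1 [RHS]mulrSr.
Qed.
Lemma star0_var g : star0 (free_var kk g) = piH (free_var kk g).
Proof. by rewrite [LHS]act_var; exact: mul1r. Qed.
Lemma star0_e i : star0 (free_e kk i) = e i. Proof. exact: star0_var. Qed.
Lemma star0_y r : star0 (free_y kk p r) = y r. Proof. exact: star0_var. Qed.
Lemma star0_psi r : star0 (free_psi kk p r) = psi r. Proof. exact: star0_var. Qed.

Lemma star0_mulE x z u v : star0 x = u -> star0 z = v -> star0 (x * z) = v * u.
Proof. by move=> <- <-; exact: star0M. Qed.
Lemma star0_addE x z u v : star0 x = u -> star0 z = v -> star0 (x + z) = u + v.
Proof. by move=> <- <-; exact: star0D. Qed.
Lemma star0_subE x z u v : star0 x = u -> star0 z = v -> star0 (x - z) = u - v.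
Proof. by move=> <- <-; exact: star0B. Qed.
Lemma star0_oppE x u : star0 x = u -> star0 (- x) = - u.
Proof. by move=> <-; exact: star0N. Qed.

Lemma star0_rel a b : qH_rel a b -> star0 a = star0 b.
Proof.
have C := klr_converse klr_qH.
case=> {a b}.
- move=> i j; apply: (eq_through _ _ (klr_eM C i j)).
    exact: (star0_mulE (star0_e i) (star0_e j)).
  by case: ifP => _; [exact: star0_e | exact: star0_0].
- apply: (eq_through _ star0_1 (klr_sum_e C)).
  rewrite (big_morph star0 star0D star0_0); apply: eq_bigr => i _; exact: star0_e.
- move=> r i; exact: (eq_through (star0_mulE (star0_y r) (star0_e i))
    (star0_mulE (star0_e i) (star0_y r)) (klr_ye C r i)).
- move=> r i; exact: (eq_through (star0_mulE (star0_psi r) (star0_e i))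
    (star0_mulE (star0_e _) (star0_psi r)) (klr_psie C r i)).
- move=> r s; exact: (eq_through (star0_mulE (star0_y r) (star0_y s))
    (star0_mulE (star0_y s) (star0_y r)) (klr_yy C r s)).
- move=> r s h h'; exact: (eq_through (star0_mulE (star0_psi r) (star0_y s))
    (star0_mulE (star0_y s) (star0_psi r)) (klr_psiy C h h')).
- move=> r s h; exact: (eq_through (star0_mulE (star0_psi r) (star0_psi s))
    (star0_mulE (star0_psi s) (star0_psi r)) (klr_psipsi C h)).
- move=> r i; exact: (eq_through
    (star0_mulE (star0_mulE (star0_y _) (star0_psi r)) (star0_e i))
    (star0_mulE (star0_addE (star0_mulE (star0_psi r) (star0_y _)) (star0_nat _))
       (star0_e i)) (klr_ypsi C r i)).
- move=> r i; exact: (eq_through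
    (star0_mulE (star0_mulE (star0_y _) (star0_psi r)) (star0_e i))
    (star0_mulE (star0_subE (star0_mulE (star0_psi r) (star0_y _)) (star0_nat _))
       (star0_e i)) (klr_ySpsi C r i)).
- move=> r i; apply: (eq_through
    (star0_mulE (star0_mulE (star0_psi r) (star0_psi r)) (star0_e i)) _
    (klr_psi_sq C r i)).
  rewrite /klr_quad; case: ifP => _; first exact: star0_0.
  case: ifP => _.
    exact: (star0_mulE (star0_subE (star0_y _) (star0_y _)) (star0_e i)).
  case: ifP => _; last exact: star0_e.
  exact: (star0_mulE (star0_subE (star0_y _) (star0_y _)) (star0_e i)).
- move=> r s i h; apply: (eq_through
    (star0_mulE (star0_subE
      (star0_mulE (star0_mulE (star0_psi r) (star0_psi s)) (star0_psi r))
      (star0_mulE (star0_mulE (star0_psi s) (star0_psi r)) (star0_psi s)))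
      (star0_e i)) _ (klr_braidE C i h)).
  rewrite /klr_braid; case: ifP => _; first exact: (star0_oppE (star0_e i)).
  by case: ifP => _; [exact: star0_e | exact: star0_0].
- move=> r i h; apply: (eq_through _ star0_0 (klr_cyclotomic C i h)).
  apply: (star0_mulE _ (star0_e i)).
  by case: (i r == 0); [exact: star0_y | exact: star0_1].
Qed.

Definition star (u : H) : H := star0 (repr u).

(** This is independence of the representative: [star0] agrees on the two sides of a relation, as
    the relations also hold in the opposite ring, so the ideal they generate acts by zero. *)
Lemma starE x : star (piH x) = star0 x.
Proof.
apply/eqP; rewrite -subr_eq0; apply/eqP; apply: (etrans (esym (star0B _ _))).
have h := quot_repr (fun x : F => exists a b, qH_rel a b /\ x = a - b) x.
refine (@act_ideal_gen kk (generator p n) kk idfun H (fun g => rmulgen g)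
  _ (fun _ => True) (fun u => u = 0) _ _ _ _ _ _ _ _ _ h I) => //.
- by move=> g u ->; rewrite linear0.
- by move=> c u v -> ->; rewrite scaler0 addr0.
- move=> g u [a [b [ab ->]]] _; rewrite ractE.
  by rewrite star0B (star0_rel ab) subrr mulr0.
Qed.

Lemma starM u v : star (u * v) = star v * star u.
Proof.
have [x <-] := piHK u; have [z <-] := piHK v.
by rewrite (esym (piHM x z)) !starE star0M.
Qed.
Lemma starD u v : star (u + v) = star u + star v.
Proof.
have [x <-] := piHK u; have [z <-] := piHK v.
by rewrite (esym (piHD x z)) !starE star0D.
Qed.
Lemma starZ c u : star (c *: u) = c *: star u.
Proof. by have [x <-] := piHK u; rewrite (esym (piHZ c x)) !starE; exact: actZl. Qed.
Lemma star_0 : star 0 = 0. Proof. exact: (etrans (starE 0) star0_0). Qed.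
Lemma star_1 : star 1 = 1. Proof. exact: (etrans (starE 1) star0_1). Qed.
Lemma star_e i : star (e i) = e i.
Proof. exact: (etrans (starE _) (star0_e _)). Qed.
Lemma star_y r : star (y r) = y r.
Proof. exact: (etrans (starE _) (star0_y _)). Qed.
Lemma star_psi r : star (psi r) = psi r.
Proof. exact: (etrans (starE _) (star0_psi _)). Qed.

Lemma homogeneous_star d u : homogeneous d u -> homogeneous d (star u).
Proof.
elim=> {d u} [i|r|r i|d|d c u v _ hu _ hv|d d' u v _ hu _ hv].
- by rewrite star_e; constructor.
- by rewrite star_y; constructor.
- rewrite starM star_e star_psi (klr_epsi klr_qH) -psi_deg_swap; constructor.
- by rewrite star_0; constructor.
- by rewrite starD starZ; constructor.
- by rewrite starM addrC; constructor.
Qed.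

End QuiverHeckeRelations.

(** * Graded action on functions of the degree *)

Section GradedOperators.
Variables (p n : nat) (A : pzRingType).
Variables (e : res_seq p n -> A) (y : 'I_n -> A) (psi : 'I_n.-1 -> A).
Hypothesis K : klr e y psi.

(** A function [m] stands for the formal series of the terms [m d] t^d: a homogeneous element
    multiplies the coefficients and shifts the exponent by its degree. The degree of [psi r] depends
    on the residue sequence, hence the sum over idempotents in [opP]. *)
Definition opE i (m : int -> A) : int -> A := fun d => e i * m d.
Definition opY r (m : int -> A) : int -> A := fun d => y r * m (d - 2).
Definition opP r (m : int -> A) : int -> A :=
  fun d => \sum_i psi r * (e i * m (d - psi_deg r i)).

Definition supported i (m : int -> A) := forall d, e i * m d = m d.

Lemma supported_opE i m : supported i (opE i m).
Proof. by move=> d; rewrite /opE mulrA (klr_eE K). Qed.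

Lemma opE_supported i j m : supported i m ->
  opE j m = if j == i then m else fun=> 0.
Proof.
move=> h; apply/funext => d; rewrite /opE -h mulrA (klr_eM K).
by case: eqP => [->|]; rewrite ?h ?mul0r.
Qed.

Lemma supported_opY i r m : supported i m -> supported i (opY r m).
Proof. by move=> h d; rewrite /opY mulrA -(klr_ye K) -mulrA h. Qed.

Lemma opP_supported i r m : supported i m ->
  opP r m = fun d => psi r * m (d - psi_deg r i).
Proof.
move=> h; apply/funext => d; rewrite /opP (bigD1 i) //= h big1 ?addr0 //.
by move=> j ji; rewrite -h [e j * _]mulrA (klr_eM0 K) // mul0r mulr0.
Qed.

Lemma supported_opP i r m : supported i m -> supported (swap_res r i) (opP r m).
Proof.
move=> h d; rewrite (opP_supported r h) mulrA -(klr_psie K) -mulrA h //.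
Qed.

Lemma opP_sum r m d :
  opP r m d = \sum_i opP r (opE i m) d.
Proof.
rewrite /opP; apply: eq_bigr => i _; rewrite (bigD1 i) //= big1 ?addr0.
  by rewrite /opE [e i * (e i * _)]mulrA (klr_eE K).
by move=> j ji; rewrite /opE [e j * _]mulrA (klr_eM0 K) // mul0r mulr0.
Qed.

Lemma opE_opP r i m : opP r (opE i m) = opE (swap_res r i) (opP r m).
Proof.
apply/funext => d; rewrite (opP_supported r (@supported_opE i m)).
rewrite /opE /opP big_distrr /= (bigD1 i) //= big1 ?addr0.
  by rewrite !mulrA -(klr_psie K) -[psi r * e i * e i]mulrA (klr_eE K).
move=> j ji; rewrite mulrA -(klr_psie K) -mulrA [e i * _]mulrA (klr_eM0 K) ?mul0r ?mulr0 //.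
by rewrite eq_sym.
Qed.

Lemma opP_opY r (s : 'I_n) m : s != pos r -> s != pos_succ r ->
  opP r (opY s m) = opY s (opP r m).
Proof.
move=> h1 h2; apply/funext => d; rewrite /opP /opY big_distrr /=.
apply: eq_bigr => i _; rewrite [e i * _]mulrA -(klr_ye K) !mulrA.
by rewrite (klr_psiy K) // addrAC.
Qed.

Lemma opP_opP (r s : 'I_n.-1) m : (r.+1 < s)%N || (s.+1 < r)%N ->
  opP r (opP s m) = opP s (opP r m).
Proof.
move=> h; apply/funext => d; rewrite opP_sum [RHS]opP_sum.
have E a b i : opP a (opE i (opP b m)) = opP a (opP b (opE (swap_res b i) m)).
  by have := opE_opP b (swap_res b i) m; rewrite swap_resK => ->.
under eq_bigr => i _ do rewrite E.
under [RHS]eq_bigr => i _ do rewrite E.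
rewrite (reindex_inj (inv_inj (@swap_resK p n s))) /=.
rewrite [RHS](reindex_inj (inv_inj (@swap_resK p n r))) /=.
apply: eq_bigr => i _; rewrite !swap_resK {E}.
move: (opE i m) (@supported_opE i m) => {}m hi.
rewrite (opP_supported r (supported_opP s hi)) (opP_supported s hi).
rewrite (opP_supported s (supported_opP r hi)) (opP_supported r hi).
rewrite !mulrA (klr_psipsi K h); congr (_ * m _).
have h' : (s.+1 < r)%N || (r.+1 < s)%N by rewrite orbC.
have [a1 a2 _] := swap_res_pos_neq i h; have [b1 b2 _] := swap_res_pos_neq i h'.
by rewrite /psi_deg a1 a2 b1 b2 addrAC.
Qed.

Lemma opY_opP r i m : supported i m ->
  opY (pos r) (opP r m) = fun d => opP r (opY (pos_succ r) m) d
     + (i (pos r) == i (pos_succ r))%:R * m d.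
Proof.
move=> h; apply/funext => d.
rewrite (opP_supported r h) (opP_supported r (supported_opY _ h)) /opY.
rewrite -[m (d - 2 - _)]h !mulrA (klr_ypsi K) -mulrA h.
rewrite mulrDl [d - 2 - _]addrAC; congr (_ + _).
rewrite /psi_deg; case: eqP => //= _; last by rewrite !mul0r.
by rewrite !mul1r; congr (m _); lia.
Qed.

Lemma opYS_opP r i m : supported i m ->
  opY (pos_succ r) (opP r m) = fun d => opP r (opY (pos r) m) d
     - (i (pos r) == i (pos_succ r))%:R * m d.
Proof.
move=> h; apply/funext => d.
rewrite (opP_supported r h) (opP_supported r (supported_opY _ h)) /opY.
rewrite -[m (d - 2 - _)]h !mulrA (klr_ySpsi K) -mulrA h.
rewrite mulrBl [d - 2 - _]addrAC; congr (_ - _).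
rewrite /psi_deg; case: eqP => //= _; last by rewrite !mul0r.
by rewrite !mul1r; congr (m _); lia.
Qed.

Lemma opP_sq r i m : supported i m ->
  opP r (opP r m) =
  if i (pos r) == i (pos_succ r) then fun=> 0
  else if i (pos_succ r) == i (pos r) - 1 then
    fun d => opY (pos_succ r) m d - opY (pos r) m d
  else if i (pos_succ r) == i (pos r) + 1 then
    fun d => opY (pos r) m d - opY (pos_succ r) m d
  else m.
Proof.
move=> h; apply/funext => d.
rewrite (opP_supported r (supported_opP r h)) (opP_supported r h) psi_deg_swap.
rewrite -h !mulrA (klr_psi_sq K) /klr_quad /psi_deg /opY.
case: ifP => _; first by rewrite mul0r.
have E (a b : 'Z_p) : (b == a - 1) = (a == b + 1) by rewrite eq_sym subr_eq.
rewrite (E (i (pos r)) (i (pos_succ r))) -(E (i (pos_succ r)) (i (pos r))).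
case: ifP => [_|_] /=.
  by rewrite -mulrA h mulrBl; congr (_ * m _ - _ * m _); lia.
case: ifP => [_|_] /=; last by rewrite h !subr0.
by rewrite -mulrA h mulrBl; congr (_ * m _ - _ * m _); lia.
Qed.

Lemma opP_braid (r s : 'I_n.-1) i m : s = r.+1 :> nat -> supported i m ->
  (fun d => opP r (opP s (opP r m)) d - opP s (opP r (opP s m)) d) =
  if (i (pos r) == i (pos_succ s)) && (i (pos r) == i (pos_succ r) + 1)
  then fun d => - m d
  else if (i (pos r) == i (pos_succ s)) && (i (pos r) == i (pos_succ r) - 1)
  then m else fun=> 0.
Proof.
move=> rs h; apply/funext => d.
have h1 := supported_opP r h; have h2 := supported_opP s h.
rewrite (opP_supported r (supported_opP s h1)) (opP_supported s h1).
rewrite (opP_supported s (supported_opP r h2)) (opP_supported r h2).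
rewrite (opP_supported r h) (opP_supported s h).
have prs : pos s = pos_succ r by apply: val_inj.
have nrs : pos_succ s != pos r by rewrite -(inj_eq val_inj) /=; apply/eqP; lia.
have nrs' : pos_succ s != pos_succ r by rewrite -(inj_eq val_inj) /=; apply/eqP; lia.
have nsr : pos r != pos_succ r by rewrite -(inj_eq val_inj) /=; apply/eqP; lia.
have D : [/\ psi_deg r (swap_res s (swap_res r i)) = psi_deg s i,
   psi_deg s (swap_res r (swap_res s i)) = psi_deg r i &
   psi_deg s (swap_res r i) = psi_deg r (swap_res s i)].
  have a1 j : swap_res s j (pos r) = j (pos r).
    by rewrite swap_res_other // ?prs // eq_sym.
  have a2 j : swap_res r j (pos_succ s) = j (pos_succ s).
    by rewrite swap_res_other.
  have a3 j : swap_res s j (pos_succ r) = j (pos_succ s) by rewrite -prs swap_res_pos.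
  have a4 j : swap_res s j (pos_succ s) = j (pos_succ r) by rewrite swap_res_pos_succ prs.
  by rewrite /psi_deg prs !(a1, a2, a3, a4, swap_res_pos, swap_res_pos_succ).
case: D => -> -> ->.
set D := d - _ - _ - _; have -> : d - psi_deg r i - psi_deg r (swap_res s i) - psi_deg s i = D.
  by rewrite /D; lia.
rewrite -h !mulrA -!mulrBl (klr_braidE K _ rs) /klr_braid.
(* When the correction term is present, the three shifts are 1, 1 and -2 in some order, so they
   cancel. *)
have DE : i (pos r) = i (pos_succ s) ->
    i (pos r) = i (pos_succ r) + 1 \/ i (pos r) = i (pos_succ r) - 1 -> D = d.
  move=> E1 E2.
  have o : (1 : 'Z_p) != 0 by rewrite oner_eq0.
  have E (a b : 'Z_p) : (b == a - 1) = (a == b + 1) by rewrite eq_sym subr_eq.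
  have [n1 n2] : i (pos r) != i (pos_succ r) /\
      (i (pos r) == i (pos_succ r) + 1) || (i (pos r) == i (pos_succ r) - 1).
    case: E2 => ->; split; rewrite ?eqxx ?orbT //.
      by rewrite -subr_eq0 addrAC subrr add0r.
    by rewrite -subr_eq0 addrAC subrr add0r oppr_eq0.
  have d1 : psi_deg r i = 1 by rewrite /psi_deg (negbTE n1) n2.
  have d2 : psi_deg s i = 1.
    rewrite /psi_deg prs -E1 eq_sym (negbTE n1).
    by rewrite (E (i (pos r))) -(E (i (pos_succ r)) (i (pos r))) orbC n2.
  have d3 : psi_deg r (swap_res s i) = - 2.
    have a1 : swap_res s i (pos r) = i (pos r).
      by rewrite swap_res_other // ?prs // eq_sym.
    by rewrite /psi_deg a1 -prs swap_res_pos E1 eqxx.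
  by rewrite /D d1 d2 d3; lia.
case: (altP (i (pos r) =P i (pos_succ s))) => E1 /=; last by rewrite mul0r.
case: eqP => E2; first by rewrite DE //; [rewrite mulNr h|left].
by case: eqP => E3; [rewrite DE ?h //; right|rewrite mul0r].
Qed.

Lemma opY_cyclotomic (r : 'I_n) i m : r = 0%N :> nat -> supported i m ->
  (if i r == 0 then opY r m else m) = fun=> 0.
Proof.
move=> r0 h; apply/funext => d; have := klr_cyclotomic K i r0.
case: (i r == 0) => E; move: E; rewrite ?expr0 ?expr1 ?mul1r => E.
  by rewrite /opY -h mulrA E mul0r.
by rewrite -h E mul0r.
Qed.

Lemma opY_opY r s m : opY r (opY s m) = opY s (opY r m).
Proof. by apply/funext => d; rewrite /opY !mulrA (klr_yy K). Qed.

Lemma opY_opE r i m : opY r (opE i m) = opE i (opY r m).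
Proof. by apply/funext => d; rewrite /opY /opE !mulrA (klr_ye K). Qed.

End GradedOperators.

Lemma sum_linear (R : pzRingType) (W : lmodType R) (I : finType) (c : R)
    (f g h : I -> W) : (forall i, f i = c *: g i + h i) ->
  \sum_i f i = c *: (\sum_i g i) + \sum_i h i.
Proof.
by move=> E; rewrite (eq_bigr _ (fun i _ => E i)) big_split scaler_sumr.
Qed.

Lemma sum_mull (A : pzRingType) (I : finType) (f : I -> A) a :
  \sum_i (f i * a) = (\sum_i f i) * a.
Proof. by rewrite big_distrl. Qed.

(** * Homogeneous components of [qH] *)

Section Grading.
Variables (kk : fieldType) (p n : nat).
Local Notation F := (free_alg kk (generator p n)).
Local Notation H := (qH kk p n).
Local Notation M := (int -> H).
Local Notation e := (@e_ kk p n).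
Local Notation y := (@y_ kk p n).
Local Notation psi := (@psi_ kk p n).

Local Opaque free_e free_y free_psi quot_mul quot_add quot_opp quot_scale.

Definition gradop (g : generator p n) : M -> M :=
  match g with
  | inl (inl i) => opE e i
  | inl (inr r) => opY y r
  | inr r => opP e psi r
  end.

Fact gradop_linear g : linear (gradop g).
Proof.
have lin a c (u v : H) : a * (c *: u + v) = c *: (a * u) + a * v.
  exact: (etrans (mulrDr a _ v) (f_equal (fun w => w + a * v) (esym (qHZr c a u)))).
move=> c m m'; apply/funext => d; case: g => [[i|r]|r]; try exact: lin.
rewrite /= /opP.
have E i : psi r * (e i * (c *: m + m') (d - psi_deg r i)) =
   c *: (psi r * (e i * m (d - psi_deg r i))) + psi r * (e i * m' (d - psi_deg r i)).
  exact: (etrans (f_equal (fun v => psi r * v) (lin (e i) c _ _)) (lin (psi r) c _ _)).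
exact: sum_linear E.
Qed.

HB.instance Definition _ g := GRing.isLinear.Build kk M M _ (gradop g) (gradop_linear g).

Local Notation gract := (@act kk (generator p n) kk idfun M (fun g => gradop g)).

Lemma gract_e i m : gract (free_e kk i) m = opE e i m.
Proof. exact: act_var. Qed.
Lemma gract_y r m : gract (free_y kk p r) m = opY y r m.
Proof. exact: act_var. Qed.
Lemma gract_psi r m : gract (free_psi kk p r) m = opP e psi r m.
Proof. exact: act_var. Qed.

Lemma gract_mulE x z X Z : (forall m, gract x m = X m) ->
  (forall m, gract z m = Z m) -> forall m, gract (x * z) m = X (Z m).
Proof. by move=> hx hz m; rewrite actM hz hx. Qed.
Lemma gract_addE x z X Z : (forall m, gract x m = X m) ->
  (forall m, gract z m = Z m) -> forall m, gract (x + z) m = fun d => X m d + Z m d.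
Proof. by move=> hx hz m; rewrite actDl hz hx. Qed.
Lemma gract_subE x z X Z : (forall m, gract x m = X m) ->
  (forall m, gract z m = Z m) -> forall m, gract (x - z) m = fun d => X m d - Z m d.
Proof. by move=> hx hz m; rewrite actBl hz hx. Qed.
Lemma gract_oppE x X : (forall m, gract x m = X m) ->
  forall m, gract (- x) m = fun d => - X m d.
Proof. by move=> hx m; rewrite actNl hx. Qed.
Lemma gract_0 m : gract 0 m = fun=> 0.
Proof. exact: act0l. Qed.
Lemma gract_1 m : gract 1 m = m.
Proof. exact: act1l. Qed.
Lemma gract_bool (b : bool) m : gract b%:R m = fun d => b%:R * m d.
Proof.
case: b; first by rewrite [LHS]gract_1; apply/funext => d; exact: (esym (mul1r _)).
by rewrite [LHS]gract_0; apply/funext => d; exact: (esym (mul0r _)).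
Qed.

Let K := klr_qH kk p n.
Let sE i m := @supported_opE p n H _ _ _ K i m.

Lemma gract_rel a b : qH_rel a b -> forall m, gract a m = gract b m.
Proof.
case=> {a b}.
- move=> i j m; rewrite (gract_mulE (gract_e i) (gract_e j)).
  rewrite (opE_supported K i (sE j m)).
  case: ifP => [/eqP ->|_]; last by rewrite gract_0.
  by rewrite gract_e.
- move=> m; rewrite gract_1 act_suml (eq_bigr _ (fun i _ => gract_e i m)).
  apply/funext => d; rewrite fct_sumE.
  exact: (etrans (sum_mull e (m d))
    (etrans (f_equal (fun u => u * m d) (klr_sum_e K)) (mul1r (m d)))).
- move=> r i m; exact: (eq_through (gract_mulE (gract_y r) (gract_e i) m)
    (gract_mulE (gract_e i) (gract_y r) m) (opY_opE K r i m)).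
- move=> r i m; exact: (eq_through (gract_mulE (gract_psi r) (gract_e i) m)
    (gract_mulE (gract_e _) (gract_psi r) m) (opE_opP K r i m)).
- move=> r s m; exact: (eq_through (gract_mulE (gract_y r) (gract_y s) m)
    (gract_mulE (gract_y s) (gract_y r) m) (opY_opY K r s m)).
- move=> r s h h' m; exact: (eq_through (gract_mulE (gract_psi r) (gract_y s) m)
    (gract_mulE (gract_y s) (gract_psi r) m) (opP_opY K m h h')).
- move=> r s h m; exact: (eq_through (gract_mulE (gract_psi r) (gract_psi s) m)
    (gract_mulE (gract_psi s) (gract_psi r) m) (opP_opP K m h)).
- move=> r i m; exact: (eq_through
    (gract_mulE (gract_mulE (gract_y _) (gract_psi r)) (gract_e i) m)
    (gract_mulE (gract_addE (gract_mulE (gract_psi r) (gract_y _))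
      (gract_bool _)) (gract_e i) m) (opY_opP K r (sE i m))).
- move=> r i m; exact: (eq_through
    (gract_mulE (gract_mulE (gract_y _) (gract_psi r)) (gract_e i) m)
    (gract_mulE (gract_subE (gract_mulE (gract_psi r) (gract_y _))
      (gract_bool _)) (gract_e i) m) (opYS_opP K r (sE i m))).
- move=> r i m; apply: (eq_through
    (gract_mulE (gract_mulE (gract_psi r) (gract_psi r)) (gract_e i) m) _
    (opP_sq K r (sE i m))).
  case: ifP => _; first exact: gract_0.
  case: ifP => _.
    exact: (gract_mulE (gract_subE (gract_y _) (gract_y _)) (gract_e i) m).
  case: ifP => _; last exact: gract_e.
  exact: (gract_mulE (gract_subE (gract_y _) (gract_y _)) (gract_e i) m).
- move=> r s i h m; apply: (eq_through (gract_mulE (gract_subE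
      (gract_mulE (gract_mulE (gract_psi r) (gract_psi s)) (gract_psi r))
      (gract_mulE (gract_mulE (gract_psi s) (gract_psi r)) (gract_psi s)))
      (gract_e i) m) _ (opP_braid K h (sE i m))).
  case: ifP => _; first exact: (gract_oppE (gract_e i) m).
  by case: ifP => _; [exact: gract_e | exact: gract_0].
- move=> r i h m; apply: (eq_through _ (gract_0 m) (opY_cyclotomic K h (sE i m))).
  case: (i r == 0); first exact: (gract_mulE (gract_y r) (gract_e i) m).
  exact: (gract_mulE gract_1 (gract_e i) m).
Qed.

Definition hact (u : H) : M -> M := gract (repr u).

Lemma hactE x m : hact (piH x) m = gract x m.
Proof.
apply/eqP; rewrite -subr_eq0 /hact -actBl; apply/eqP.
have h := quot_repr (fun x : F => exists a b, qH_rel a b /\ x = a - b) x.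
refine (@act_ideal_gen kk (generator p n) kk idfun M (fun g => gradop g)
  _ (fun _ => True) (fun u => u = 0) _ _ _ _ _ _ _ _ _ h I) => //.
- by move=> g u ->; rewrite linear0.
- by move=> c u v -> ->; rewrite scaler0 addr0.
- move=> g u [a [b [ab ->]]] _.
  by rewrite actBl (gract_rel ab) subrr.
Qed.

Lemma hactM u v m : hact (u * v) m = hact u (hact v m).
Proof.
have [x <-] := piHK u; have [z <-] := piHK v.
by rewrite (esym (piHM x z)) !hactE actM.
Qed.

Lemma hactP c u v m : hact (c *: u + v) m = c *: hact u m + hact v m.
Proof.
have [x <-] := piHK u; have [z <-] := piHK v.
rewrite (esym (piHZ c x)) (esym (piHD _ _)) !hactE actDl actZl //.
Qed.

Lemma hact_homogeneous d u : homogeneous d u ->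
  forall m c, hact u m c = u * m (c - d).
Proof.
elim=> {d u} [i|r|r i|d|d c u v _ hu _ hv|d d' u v _ hu _ hv] m a.
- rewrite -[e i]/(piH (free_e kk i)) hactE gract_e /opE subr0; exact: erefl.
- rewrite -[y r]/(piH (free_y kk p r)) hactE gract_y; exact: erefl.
- rewrite hactM -[e i]/(piH (free_e kk i)) -[psi r]/(piH (free_psi kk p r)) !hactE.
  rewrite gract_e gract_psi (opP_supported K r (sE i m)); exact: (mulrA _ _ _).
- rewrite -(piH0 kk p n) hactE gract_0; exact: (esym (mul0r _)).
- rewrite hactP; apply: (etrans (congr2 (fun s t => c *: s + t) (hu m a) (hv m a))).
  rewrite [RHS]mulrDl; congr (_ + _); exact: qHZl.
- rewrite hactM hu hv (_ : a - (d + d') = a - d - d'); first exact: (mulrA _ _ _).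
  by rewrite opprD addrA.
Qed.

(** The coefficient of t^d in [u] applied to the constant series 1. On homogeneous elements it is
    the component of degree [d], which shows that distinct degrees are independent; the inductive
    predicate [homogeneous] does not give that by itself. *)
Definition proj (d : int) (u : H) : H := hact u (fun c => (c == 0)%:R) d.

Lemma projP d c u v : proj d (c *: u + v) = c *: proj d u + proj d v.
Proof. by rewrite /proj hactP. Qed.

Lemma proj_homogeneous d u d' : homogeneous d u ->
  proj d' u = if d' == d then u else 0.
Proof.
move=> h; rewrite /proj (hact_homogeneous h) subr_eq0.
by case: ifP => _; [exact: mulr1 | exact: mulr0].
Qed.

Lemma proj_homogM d a u d' : homogeneous d a ->
  proj d' (a * u) = a * proj (d' - d) u.
Proof. by move=> h; rewrite /proj hactM (hact_homogeneous h). Qed.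

End Grading.

(** * Counting factors of a composition chain *)

Definition is_submod (kk : fieldType) (V : lmodType kk) (L : V -> Prop) :=
  L 0 /\ forall c u v, L u -> L v -> L (c *: u + v).

Section Submodules.
Variables (kk : fieldType) (V : lmodType kk).
Implicit Types (L : V -> Prop) (u v : V).

Lemma submodD L u v : is_submod L -> L u -> L v -> L (u + v).
Proof. by case=> _ h hu hv; rewrite -[u]scale1r; apply: h. Qed.

Lemma submodZ L c u : is_submod L -> L u -> L (c *: u).
Proof. by case=> h0 h hu; rewrite -[_ *: _]addr0; apply: h. Qed.

Lemma submodN L u : is_submod L -> L u -> L (- u).
Proof. by move=> h hu; rewrite -scaleN1r; apply: submodZ. Qed.

Lemma submodB L u v : is_submod L -> L u -> L v -> L (u - v).
Proof. by move=> h hu hv; apply: submodD => //; apply: submodN. Qed.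

Lemma submod_sum L (I : Type) (r : seq I) (P : pred I) (f : I -> V) :
  is_submod L -> (forall i, P i -> L (f i)) -> L (\sum_(i <- r | P i) f i).
Proof.
move=> h hf; elim/big_ind: _ => //; first by case: h.
by move=> u v; apply: submodD.
Qed.

Lemma submod_sum_in L (I : eqType) (r : seq I) (f : I -> V) :
  is_submod L -> (forall i, i \in r -> L (f i)) -> L (\sum_(i <- r) f i).
Proof. by move=> h hf; rewrite big_seq; apply: submod_sum. Qed.

Lemma submod_trans L u v : is_submod L -> L (u - v) -> L v -> L u.
Proof. by move=> h huv hv; rewrite -(subrK v u); apply: submodD. Qed.

Lemma linear_sum_seq (W : lmodType kk) (I : Type) (r : seq I) (g : V -> W) a (f : I -> V) :
  linear g -> g (\sum_(i <- r) a i *: f i) = \sum_(i <- r) a i *: g (f i).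
Proof.
move=> lg; elim: r => [|i r ih].
  have := lg 1 0 0; rewrite !scale1r addr0 => h.
  by rewrite !big_nil; apply: (addrI (g 0)); rewrite -h addr0.
by rewrite !big_cons lg ih.
Qed.

(** The abstract reason why the idempotent kills the radical: modulo [L], the map [E] sends each
    [w s] to the multiple [b s] of the one vector [e0], hence a combination with coefficients [a] to
    the pairing of [a] with [b], times [e0]. *)
Lemma rad_killed (T : eqType) L (E : V -> V) (ts : seq T) (w : T -> V) e0
    (a b : T -> kk) u :
  is_submod L -> linear E -> (forall v, L v -> L (E v)) ->
  (forall s, s \in ts -> L (E (w s) - b s *: e0)) ->
  L (u - \sum_(s <- ts) a s *: w s) -> \sum_(s <- ts) a s * b s = 0 ->
  L (E u).
Proof.
move=> hL lE LE hb hu ab.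
have EB x z : E (x - z) = E x - E z.
  by rewrite -scaleN1r addrC lE scaleN1r addrC.
apply: (submod_trans (v := E (\sum_(s <- ts) a s *: w s)) hL).
  by rewrite -EB; apply: LE.
rewrite linear_sum_seq //.
have -> : \sum_(s <- ts) a s *: E (w s) =
    \sum_(s <- ts) a s *: (E (w s) - b s *: e0).
  under [RHS]eq_bigr do rewrite scalerBr scalerA.
  by rewrite sumrB -scaler_suml ab scale0r subr0.
by apply: submod_sum_in => // s hs; apply: submodZ => //; apply: hb.
Qed.

Section GradedGenerator.
Variables (L numM denM numN denN : V -> Prop) (hom : int -> V -> Prop).
Variables (E : V -> V) (pr : int -> V -> V) (f : {linear V -> V}) (e0 : V) (k : int).
Hypotheses (hL : is_submod L) (hM : is_submod numM).
Hypotheses (lE : linear E) (EE : forall u, E (E u) = E u).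
Hypotheses (ME : forall u, numM u -> numM (E u)).
Hypotheses (lpr : forall d, linear (pr d)) (prL : forall d u, L u -> L (pr d u)).
Hypothesis prE : forall d u, pr d (E u) = E (pr d u).
Hypothesis pr_hom : forall d u d', hom d u -> pr d' u = if d' == d then u else 0.
Hypotheses (hom0 : forall d, hom d 0).
Hypothesis homP : forall d c u v, hom d u -> hom d v -> hom d (c *: u + v).
Hypothesis denNL : forall u, denN u -> L (E u).
Hypotheses (e0N : numN e0) (e0h : hom 0 e0) (e0E : E e0 = e0) (e0L : ~ L e0).
Hypothesis span : forall x, numM x -> forall P : V -> Prop, P 0 ->
  (forall c b z, numM b -> (exists d, hom d b) -> P z -> P (c *: b + z)) -> P x.
Hypothesis f_den : forall x, numM x -> (denN (f x) <-> denM x).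
Hypothesis f_E : forall x, numM x -> denN (f (E x) - E (f x)).
Hypothesis f_surj : forall z, numN z -> exists2 x, numM x & denN (z - f x).
Hypothesis f_deg : forall d x, numM x -> hom d x ->
  exists z, [/\ numN z, hom (d - k) z & denN (f x - z)].

(** A preimage of [e0] under the isomorphism is moved into the image of [E], then into degree [k].
    After both corrections, [E] of its image is still [e0] modulo [L], and [e0] is not in [L]; so
    the vector found is nonzero in the factor. *)
Lemma graded_generator : exists x, [/\ numM x, hom k x, E x = x & ~ denM x].
Proof.
have EB x z : E (x - z) = E x - E z.
  by rewrite -scaleN1r addrC lE scaleN1r addrC.
have E0 : E 0 = 0 by rewrite -(subrr e0) EB !subrr.
have prB d x z : pr d (x - z) = pr d x - pr d z.
  by rewrite -scaleN1r addrC lpr scaleN1r addrC.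
have [x0 x0M hx0] := f_surj e0N.
pose x1 := E x0; have x1M : numM x1 by apply: ME.
have fx1 : L (e0 - E (f x1)).
  have h1 := denNL hx0; have h2 := denNL (f_E x0M).
  rewrite EB e0E in h1; rewrite EB EE in h2.
  by have := submodB hL h1 h2; rewrite opprB addrA subrK.
(* The claim is linear in [x] and [numM] is spanned by homogeneous elements, so it suffices to treat
   an element of degree [d]: its image has degree [d - k], which is 0 exactly when [d] is [k]. *)
have key x : numM x -> [/\ numM (pr k x), hom k (pr k x) &
    L (pr 0 (E (f x)) - E (f (pr k x)))].
  move=> xM; refine (span xM (P := fun x => [/\ numM (pr k x), hom k (pr k x) &
    L (pr 0 (E (f x)) - E (f (pr k x)))]) _ _).
    have pr0 d : pr d 0 = 0 by rewrite (pr_hom d (hom0 d)) if_same.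
    by rewrite pr0 !linear0 E0 pr0 subrr; have [L0 _] := hL; have [M0 _] := hM; split.
  move=> c b z bM [d bd] [zM zk zL]; rewrite lpr.
  have [yb [yN yh ydn]] := f_deg bM bd.
  have bk : [/\ numM (pr k b), hom k (pr k b) & L (pr 0 (E (f b)) - E (f (pr k b)))].
    have Lb : L (pr 0 (E (f b)) - pr 0 (E yb)).
      by rewrite -prB -EB; apply: prL; apply: denNL.
    rewrite (pr_hom _ bd); case: eqP => [kd|kd].
      rewrite kd; split=> //.
      have E1 : pr 0 (E yb) = E yb by rewrite prE (pr_hom _ yh) -kd subrr eqxx.
      have Ld := denNL ydn; rewrite EB in Ld; rewrite E1 in Lb.
      by have := submodB hL Lb Ld; rewrite opprB addrA subrK.
    split=> //; first by case: hM.
    rewrite linear0 E0 subr0.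
    move: Lb; rewrite (_ : pr 0 (E yb) = 0) ?subr0 //.
    rewrite prE (pr_hom _ yh); case: eqP => [h|_].
      by case: kd; apply/eqP; rewrite eq_sym -subr_eq0 -h.
    exact: E0.
  case: bk => b1 b2 b3; split.
  - by case: hM => _; apply.
  - exact: homP.
  - rewrite !linearP !lE !lpr opprD addrACA -scalerBr.
    by case: hL => _; apply.
have [xM xk xL] := key _ x1M.
exists (pr k x1); split=> //; first by rewrite -prE /x1 EE.
move=> /(f_den xM) /denNL h; apply: e0L.
apply: (submod_trans hL _ h).
have h2 := prL 0 fx1; rewrite prB (pr_hom _ e0h) eqxx in h2.
by have := submodD hL h2 xL; rewrite addrA subrK.
Qed.

End GradedGenerator.

(** More than [m] coefficient vectors of length [m] are linearly dependent. The same combination of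
    the [x] lies in [W 0]; all its terms but the one of largest index [j] lie in [W j], hence so
    does that one, a contradiction. *)
Lemma chain_count (W : nat -> V -> Prop) l (J : {set 'I_l}) m (w : 'I_m -> V) :
  (forall j, (j <= l)%N -> is_submod (W j)) ->
  (forall j, (j < l)%N -> forall x, W j x -> W j.+1 x) ->
  (forall j : 'I_l, j \in J -> exists x (c : 'I_m -> kk),
     [/\ W j.+1 x, ~ W j x & W 0%N (x - \sum_s c s *: w s)]) ->
  (#|J| <= m)%N.
Proof.
move=> hW Winc hx.
have Wmono i j x : (i <= j <= l)%N -> W i x -> W j x.
  elim: j => [|j ih] /andP[ij jl] hxi; first by move: ij hxi; rewrite leqn0 => /eqP ->.
  move: ij; rewrite leq_eqVlt => /orP[/eqP <- //|ij].
  by apply: Winc => //; apply: ih => //; apply/andP; split; [exact: ij | exact: ltnW].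
rewrite leqNgt; apply/negP => lt.
have /choice [xc hxc] : forall i : 'I_#|J|, exists xc : V * ('I_m -> kk),
    [/\ W (enum_val i : 'I_l).+1 xc.1, ~ W (enum_val i : 'I_l) xc.1 &
        W 0%N (xc.1 - \sum_s xc.2 s *: w s)].
  by move=> i; have [x [c h]] := hx _ (enum_valP i); exists (x, c).
pose C : 'M[kk]_(#|J|, m) := \matrix_(i, s) (xc i).2 s.
have [i0 ki0] : exists i, row i (kermx C) != 0.
  apply/existsP; rewrite -negb_forall; apply/negP => /forallP h.
  have : kermx C = 0 by apply/row_matrixP => i; rewrite row0; apply/eqP.
  move/eqP; rewrite kermx_eq0 /row_free => /eqP E.
  by have := rank_leq_col C; rewrite E leqNgt lt.
set u := row i0 (kermx C) in ki0.
have uC : u *m C = 0 by apply: sub_kermxP; apply: row_sub.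
have [i1 ui1] : exists i, u 0 i != 0.
  apply/existsP; rewrite -negb_forall; apply/negP => /forallP h.
  by case/eqP: ki0; apply/rowP => i; rewrite [RHS]mxE; apply/eqP.
case: (@arg_maxnP _ i1 (fun i => u 0 i != 0) (fun i => nat_of_ord (enum_val i)) ui1) => i ui imax.
have [h1 h2 h3] := hxc i; apply: h2.
have il : (enum_val i < l)%N by [].
have sW := hW _ (ltnW il).
have s0 : W 0%N (\sum_j u 0 j *: (xc j).1).
  have -> : \sum_j u 0 j *: (xc j).1 =
      \sum_j u 0 j *: ((xc j).1 - \sum_s (xc j).2 s *: w s).
    under [RHS]eq_bigr do rewrite scalerBr.
    rewrite sumrB; apply/eqP; rewrite -subr_eq0 opprB addrC subrK; apply/eqP.
    under eq_bigr do rewrite scaler_sumr.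
    rewrite exchange_big big1 //= => s _.
    under eq_bigr do rewrite scalerA.
    rewrite -scaler_suml; have /rowP /(_ s) := uC; rewrite !mxE => E.
    by under eq_bigr => j _ do rewrite -[(xc j).2 s](mxE matrix_key (fun i s => (xc i).2 s)); rewrite E scale0r.
  by apply: submod_sum => [|j _]; [exact: hW | apply: submodZ; [exact: hW | case: (hxc j)]].
have s1 : W (enum_val i) (\sum_j u 0 j *: (xc j).1).
  by apply: (Wmono 0%N) => //; rewrite leq0n ltnW.
rewrite (bigD1 i) //= in s1.
have s2 : W (enum_val i) (\sum_(j | j != i) u 0 j *: (xc j).1).
  apply: submod_sum => // j ji.
  have [->|uj] := eqVneq (u 0 j) 0; first by rewrite scale0r; case: sW.
  apply: submodZ => //; have [hj _ _] := hxc j; apply: Wmono hj.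
  rewrite (ltnW il) andbT ltn_neqAle; have := imax j uj; rewrite /= => ->.
  by rewrite andbT; apply: contra ji => /eqP /val_inj /enum_val_inj ->.
have := submodZ (u 0 i)^-1 sW (submodB sW s1 s2).
by rewrite addrK scalerA mulVf // scale1r.
Qed.

End Submodules.

(** * The deformed seminormal representation *)

Section WordReduction.
Variables (R : nzRingType) (O : R -> Prop).
Hypotheses (O1 : O 1) (ON1 : O (-1)) (OM : forall a b, O a -> O b -> O (a * b)).
Variables (V : lmodType R) (M : nat) (P : nat -> V -> V) (v0 : V).

Definition pword (w : seq nat) : V := foldr (fun r u => P r u) v0 w.

(** The filtration by length, with coefficients restricted to [O]. The bound is strict: level [l]
    holds what is negligible next to a word of length [l]. *)
Inductive short_span (l : nat) : V -> Prop :=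
| short_span0 : short_span l 0
| short_spanD c w u : O c -> (size w < l)%N -> all (fun r => r < M)%N w ->
    short_span l u -> short_span l (c *: pword w + u).

Local Notation SP := short_span.

Lemma short_spanP l c u v : O c -> SP l u -> SP l v -> SP l (c *: u + v).
Proof.
move=> hc hu hv; elim: hu => [|c' w u' hc' hw aw _ ih].
  by rewrite scaler0 add0r.
by rewrite scalerDr scalerA -addrA; apply: short_spanD => //; apply: OM.
Qed.

Lemma short_spanZ l c u : O c -> SP l u -> SP l (c *: u).
Proof. by move=> hc hu; rewrite -[_ *: _]addr0; apply: short_spanP => //; exact: short_span0. Qed.

Lemma short_spanA l u v : SP l u -> SP l v -> SP l (u + v).
Proof. by move=> hu hv; rewrite -[u]scale1r; apply: short_spanP. Qed.

Lemma short_spanN l u : SP l u -> SP l (- u).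
Proof. by move=> hu; rewrite -scaleN1r; apply: short_spanZ. Qed.

Lemma short_spanB l u v : SP l u -> SP l v -> SP l (u - v).
Proof. by move=> hu hv; apply: short_spanA => //; apply: short_spanN. Qed.

Lemma short_span_word l w : (size w < l)%N -> all (fun r => r < M)%N w -> SP l (pword w).
Proof.
move=> hw aw; rewrite -[pword w]addr0 -[pword w]scale1r.
by apply: short_spanD => //; exact: short_span0.
Qed.

Lemma short_span_leq l l' u : (l <= l')%N -> SP l u -> SP l' u.
Proof.
move=> le; elim=> [|c w u' hc hw aw _ ih]; first exact: short_span0.
by apply: short_spanD => //; apply: leq_trans le.
Qed.

Hypothesis lP : forall r, (r < M)%N -> linear (P r).
Hypothesis sqP : forall r w, (r < M)%N -> all (fun r => r < M)%N w ->
  SP (size w).+1 (P r (P r (pword w))).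
Hypothesis braidP : forall r w, (r.+1 < M)%N -> all (fun r => r < M)%N w ->
  SP (size w).+1 (P r (P r.+1 (P r (pword w))) - P r.+1 (P r (P r.+1 (pword w)))).
Hypothesis farP : forall r s w, (r < M)%N -> (s < M)%N -> (r.+1 < s)%N ->
  all (fun r => r < M)%N w -> P r (P s (pword w)) = P s (P r (pword w)).

Lemma pwordS r l u : (r < M)%N -> SP l u -> SP l.+1 (P r u).
Proof.
move=> rM; elim=> [|c w u' hc hw aw _ ih].
  have := lP rM 1 0 0; rewrite !scale1r addr0 => h.
  have -> : P r 0 = 0 by apply: (addrI (P r 0)); rewrite -h addr0.
  exact: short_span0.
rewrite lP // -[P r (pword w)]/(pword (r :: w)).
by apply: short_spanD => //=; rewrite rM.
Qed.

Definition wact (w : seq nat) (u : V) : V := foldr (fun r u => P r u) u w.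

Lemma wact_cat w w' u : wact (w ++ w') u = wact w (wact w' u).
Proof. by rewrite /wact foldr_cat. Qed.

Lemma wact_pword w w' : wact w (pword w') = pword (w ++ w').
Proof. by rewrite /pword /wact foldr_cat. Qed.

Lemma wactS w l u : all (fun r => r < M)%N w -> SP l u -> SP (size w + l) (wact w u).
Proof. by elim: w => //= r w ih /andP[rM /ih h] /h; rewrite addSn; apply: pwordS. Qed.

Lemma PB r u v : (r < M)%N -> P r (u - v) = P r u - P r v.
Proof. by move=> rM; rewrite -scaleN1r addrC lP // scaleN1r addrC. Qed.

Lemma wactB w u v : all (fun r => r < M)%N w -> wact w (u - v) = wact w u - wact w v.
Proof. by elim: w => //= r w ih /andP[rM /ih ->]; rewrite PB. Qed.

Lemma wact_far k w w' : (k < M)%N -> all (fun r => (r < M) && ((k.+1 < r) || (r.+1 < k)))%N w ->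
  all (fun r => r < M)%N w' -> P k (wact w (pword w')) = wact w (P k (pword w')).
Proof.
move=> kM; elim: w => //= r w ih /andP[/andP[rM rk] aw] aw'.
have aw2 : all (fun r => r < M)%N (w ++ w').
  rewrite all_cat aw' andbT; apply: sub_all aw => i; by case/andP.
rewrite -ih // wact_pword; case/orP: rk => h; first by rewrite farP.
by rewrite -farP.
Qed.

(** An increasing run up to the letter [m - 1], possibly empty, followed by a normal form in smaller
    letters: these are the reduced words of the symmetric group on [m + 1] points built from coset
    representatives in the chain of symmetric subgroups. The longest has 1 + ... + m letters, the
    source of the binomial bound. *)
Fixpoint normal_form (m : nat) (w : seq nat) : Prop :=
  if m is m'.+1 then exists j w', [/\ (j <= m)%N, normal_form m' w' &
    w = iota j (m - j) ++ w'] else w = [::].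

Lemma normal_form_letters m w : normal_form m w -> all (fun r => r < m)%N w.
Proof.
elim: m w => [w ->//|m ih w [j [w' [jm nf ->]]]].
rewrite all_cat; apply/andP; split.
  by apply/allP => x; rewrite mem_iota => /andP[_]; rewrite subnKC.
by apply: sub_all (ih _ nf) => x /= h; rewrite ltnS ltnW.
Qed.

Lemma normal_form_size m w : normal_form m w -> (size w <= 'C(m.+1, 2))%N.
Proof.
elim: m w => [w ->//|m ih w [j [w' [jm nf ->]]]].
rewrite size_cat size_iota binS bin1 addnC leq_add ?leq_subr //.
exact: ih.
Qed.

Lemma normal_form_widen m w : normal_form m w -> normal_form m.+1 w.
Proof. by move=> h; exists m.+1, w; rewrite subnn. Qed.

Definition reducible m l u := SP l u \/
  exists w, [/\ normal_form m w, size w = l & SP l (u - pword w)].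

(** A letter [k] put in front of the run starting at [j] commutes past it if [k + 1 < j], prolongs
    it if [k + 1 = j], and produces a square, hence shorter words, if [k = j]. If [k > j], it
    commutes up to the letters k - 1, k, and a braid move lets it leave the run on the right as k -
    1. A letter that leaves the run is absorbed by induction. *)
Lemma reducible_step m w k : (m <= M)%N -> (k < m)%N -> normal_form m w ->
  reducible m (size w).+1 (P k (pword w)).
Proof.
elim: m w k => [//|m ih] w k mM km [j [w' [jm nf ->]]].
have mM' := ltnW mM.
have aM w2 : normal_form m w2 -> all (fun r => r < M)%N w2.
  by move/normal_form_letters; apply: sub_all => x h; apply: leq_trans mM'.
have aI i l : (i + l <= m.+1)%N -> all (fun r => r < M)%N (iota i l).
  move=> h; apply/allP => x; rewrite mem_iota => /andP[_ h2].
  by apply: leq_trans mM; apply: leq_trans h.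
have kM : (k < M)%N by apply: leq_trans mM.
have push k' : (k' < m)%N ->
    reducible m.+1 (size (iota j (m.+1 - j) ++ w')).+1
      (wact (iota j (m.+1 - j)) (P k' (pword w'))).
  move=> k'm; have aj : all (fun r => r < M)%N (iota j (m.+1 - j)).
    by apply: aI; rewrite subnKC.
  rewrite size_cat -addnS; case: (ih _ _ mM' k'm nf) => [h|[w2 [nf2 s2 h]]].
    by left; apply: wactS.
  right; exists (iota j (m.+1 - j) ++ w2); split.
  - by exists j, w2.
  - by rewrite size_cat s2.
  - by rewrite -wact_pword -wactB //; apply: wactS.
move: jm; rewrite leq_eqVlt => /orP[/eqP j1|jm].
  move: (push k); rewrite j1 subnn /=; move: km; rewrite leq_eqVlt.
  case/orP=> [/eqP [km] _|km]; last by apply.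
  right; exists (m :: w'); split=> //.
    by exists m, w'; rewrite subSn // subnn.
  by rewrite -km subrr; exact: short_span0.
have jm' : (j <= m)%N by rewrite -ltnS.
have aw' := aM _ nf.
have aj : all (fun r => r < M)%N (iota j (m.+1 - j)) by apply: aI; lia.
have [kj|kj] := ltnP k j.
  have [kj1|kj1] := ltnP k.+1 j.
    rewrite -wact_pword wact_far //; first by apply: push; lia.
    apply/allP => x hx; rewrite (allP aj) //=; move: hx; rewrite mem_iota; lia.
  have E : j = k.+1 by lia.
  right; exists (iota k (m.+1 - k) ++ w'); split.
  - by exists k, w'; split=> //; lia.
  - by rewrite !size_cat !size_iota; lia.
  rewrite E (_ : (m.+1 - k = (m.+1 - k.+1).+1)%N); last lia.
  by rewrite /= subrr; exact: short_span0.
move: kj; rewrite leq_eqVlt => /orP[/eqP kj|kj].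
  left; rewrite -kj (_ : (m.+1 - j = (m.+1 - j.+1).+1)%N); last lia.
  rewrite /=; apply: (short_span_leq (l := (size (iota j.+1 (m.+1 - j.+1) ++ w')).+1)).
    by lia.
  apply: sqP; first by rewrite kj.
  by rewrite all_cat aw' andbT; apply: aI; lia.
pose a := (k.-1 - j)%N; pose b := (m.+1 - k.+1)%N.
have EI : iota j (m.+1 - j) = iota j a ++ [:: k.-1; k] ++ iota k.+1 b.
  rewrite (_ : (m.+1 - j = a + (2 + b))%N); last by rewrite /a /b; lia.
  by rewrite !iotaD /=; congr (_ ++ [:: _, _ & iota _ _]); rewrite /a; lia.
have k1M : (k.-1 < M)%N by lia.
have ab : all (fun r => r < M)%N (iota k.+1 b ++ w').
  by rewrite all_cat aw' andbT; apply: aI; rewrite /b; lia.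
have aa : all (fun r => r < M)%N (iota j a) by apply: aI; rewrite /a; lia.
have k1m : (k.-1 < m)%N by lia.
have far1 : P k (pword (iota j (m.+1 - j) ++ w')) =
    wact (iota j a) (P k (P k.-1 (P k (pword (iota k.+1 b ++ w'))))).
  have h2 : all (fun r => r < M)%N ([:: k.-1; k] ++ iota k.+1 b ++ w').
    by rewrite /= k1M kM.
  have h1 : all (fun r => (r < M) && ((k.+1 < r) || (r.+1 < k)))%N (iota j a).
    apply/allP => x hx; rewrite (allP aa) //=; move: hx; rewrite mem_iota /a; lia.
  by rewrite EI -!catA -wact_pword (wact_far kM h1 h2).
have far2 : wact (iota j (m.+1 - j)) (P k.-1 (pword w')) =
    wact (iota j a) (P k.-1 (P k (P k.-1 (pword (iota k.+1 b ++ w'))))).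
  have h1 : all (fun r => (r < M) && ((k.-1.+1 < r) || (r.+1 < k.-1)))%N (iota k.+1 b).
    apply/allP => x hx; have /= -> := allP (aI k.+1 b _) x hx; last by rewrite /b; lia.
    by move: hx; rewrite mem_iota /b; lia.
  by rewrite EI !wact_cat /= -[pword (iota k.+1 b ++ w')]wact_pword (wact_far k1M h1 aw').
have kE : k = k.-1.+1 by lia.
have B : SP (size (iota j (m.+1 - j) ++ w')).+1
    (P k (pword (iota j (m.+1 - j) ++ w')) - wact (iota j (m.+1 - j)) (P k.-1 (pword w'))).
  rewrite far1 far2 -wactB //.
  apply: (short_span_leq (l := (size (iota j a) + (size (iota k.+1 b ++ w')).+1)%N)).
    by rewrite EI !size_cat /= !size_iota; lia.
  apply: wactS => //; rewrite -opprB; apply: short_spanN.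
  by have := @braidP k.-1 (iota k.+1 b ++ w'); rewrite -kE; apply.
case: (push _ k1m) => [h|[w2 [nf2 s2 h]]].
  by left; have := short_spanA B h; rewrite subrK.
by right; exists w2; split=> //; have := short_spanA B h; rewrite addrA subrK.
Qed.

Lemma word_reducible w : all (fun r => r < M)%N w -> reducible M (size w) (pword w).
Proof.
elim: w => [_|k w ih] /=.
  right; exists [::]; split=> //; last by rewrite subrr; exact: short_span0.
  elim: (M) => // m hm; exact: normal_form_widen.
case/andP=> kM /ih [h|[w' [nf s h]]]; first by left; apply: pwordS.
have aw' := normal_form_letters nf.
have h2 := pwordS kM h; rewrite PB // in h2.
case: (reducible_step (leqnn _) kM nf) => [h3|[w2 [nf2 s2 h3]]]; rewrite s in h3 *.
  by left; have := short_spanA h2 h3; rewrite subrK.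
right; exists w2; rewrite -s; split=> //; rewrite s.
by have := short_spanA h2 h3; rewrite addrA subrK.
Qed.

(** A word longer than every normal form cannot reduce to one of its own length, so it reduces to
    shorter words; this is repeated until the bound is reached. *)
Lemma short_span_bound l u : SP l u -> SP ('C(M.+1, 2)).+1 u.
Proof.
elim: l u => [|l ih] u; elim=> [|c w u' hc hw aw _ ih']; try exact: short_span0; first by [].
apply: short_spanP => //; have [lt|le] := ltnP 'C(M.+1, 2) (size w).
  have sl : (size w <= l)%N by rewrite -ltnS.
  case: (word_reducible aw) => [h|[w2 [nf s _]]].
    by apply: ih; apply: short_span_leq h.
  by have := normal_form_size nf; rewrite s leqNgt lt.
by apply: short_span_word.
Qed.

End WordReduction.

(** * Coefficients of the deformed seminormal form *)

Section FieldIdentities.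
Variable F : fieldType.
Implicit Types x y z g : F.

Lemma inv_three x y z : x - y != 0 -> y - z != 0 -> x - z != 0 ->
  (x - y)^-1 * (y - z)^-1 = (x - z)^-1 * ((x - y)^-1 + (y - z)^-1).
Proof. by move=> h1 h2 h3; field; rewrite h1 h2 h3. Qed.

Lemma slope_one x y z : x - z != 0 ->
  (y - x) * (x - z)^-1 - (y - z) * (x - z)^-1 = -1.
Proof. by move=> h; field. Qed.

Lemma slope_mul g x y z : x - z != 0 ->
  (g * x - y) * (x - z)^-1 - (g * z - y) * (x - z)^-1 = g.
Proof. by move=> h; field. Qed.

Lemma braid_factor x y z : x * x * y + x * - x * z - y * y * x - y * - y * z =
   (x - y) * (x * y - z * (x + y)).
Proof. by ring. Qed.

End FieldIdentities.

Section DeformedCoefficients.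
Variables (kk : fieldType) (p : nat).
Hypothesis p3 : (2 < p)%N.
Local Notation K := {fraction {poly kk}}.

(** The deformed content: distinct contents have distinct values, so their differences are
    invertible in the field of fractions even when the contents are congruent modulo p, while all
    values become 1 at X = 0. *)
Definition qpow (a : nat) : K := tofrac (('X + 1) ^+ a : {poly kk}).

Lemma qpowS a : qpow a.+1 = qpow 1 * qpow a.
Proof. by rewrite /qpow expr1 exprS tofracM. Qed.

Lemma qpow_inj : injective qpow.
Proof.
move=> a b /eqP; rewrite /qpow tofrac_eq => /eqP /(congr1 (size \o (@polyseq kk))) /=.
have -> : 'X + 1 = 'X - (-1)%:P :> {poly kk} by rewrite polyCN opprK.
by rewrite !size_exp_XsubC => -[].
Qed.

Definition eqr (a b : nat) : bool := a%:R == b%:R :> 'Z_p.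

Lemma eqr_sym a b : eqr a b = eqr b a. Proof. exact: eq_sym. Qed.

Lemma eqr_trans a b c : eqr a b -> eqr b c = eqr a c.
Proof. by rewrite /eqr => /eqP ->. Qed.

Lemma eqrS a b : eqr a.+1 b.+1 = eqr a b.
Proof. by rewrite /eqr -!natr1 (inj_eq (addIr _)). Qed.

Lemma eqr_succ a : eqr a a.+1 = false.
Proof.
by rewrite /eqr -natr1 -subr_eq0 opprD addrA subrr sub0r oppr_eq0 oner_eq0.
Qed.

Lemma eqr_succ2 a : eqr a a.+2 = false.
Proof.
rewrite /eqr -!natr1 -subr_eq0 !opprD !addrA subrr sub0r -opprD oppr_eq0.
have -> : 1 + 1 = 2%:R :> 'Z_p by [].
apply/eqP => /(congr1 (@nat_of_ord _)); rewrite val_Zp_nat; last by lia.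
by rewrite modn_small.
Qed.

(* The seminormal coefficients: [psi_r] sends [u] to
   [dcoef a b * u t + ccoef a b * u (s_r t)] at a sequence [t] with entries [a], [b]
   in positions [r], [r + 1]. That [ccoef a b = 0] for adjacent contents makes the
   space of functions supported on content sequences of standard tableaux stable. *)
Definition dcoef (a b : nat) : K := if eqr a b then (qpow a - qpow b)^-1 else 0.

Definition ccoef (a b : nat) : K :=
  if eqr a b then (qpow a - qpow b)^-1
  else if (a == b.+1) || (b == a.+1) then 0
  else if eqr b a.+1 then qpow 1 * qpow a - qpow b else 1.

(** The multiplier by which the square of [psi_r] acts when the residues differ. As [qpow 1] is 1 +
    X, each of the first two cases is the difference of [y] values prescribed by the quadratic
    relation, up to a multiple of X; it vanishes for adjacent contents, in accordance with
    [ccoef]. *)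
Definition qcoef (a b : nat) : K :=
  if eqr b a.+1 then qpow 1 * qpow a - qpow b
  else if eqr a b.+1 then qpow 1 * qpow b - qpow a else 1.

Lemma qpowB_neq0 a b : a != b -> qpow a - qpow b != 0.
Proof. by rewrite subr_eq0 (inj_eq qpow_inj). Qed.

Lemma eqr_not_both a b : eqr b a.+1 -> eqr a b.+1 = false.
Proof.
rewrite -(eqrS b) => h.
by rewrite eqr_sym -(eqr_trans _ h) eqr_sym eqr_succ2.
Qed.

Lemma qcoef_sym a b : qcoef a b = qcoef b a.
Proof.
rewrite /qcoef; case: (boolP (eqr b a.+1)) => // h.
by rewrite (eqr_not_both h).
Qed.

Lemma ccoef_adj a b : (a == b.+1) || (b == a.+1) -> ccoef a b = 0.
Proof.
by move=> h; rewrite /ccoef h; case/orP: h => /eqP ->; rewrite ?eqr_succ // eqr_sym eqr_succ.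
Qed.

Lemma ccoefM a b : a != b -> eqr a b = false -> ccoef a b * ccoef b a = qcoef a b.
Proof.
move=> ab eab; rewrite /ccoef (eqr_sym b a) eab orbC.
have [h|h] := boolP ((b == a.+1) || (a == b.+1)).
  rewrite mul0r /qcoef; case/orP: h => /eqP ->.
    by rewrite /eqr eqxx -qpowS subrr.
  by rewrite eqr_succ2 /eqr eqxx -qpowS subrr.
rewrite /qcoef.
case: (boolP (eqr b a.+1)) => h2; first by rewrite (eqr_not_both h2) /= mulr1.
by rewrite /= mul1r.
Qed.

Lemma dcoefN a b : dcoef a b = - dcoef b a.
Proof.
by rewrite /dcoef (eqr_sym b a); case: ifP; rewrite ?oppr0 // => _; rewrite -invrN opprB.
Qed.

Lemma ccoef_eqr a b : eqr a b -> ccoef a b = dcoef a b.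
Proof. by rewrite /ccoef /dcoef => ->. Qed.

Lemma dcoef0 a b : eqr a b = false -> dcoef a b = 0.
Proof. by rewrite /dcoef => ->. Qed.

Lemma dcoefE a b : eqr a b -> dcoef a b = (qpow a - qpow b)^-1.
Proof. by rewrite /dcoef => ->. Qed.

Lemma dcoefM a b : a != b -> dcoef a b * (qpow a - qpow b) = (eqr a b)%:R.
Proof.
by move=> ab; rewrite /dcoef; case: ifP => _; rewrite ?mul0r // mulVf // qpowB_neq0.
Qed.

Lemma psi_sq_coef1 a b : ccoef a b * (dcoef a b + dcoef b a) = 0.
Proof. by rewrite dcoefN addNr mulr0. Qed.

Lemma psi_sq_coef2 a b : a != b ->
  dcoef a b * dcoef a b + ccoef a b * ccoef b a = if eqr a b then 0 else qcoef a b.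
Proof.
move=> ab; case: (boolP (eqr a b)) => h.
  by rewrite !ccoef_eqr // 1?eqr_sym // (dcoefN b) mulrN subrr.
by rewrite dcoef0 ?mul0r ?add0r ?ccoefM //; apply: negbTE.
Qed.

(* The two three-term identities behind the braid relation: both are
   consequences of [1/(xy) = 1/((x+y)x) + 1/((x+y)y)]. *)
Lemma dcoef3 a b c : a != b -> b != c -> a != c ->
  dcoef a b * dcoef b c = dcoef a c * (dcoef a b + dcoef b c).
Proof.
move=> ab bc ac; rewrite /dcoef.
case: (boolP (eqr a b)) => eab; last first.
  rewrite mul0r add0r; case: (boolP (eqr b c)) => ebc; last by rewrite mulr0.
  by rewrite eqr_sym in ebc; rewrite (eqr_sym a) -(eqr_trans _ ebc) (eqr_sym b) (negbTE eab) mul0r.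
rewrite (eqr_trans _ eab); case: ifP => _; last by rewrite mulr0 mul0r.
by apply: inv_three; apply: qpowB_neq0.
Qed.

Lemma braid_coef1 a b c : a != b -> b != c -> a != c ->
  dcoef a b * dcoef b c + dcoef a c * dcoef b a - dcoef b c * dcoef a c = 0.
Proof.
move=> ab bc ac; rewrite (dcoef3 ab bc ac) (dcoefN b a) mulrDr mulrN (mulrC (dcoef b c)).
by rewrite addrAC addrK subrr.
Qed.

Lemma braid_coef2 a b c : a != b -> b != c -> a != c ->
  dcoef a b * dcoef a c - dcoef b c * dcoef a b - dcoef a c * dcoef c b = 0.
Proof.
move=> ab bc ac; rewrite (mulrC (dcoef b c)) (dcoef3 ab bc ac) (dcoefN c b).
rewrite (mulrC (dcoef a b)) mulrDr mulrN opprK opprD addrA subrr sub0r.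
by rewrite addNr.
Qed.

(** The value [qpow 1], that is 1 + X, takes the place of the coefficient 1 of the braid relation;
    the other two values are undeformed. *)
Definition braid_coef (a b c : nat) : K :=
  if eqr a c && eqr a b.+1 then -1
  else if eqr a c && eqr b a.+1 then qpow 1 else 0.

(** If [a] and [b] have different residues, only the [ccoef] products can survive, and only when [a]
    and [c] have equal residues: they are then the values of one affine function at [qpow a] and
    [qpow c], and dividing their difference by [qpow a - qpow c] leaves its slope. If all three
    residues agree, the three-term identity [dcoef3] makes a factor vanish. *)
Lemma braid_coef3 a b c : a != b -> b != c -> a != c ->
  dcoef a b * dcoef a b * dcoef b c + ccoef a b * ccoef b a * dcoef a c
  - dcoef b c * dcoef b c * dcoef a b - ccoef b c * ccoef c b * dcoef a c =
  braid_coef a b c.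
Proof.
move=> ab bc ac; rewrite /braid_coef.
have cb : c != b by rewrite eq_sym.
case: (boolP (eqr a b)) => eab; last first.
  have n1 : eqr a b = false by apply: negbTE.
  rewrite (ccoefM ab n1) (dcoef0 n1) !mul0r mulr0 add0r subr0.
  case: (boolP (eqr a c)) => eac; last by rewrite (dcoef0 (negbTE eac)) !mulr0 subrr.
  have n2 : eqr b c = false by rewrite eqr_sym (eqr_trans _ eac) n1.
  rewrite (ccoefM bc n2) (qcoef_sym b c) /qcoef /=.
  have e1 : eqr b c.+1 = eqr b a.+1.
    by rewrite !(eqr_sym b) (@eqr_trans a.+1 c.+1) // eqrS.
  have e2 : eqr c b.+1 = eqr a b.+1 by rewrite (eqr_trans _ eac).
  have h := qpowB_neq0 ac; rewrite e1 e2 dcoefE //.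
  case: (boolP (eqr b a.+1)) => [h2|_]; first by rewrite (eqr_not_both h2) slope_mul.
  by case: ifP => _; rewrite ?subrr // slope_one.
have -> : eqr a b.+1 = false.
  by rewrite (@eqr_trans b a) ?eqr_succ // eqr_sym.
have -> : eqr b a.+1 = false by rewrite (eqr_trans _ eab) eqr_succ.
rewrite !andbF.
rewrite (ccoef_eqr eab) ccoef_eqr 1?eqr_sym // (dcoefN b a).
case: (boolP (eqr b c)) => ebc; last first.
  have n1 : eqr b c = false by apply: negbTE.
  have n2 : eqr a c = false by rewrite -(eqr_trans _ eab).
  by rewrite (dcoef0 n1) (dcoef0 n2) !(mulr0, mul0r) !subr0 addr0.
rewrite (ccoef_eqr ebc) ccoef_eqr 1?eqr_sym // (dcoefN c b).
have := dcoef3 ab bc ac; set x := dcoef a b; set y := dcoef b c; set z := dcoef a c.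
move=> E; rewrite braid_factor.
by rewrite E subrr mulr0.
Qed.

End DeformedCoefficients.

(** The [u] are the values at the six rearrangements of three entries. The coefficients of the last
    three cancel; the others are, up to a factor, the left sides of [braid_coef3], [braid_coef1] and
    [braid_coef2]. *)
Lemma braid_expand (F : comNzRingType) (dab dba dbc dcb dac cab cba cbc ccb cac
    u1 u2 u3 u4 u5 u6 : F) :
  dab * (dbc * (dab * u1 + cab * u2) + cbc * (dac * u3 + cac * u4)) +
  cab * (dac * (dba * u2 + cba * u1) + cac * (dbc * u5 + cbc * u6)) -
  (dbc * (dab * (dbc * u1 + cbc * u3) + cab * (dac * u2 + cac * u5)) +
   cbc * (dac * (dcb * u3 + ccb * u1) + cac * (dab * u4 + cab * u6))) =
  (dab * dab * dbc + cab * cba * dac - dbc * dbc * dab - cbc * ccb * dac) * u1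
  + cab * (dab * dbc + dac * dba - dbc * dac) * u2
  + cbc * (dab * dac - dbc * dab - dac * dcb) * u3.
Proof. by ring. Qed.

Lemma far_expand (F : comNzRingType) (d1 d2 c1 c2 u1 u2 u3 u4 : F) :
  d1 * (d2 * u1 + c2 * u2) + c1 * (d2 * u3 + c2 * u4) =
  d2 * (d1 * u1 + c1 * u3) + c2 * (d1 * u2 + c1 * u4).
Proof. by ring. Qed.

Lemma y_expand (F : comNzRingType) (a b c d u v : F) :
  (a - 1) * (d * u + c * v) =
  d * ((b - 1) * u) + c * ((a - 1) * v) + d * (a - b) * u.
Proof. by ring. Qed.

Lemma ysucc_expand (F : comNzRingType) (a b c d u v : F) :
  (b - 1) * (d * u + c * v) =
  d * ((a - 1) * u) + c * ((b - 1) * v) - d * (a - b) * u.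
Proof. by ring. Qed.

Lemma sq_expand (F : comNzRingType) (c d c' d' u v : F) :
  d * (d * u + c * v) + c * (d' * v + c' * u) =
  (d * d + c * c') * u + c * (d + d') * v.
Proof. by ring. Qed.

(** * The deformed generators on functions of content sequences *)

Section DeformedModule.
Variables (kk : fieldType) (p n : nat).
Hypothesis p3 : (2 < p)%N.
Local Notation K := {fraction {poly kk}}.
Local Notation C := {ffun 'I_n -> nat}.
Local Notation V := (C -> K^o).
Local Notation qp := (@qpow kk).
Local Notation dc := (@dcoef kk p).
Local Notation cc := (@ccoef kk p).
Implicit Types (t : C) (u : V).

Variable T : seq C.
Hypothesis T_swap : forall t r, t \in T -> t (pos r) != (t (pos_succ r)).+1 ->
  t (pos_succ r) != (t (pos r)).+1 -> fswap r t \in T.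
Hypothesis T_neq : forall t r, t \in T -> t (pos r) != t (pos_succ r).
Hypothesis T_neq2 : forall t (r s : 'I_n.-1), t \in T -> s = r.+1 :> nat ->
  t (pos r) != t (pos_succ s).

Definition cres t : res_seq p n := [ffun k => (t k)%:R].

Definition defE (i : res_seq p n) u : V := fun t => (cres t == i)%:R * u t.
Definition defY (r : 'I_n) u : V := fun t => (qp (t r) - 1) * u t.
Definition defP (r : 'I_n.-1) u : V := fun t =>
  dc (t (pos r)) (t (pos_succ r)) * u t
  + cc (t (pos r)) (t (pos_succ r)) * u (fswap r t).
Definition eqpart (r : 'I_n.-1) u : V := fun t =>
  (eqr p (t (pos r)) (t (pos_succ r)))%:R * u t.

(** The operators are defined on all functions, but the relations that involve inverse differences
    are proved where neighbouring entries, and for the braid relation also entries at distance two,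
    are distinct. This holds on [T], and support in [T] is preserved. *)
Definition carried u := forall t, t \notin T -> u t = 0.

Lemma cres_fswap r t : cres (fswap r t) = swap_res r (cres t).
Proof. by apply/ffunP => k; rewrite !ffunE. Qed.

Lemma cres_eqr r t :
  (cres t (pos r) == cres t (pos_succ r)) = eqr p (t (pos r)) (t (pos_succ r)).
Proof. by rewrite !ffunE. Qed.

Lemma carried_defE i u : carried u -> carried (defE i u).
Proof. by move=> h t /h; rewrite /defE => ->; rewrite mulr0. Qed.

Lemma carried_defY r u : carried u -> carried (defY r u).
Proof. by move=> h t /h; rewrite /defY => ->; rewrite mulr0. Qed.

Lemma carried_defP r u : carried u -> carried (defP r u).
Proof.
move=> h t tT; rewrite /defP (h _ tT) mulr0 add0r.
have [sT|/h ->] := boolP (fswap r t \in T); last by rewrite mulr0.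
rewrite ccoef_adj ?mul0r //; apply: contraR tT; rewrite negb_or => /andP[h1 h2].
by rewrite -(fswapK r t); apply: T_swap; rewrite // fswap_pos fswap_pos_succ.
Qed.

Lemma pointwise u v : carried u -> carried v -> (forall t, t \in T -> u t = v t) -> u = v.
Proof.
move=> hu hv h; apply/funext => t; have [/h //|tT] := boolP (t \in T).
by rewrite hu ?hv.
Qed.

Lemma defE_defE i j u : defE i (defE j u) = if i == j then defE i u else fun=> 0.
Proof.
apply/funext => t; rewrite /defE mulrA -natrM mulnb.
case: (eqVneq i j) => [->|ij]; first by rewrite andbb.
by case: eqP => [->|] /=; rewrite ?(negbTE ij) ?mul0r.
Qed.

Lemma defE_sum u t : \sum_i defE i u t = u t.
Proof.
rewrite (bigD1 (cres t)) //= /defE eqxx mul1r big1 ?addr0 // => i.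
by rewrite eq_sym => /negbTE ->; rewrite mul0r.
Qed.

Lemma defY_defE r i u : defY r (defE i u) = defE i (defY r u).
Proof. by apply/funext => t; rewrite /defY /defE mulrCA. Qed.

Lemma defP_defE r i u : defP r (defE i u) = defE (swap_res r i) (defP r u).
Proof.
apply/funext => t; rewrite /defP /defE cres_fswap mulrDr !(mulrCA _ (_%:R)).
have E : (swap_res r (cres t) == i) = (cres t == swap_res r i).
  by rewrite -(inj_eq (inv_inj (@swap_resK p n r))) swap_resK.
rewrite E; congr (_ + _).
have [h|h] := boolP (eqr p (t (pos r)) (t (pos_succ r))); last first.
  by rewrite (dcoef0 _ (negbTE h)) !mul0r !mulr0.
by rewrite -E swap_res_id //; apply/eqP; rewrite cres_eqr.
Qed.

Lemma defY_defY r s u : defY r (defY s u) = defY s (defY r u).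
Proof. by apply/funext => t; rewrite /defY mulrCA. Qed.

Lemma defP_defY r s u : s != pos r -> s != pos_succ r ->
  defP r (defY s u) = defY s (defP r u).
Proof.
move=> h1 h2; apply/funext => t.
by rewrite /defP /defY fswap_other // mulrDr !(mulrCA (qp _ - 1)).
Qed.

Lemma defP_far (r s : 'I_n.-1) u : (r.+1 < s)%N || (s.+1 < r)%N ->
  defP r (defP s u) = defP s (defP r u).
Proof.
move=> h; have h' : (s.+1 < r)%N || (r.+1 < s)%N by rewrite orbC.
apply/funext => t; rewrite /defP.
have [-> -> ->] := fswap_far t h; have [-> -> _] := fswap_far t h'.
exact: far_expand.
Qed.

Lemma defY_pos_defP r u : carried u ->
  defY (pos r) (defP r u) = defP r (defY (pos_succ r) u) + eqpart r u.
Proof.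
move=> hu; apply: pointwise => [||t tT].
- by apply: carried_defY; apply: carried_defP.
- move=> t tT; rewrite addrfctE /eqpart hu // mulr0 addr0.
  by apply: carried_defP => //; apply: carried_defY.
rewrite addrfctE /defY /defP /eqpart fswap_pos_succ.
rewrite -(dcoefM kk p (T_neq r tT)); exact: y_expand.
Qed.

Lemma defY_pos_succ_defP r u : carried u ->
  defY (pos_succ r) (defP r u) = defP r (defY (pos r) u) - eqpart r u.
Proof.
move=> hu; apply: pointwise => [||t tT].
- by apply: carried_defY; apply: carried_defP.
- move=> t tT; rewrite addrfctE opprfctE /eqpart hu // mulr0 subr0.
  by apply: carried_defP => //; apply: carried_defY.
rewrite addrfctE opprfctE /defY /defP /eqpart fswap_pos.
rewrite -(dcoefM kk p (T_neq r tT)); exact: ysucc_expand.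
Qed.

Lemma defP_defP r u : carried u ->
  defP r (defP r u) = fun t => (if eqr p (t (pos r)) (t (pos_succ r)) then 0
    else qcoef kk p (t (pos r)) (t (pos_succ r))) * u t.
Proof.
move=> hu; apply: pointwise => [||t tT].
- by do 2!apply: carried_defP.
- by move=> t tT; rewrite hu // mulr0.
rewrite /defP fswap_pos fswap_pos_succ fswapK.
rewrite -(psi_sq_coef2 kk p3 (T_neq r tT)).
rewrite [LHS]sq_expand psi_sq_coef1 mul0r addr0 //.
Qed.

Lemma defP_braid (r s : 'I_n.-1) u : s = r.+1 :> nat -> carried u ->
  defP r (defP s (defP r u)) - defP s (defP r (defP s u)) =
  fun t => braid_coef kk p (t (pos r)) (t (pos_succ r)) (t (pos_succ s)) * u t.
Proof.
move=> rs hu; apply: pointwise => [||t tT].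
- move=> t tT; rewrite addrfctE opprfctE.
  by rewrite !(carried_defP _ (carried_defP _ (carried_defP _ hu))) // subrr.
- by move=> t tT; rewrite hu // mulr0.
have prs : pos s = pos_succ r by apply: val_inj.
have nrs : pos_succ s != pos r by rewrite -(inj_eq val_inj) /=; apply/eqP; lia.
have nrs' : pos_succ s != pos_succ r by rewrite -(inj_eq val_inj) /=; apply/eqP; lia.
have nsr : pos r != pos_succ r by rewrite -(inj_eq val_inj) /=; apply/eqP; lia.
have a1 j : fswap s j (pos r) = j (pos r) :> nat.
  by rewrite fswap_other // ?prs // eq_sym.
have a2 j : fswap r j (pos_succ s) = j (pos_succ s) :> nat by rewrite fswap_other.
have a3 j : fswap s j (pos_succ r) = j (pos_succ s) :> nat by rewrite -prs fswap_pos.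
have a4 j : fswap s j (pos_succ s) = j (pos_succ r) :> nat by rewrite fswap_pos_succ prs.
rewrite addrfctE opprfctE /defP prs.
rewrite !(a1, a2, a3, a4, fswap_pos, fswap_pos_succ) !fswapK (fswap_braid t rs).
have ab : t (pos r) != t (pos_succ r) by apply: T_neq.
have bc : t (pos_succ r) != t (pos_succ s) by rewrite -prs; apply: T_neq.
have ac := T_neq2 tT rs.
rewrite [LHS]braid_expand (braid_coef1 kk p ab bc ac) (braid_coef2 kk p ab bc ac).
by rewrite (braid_coef3 kk p3 ab bc ac) !mulr0 !mul0r !addr0.
Qed.

End DeformedModule.

Lemma common_denominator (F : fieldType) (O : F -> Prop) (zs : seq F) :
  O 1 -> (forall a b, O a -> O b -> O (a * b)) ->
  {in zs, forall z, O z /\ z != 0} ->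
  exists D, [/\ O D, D != 0 & {in zs, forall z, O (D * z^-1)}].
Proof.
move=> O1 OM; elim: zs => [_|z zs ih h]; first by exists 1; rewrite oner_neq0.
have [D [D1 D2 D3]] : exists D, [/\ O D, D != 0 & {in zs, forall z, O (D * z^-1)}].
  by apply: ih => x hx; apply: h; rewrite inE hx orbT.
have [z1 z2] := h z (mem_head _ _).
exists (z * D); split; [exact: OM | exact: mulf_neq0 |] => x.
rewrite inE => /orP[/eqP ->|hx]; first by rewrite mulrAC mulfV // mul1r.
by rewrite -mulrA; apply: OM => //; apply: D3.
Qed.

(** * The lattice and the survival of the idempotent *)

Section DeformedLattice.
Variables (kk : fieldType) (p n : nat).
Hypothesis p3 : (2 < p)%N.
Local Notation K := {fraction {poly kk}}.
Local Notation C := {ffun 'I_n -> nat}.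
Local Notation V := (C -> K^o).
Local Notation F := (free_alg kk (generator p n)).
Local Notation H := (qH kk p n).
Local Notation qp := (@qpow kk).
Local Notation dc := (@dcoef kk p).
Local Notation cc := (@ccoef kk p).
Implicit Types (t : C) (u : V).

Variable T : seq C.
Hypothesis T_swap : forall t r, t \in T -> t (pos r) != (t (pos_succ r)).+1 ->
  t (pos_succ r) != (t (pos r)).+1 -> fswap r t \in T.
Hypothesis T_neq : forall t r, t \in T -> t (pos r) != t (pos_succ r).
Hypothesis T_neq2 : forall t (r s : 'I_n.-1), t \in T -> s = r.+1 :> nat ->
  t (pos r) != t (pos_succ s).
Variable d0 : nat.
Hypothesis d0_res : d0%:R = 0 :> 'Z_p.
Hypothesis T_start : forall t (r : 'I_n), t \in T -> r = 0%N :> nat -> t r = d0.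
Variable t0 : C.
Hypothesis t0T : t0 \in T.

Local Notation cres := (@cres p n).
Local Notation defE := (@defE kk p n).
Local Notation defY := (@defY kk n).
Local Notation defP := (@defP kk p n).
Local Notation carried := (@carried kk n T).

Local Opaque free_e free_y free_psi quot_mul quot_add quot_opp quot_scale.

Definition defgen (g : generator p n) : V -> V :=
  match g with
  | inl (inl i) => defE i
  | inl (inr r) => defY r
  | inr r => defP r
  end.

Fact defgen_linear g : linear (defgen g).
Proof.
have E (F : comNzRingType) (a b c u v u' v' : F) :
    a * (c * u + v) + b * (c * u' + v') = c * (a * u + b * u') + (a * v + b * v') by ring.
have E1 (F : comNzRingType) (a c u v : F) :
    a * (c * u + v) = c * (a * u) + a * v by ring.
move=> c u v; apply/funext => t; case: g => [[i|r]|r] /=; [exact: E1|exact: E1|].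
exact: E.
Qed.

HB.instance Definition _ g :=
  GRing.isLinear.Build K V V _ (defgen g) (defgen_linear g).

Definition poly_scal : {rmorphism kk -> K} :=
  (@FracField.tofrac {poly kk} : {rmorphism {poly kk} -> K}) \o polyC.

Local Notation dact :=
  (@act kk (generator p n) K poly_scal V (fun g => defgen g)).

Definition v0 : V := fun t => (t == t0)%:R.

Definition integral (c : K) := exists q : {poly kk}, c = FracField.tofrac q.

Lemma integral1 : integral 1. Proof. by exists 1; rewrite tofrac1. Qed.
Lemma integral0 : integral 0. Proof. by exists 0; rewrite tofrac0. Qed.
Lemma integralN a : integral a -> integral (- a).
Proof. by case=> q ->; exists (- q); rewrite tofracN. Qed.
Lemma integralM a b : integral a -> integral b -> integral (a * b).
Proof. by case=> q -> [q' ->]; exists (q * q'); rewrite tofracM. Qed.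
Lemma integralD a b : integral a -> integral b -> integral (a + b).
Proof. by case=> q -> [q' ->]; exists (q + q'); rewrite tofracD. Qed.
Lemma integral_bool (b : bool) : integral b%:R.
Proof. by case: b; [exact: integral1 | exact: integral0]. Qed.
Lemma integral_qpow a : integral (qp a).
Proof. by exists (('X + 1) ^+ a). Qed.

Inductive lattice : V -> Prop :=
| lattice0 : lattice 0
| latticeP c u v : integral c -> lattice u -> lattice v -> lattice (c *: u + v)
| lattice_v0 : lattice v0
| lattice_gen g u : lattice u -> lattice (defgen g u).

Definition varpi : K := FracField.tofrac 'X.

Lemma qpow1E : qp 1 = varpi + 1.
Proof. by rewrite /qpow expr1 tofracD tofrac1. Qed.

Definition varpi_lattice u := exists2 w, lattice w & u = varpi *: w.

Lemma latticeZ c u : integral c -> lattice u -> lattice (c *: u).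
Proof. by move=> hc hu; rewrite -[_ *: _]addr0; apply: latticeP => //; exact: lattice0. Qed.

Lemma latticeD u v : lattice u -> lattice v -> lattice (u + v).
Proof. by move=> hu hv; rewrite -[u]scale1r; apply: latticeP => //; exact: integral1. Qed.

Lemma lattice_carried u : lattice u -> carried u.
Proof.
elim=> {u} [//|c u v _ _ hu _ hv|t tT|g u _ hu].
- by move=> t tT; rewrite addrfctE scalrfctE hu // hv // scaler0 addr0.
- by rewrite /v0; case: eqP tT => // ->; rewrite t0T.
- case: g => [[i|r]|r] /=; [exact: carried_defE|exact: carried_defY|].
  exact: carried_defP.
Qed.

Lemma varpi_lattice0 : varpi_lattice 0.
Proof. by exists 0; [exact: lattice0 | rewrite scaler0]. Qed.

Lemma varpi_lattice_gen g u : varpi_lattice u -> varpi_lattice (defgen g u).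
Proof. by case=> w hw ->; exists (defgen g w); [exact: lattice_gen | rewrite linearZ]. Qed.

Lemma varpi_latticeP c u v : integral c ->
  varpi_lattice u -> varpi_lattice v -> varpi_lattice (c *: u + v).
Proof.
move=> hc [w hw ->] [w' hw' ->]; exists (c *: w + w'); first exact: latticeP.
by rewrite scalerDr !scalerA mulrC.
Qed.

Lemma integral_scal c : integral (poly_scal c).
Proof. by exists c%:P. Qed.

Lemma defE_mul_eq (f f' : C -> K) i u : (forall t, cres t = i -> f t = f' t) ->
  (fun t => f t * defE i u t) = (fun t => f' t * defE i u t) :> V.
Proof.
move=> h; apply/funext => t; rewrite /defE.
by case: eqP => [/h ->//|_]; rewrite !mul0r !mulr0.
Qed.

Lemma cres_eqr_succ (i : res_seq p n) t k l : cres t = i ->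
  (i k == i l + 1) = eqr p (t k) (t l).+1.
Proof. by move=> <-; rewrite /eqr -natr1 !ffunE. Qed.

Lemma eq_predE (a b : 'Z_p) : (b == a - 1) = (a == b + 1).
Proof. by rewrite eq_sym subr_eq. Qed.

Lemma eqr_of (i : res_seq p n) t k l : cres t = i -> (i k == i l) = eqr p (t k) (t l).
Proof. by move=> <-; rewrite /eqr !ffunE. Qed.

(** This is multiplication by [qpow (t r)], which enters the deformed quadratic relation with the
    factor X. *)
Definition shiftY r u : V := defY r u + u.

Lemma lattice_shiftY r u : lattice u -> lattice (shiftY r u).
Proof. by move=> hu; apply: latticeD => //; exact: (@lattice_gen (inl (inr r))). Qed.

Lemma defP_sq r i u : carried u -> let w := defE i u in
  defP r (defP r w) =
  if i (pos r) == i (pos_succ r) then 0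
  else if i (pos_succ r) == i (pos r) - 1 then
    defY (pos_succ r) w - defY (pos r) w + varpi *: shiftY (pos_succ r) w
  else if i (pos_succ r) == i (pos r) + 1 then
    defY (pos r) w - defY (pos_succ r) w + varpi *: shiftY (pos r) w
  else w.
Proof.
have E1 (F : comNzRingType) (x a b v : F) :
   ((x + 1) * a - b) * v = (a - 1) * v - (b - 1) * v + x * ((a - 1) * v + v) by ring.
move=> hu w; rewrite (defP_defP p3 T_swap T_neq) /w; last exact: carried_defE.
have [h|h] := boolP (i (pos r) == i (pos_succ r)).
  rewrite (defE_mul_eq (f' := fun=> 0)) => [|t ti]; last by rewrite -(eqr_of _ _ ti) h.
  by apply/funext => t; rewrite mul0r.
have [h2|h2] := boolP (i (pos_succ r) == i (pos r) - 1).
  rewrite eq_predE in h2.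
  rewrite (defE_mul_eq (f' := fun t => qp 1 * qp (t (pos_succ r)) - qp (t (pos r)))).
    by apply/funext => t; rewrite qpow1E; exact: E1.
  move=> t ti; rewrite -(eqr_of _ _ ti) (negbTE h) qcoef_sym // /qcoef.
  by rewrite -(cres_eqr_succ _ _ ti) h2.
rewrite eq_predE in h2.
have [h3|h3] := boolP (i (pos_succ r) == i (pos r) + 1).
  rewrite (defE_mul_eq (f' := fun t => qp 1 * qp (t (pos r)) - qp (t (pos_succ r)))).
    by apply/funext => t; rewrite qpow1E; exact: E1.
  move=> t ti; rewrite -(eqr_of _ _ ti) (negbTE h) /qcoef.
  by rewrite -(cres_eqr_succ _ _ ti) h3.
rewrite (defE_mul_eq (f' := fun t => 1)) => [|t ti].
  by apply/funext => t; rewrite mul1r.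
rewrite -(eqr_of _ _ ti) (negbTE h) /qcoef.
by rewrite -!(cres_eqr_succ _ _ ti) (negbTE h2) (negbTE h3).
Qed.

Lemma defP_braid_res (r s : 'I_n.-1) i u : s = r.+1 :> nat -> carried u ->
  let w := defE i u in
  defP r (defP s (defP r w)) - defP s (defP r (defP s w)) =
  if (i (pos r) == i (pos_succ s)) && (i (pos r) == i (pos_succ r) + 1) then - w
  else if (i (pos r) == i (pos_succ s)) && (i (pos r) == i (pos_succ r) - 1)
  then w + varpi *: w else 0.
Proof.
have E1 (F : comNzRingType) (x v : F) : (x + 1) * v = v + x * v by ring.
move=> rs hu w; rewrite (defP_braid p3 T_swap T_neq T_neq2 rs) /w; last exact: carried_defE.
set b1 := _ && _; set b2 := _ && _.
rewrite (defE_mul_eq (f' := fun=> if b1 then -1 else if b2 then qp 1 else 0)); last first.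
  move=> t ti; rewrite /b1 /b2 /braid_coef -!(eqr_of _ _ ti) eq_predE.
  by rewrite -!(cres_eqr_succ _ _ ti).
case: b1; first by apply/funext => t; rewrite mulN1r.
case: b2; last by apply/funext => t; rewrite mul0r.
by apply/funext => t; rewrite qpow1E; exact: E1.
Qed.

Lemma qpow_sub1 a : exists2 c, integral c & qp a - 1 = varpi * c.
Proof.
exists (FracField.tofrac (\sum_(i < a) ('X + 1) ^+ i)); first by eexists.
by rewrite /qpow -tofrac1 -tofracB -tofracM subrX1 addrK.
Qed.

(** The first entry is always [d0], of residue 0. If [i] starts with 0, the first [y] is the scalar
    (1 + X)^d0 - 1, a multiple of X; otherwise the idempotent of [i] kills every function carried by
    [T]. *)
Lemma defY_start (r : 'I_n) (i : res_seq p n) u : r = 0%N :> nat -> lattice u ->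
  varpi_lattice (if i r == 0 then defY r (defE i u) else defE i u).
Proof.
move=> r0 hu; have hc := lattice_carried hu.
have hE : lattice (defE i u) by exact: (@lattice_gen (inl (inl i))).
have [h|h] := boolP (i r == 0); last first.
  rewrite (_ : defE i u = 0); first exact: varpi_lattice0.
  apply: (pointwise (carried_defE _ hc)) => // t tT; rewrite /defE.
  case: eqP => [ti|_]; last by rewrite mul0r.
  by case/eqP: h; rewrite -ti ffunE (T_start tT r0) d0_res.
have [c hcc E] := qpow_sub1 d0.
exists (c *: defE i u); first exact: latticeZ.
apply: (pointwise (T := T)) => [||t tT].
- by apply: carried_defY; apply: carried_defE.
- by move=> t tT; rewrite scalerA scalrfctE (carried_defE _ hc) // scaler0.
by rewrite {1}/defY (T_start tT r0) E scalerA.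
Qed.

Lemma dact_e i u : dact (free_e kk i) u = defE i u.
Proof. exact: act_var. Qed.
Lemma dact_y r u : dact (free_y kk p r) u = defY r u.
Proof. exact: act_var. Qed.
Lemma dact_psi r u : dact (free_psi kk p r) u = defP r u.
Proof. exact: act_var. Qed.

Lemma dact_mulE x z X Z : (forall m, dact x m = X m) ->
  (forall m, dact z m = Z m) -> forall m, dact (x * z) m = X (Z m).
Proof. by move=> hx hz m; rewrite actM hz hx. Qed.
Lemma dact_addE x z X Z : (forall m, dact x m = X m) ->
  (forall m, dact z m = Z m) -> forall m, dact (x + z) m = X m + Z m.
Proof. by move=> hx hz m; rewrite actDl hz hx. Qed.
Lemma dact_subE x z X Z : (forall m, dact x m = X m) ->
  (forall m, dact z m = Z m) -> forall m, dact (x - z) m = X m - Z m.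
Proof. by move=> hx hz m; rewrite actBl hz hx. Qed.
Lemma dact_oppE x X : (forall m, dact x m = X m) -> forall m, dact (- x) m = - X m.
Proof. by move=> hx m; rewrite actNl hx. Qed.
Lemma dact_0 m : dact 0 m = 0.
Proof. exact: act0l. Qed.
Lemma dact_1 m : dact 1 m = m.
Proof. exact: act1l. Qed.
Lemma dact_bool (b : bool) m : dact b%:R m = if b then m else 0.
Proof. by case: b; [exact: dact_1 | exact: dact_0]. Qed.

Lemma eqpart_defE r i u :
  eqpart p r (defE i u) = if i (pos r) == i (pos_succ r) then defE i u else 0.
Proof.
rewrite /eqpart (defE_mul_eq (f' := fun=> (i (pos r) == i (pos_succ r))%:R)); last first.
  by move=> t ti; rewrite -(eqr_of _ _ ti).
by apply/funext => t; case: ifP => _; rewrite ?mul1r ?mul0r.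
Qed.

Definition eq_mod_varpi u v := exists2 w, lattice w & u = v + varpi *: w.

Lemma eq_mod_varpi_eq u v : u = v -> eq_mod_varpi u v.
Proof. by move=> ->; exists 0; [exact: lattice0 | rewrite scaler0 addr0]. Qed.

(** A correction is made in three cases only: the quadratic relation for adjacent residues, the
    braid relation with right side [e i], and the cyclotomic relation. *)
Lemma dact_rel a b u : qH_rel a b -> lattice u -> eq_mod_varpi (dact a u) (dact b u).
Proof.
move=> ab hu; have hc := lattice_carried hu.
have through x z v w : x = v -> z = w -> eq_mod_varpi v w -> eq_mod_varpi x z.
  by move=> -> ->.
have hE i : lattice (defE i u) by exact: (@lattice_gen (inl (inl i))).
have cE i : carried (defE i u) := lattice_carried (hE i).
case: ab => {a b}.
- move=> i j; apply: eq_mod_varpi_eq.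
  apply: (eq_through (dact_mulE (dact_e i) (dact_e j) u) _ (defE_defE i j u)).
  by case: ifP => _; [exact: dact_e | exact: dact_0].
- apply: eq_mod_varpi_eq; rewrite dact_1 act_suml (eq_bigr _ (fun i _ => dact_e i u)).
  by apply/funext => t; rewrite fct_sumE; exact: defE_sum.
- move=> r i; apply: eq_mod_varpi_eq.
  exact: (eq_through (dact_mulE (dact_y r) (dact_e i) u)
    (dact_mulE (dact_e i) (dact_y r) u) (defY_defE r i u)).
- move=> r i; apply: eq_mod_varpi_eq.
  exact: (eq_through (dact_mulE (dact_psi r) (dact_e i) u)
    (dact_mulE (dact_e _) (dact_psi r) u) (defP_defE r i u)).
- move=> r s; apply: eq_mod_varpi_eq.
  exact: (eq_through (dact_mulE (dact_y r) (dact_y s) u)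
    (dact_mulE (dact_y s) (dact_y r) u) (defY_defY r s u)).
- move=> r s h h'; apply: eq_mod_varpi_eq.
  exact: (eq_through (dact_mulE (dact_psi r) (dact_y s) u)
    (dact_mulE (dact_y s) (dact_psi r) u) (defP_defY p u h h')).
- move=> r s h; apply: eq_mod_varpi_eq.
  exact: (eq_through (dact_mulE (dact_psi r) (dact_psi s) u)
    (dact_mulE (dact_psi s) (dact_psi r) u) (defP_far p u h)).
- move=> r i; apply: eq_mod_varpi_eq.
  apply: (eq_through (dact_mulE (dact_mulE (dact_y _) (dact_psi r)) (dact_e i) u)
    (dact_mulE (dact_addE (dact_mulE (dact_psi r) (dact_y _))
      (dact_bool _)) (dact_e i) u)).
  by rewrite (defY_pos_defP p T_swap T_neq) // eqpart_defE.
- move=> r i; apply: eq_mod_varpi_eq.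
  apply: (eq_through (dact_mulE (dact_mulE (dact_y _) (dact_psi r)) (dact_e i) u)
    (dact_mulE (dact_subE (dact_mulE (dact_psi r) (dact_y _))
      (dact_bool _)) (dact_e i) u)).
  by rewrite (defY_pos_succ_defP p T_swap T_neq) // eqpart_defE.
- move=> r i; apply: (through _ _ _ _ (dact_mulE (dact_mulE (dact_psi r) (dact_psi r)) (dact_e i) u) erefl).
  rewrite (defP_sq _ _ hc).
  case: ifP => _; first by apply: eq_mod_varpi_eq; rewrite dact_0.
  case: ifP => _.
    rewrite (dact_mulE (dact_subE (dact_y _) (dact_y _)) (dact_e i) u).
    by exists (shiftY (pos_succ r) (defE i u)); [apply: lattice_shiftY | exact: erefl].
  case: ifP => _; last by apply: eq_mod_varpi_eq; rewrite dact_e.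
  rewrite (dact_mulE (dact_subE (dact_y _) (dact_y _)) (dact_e i) u).
  by exists (shiftY (pos r) (defE i u)); [apply: lattice_shiftY | exact: erefl].
- move=> r s i h; apply: (through _ _ _ _ (dact_mulE (dact_subE
      (dact_mulE (dact_mulE (dact_psi r) (dact_psi s)) (dact_psi r))
      (dact_mulE (dact_mulE (dact_psi s) (dact_psi r)) (dact_psi s)))
      (dact_e i) u) erefl).
  rewrite (defP_braid_res _ h hc).
  case: ifP => _; first by apply: eq_mod_varpi_eq; rewrite (dact_oppE (dact_e i)).
  case: ifP => _; last by apply: eq_mod_varpi_eq; rewrite dact_0.
  by rewrite dact_e; exists (defE i u).
- move=> r i h; apply: (through _ _ (if i r == 0 then defY r (defE i u) else defE i u)
    0 _ (dact_0 u)).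
    case: (i r == 0); first exact: (dact_mulE (dact_y r) (dact_e i) u).
    exact: (dact_mulE dact_1 (dact_e i) u).
  by have [w hw ->] := defY_start i h hu; exists w; rewrite ?add0r.
Qed.

Definition nonres (j : res_seq p n) := forall t, t \in T -> cres t <> j.

Lemma dact_nonres z u :
  ideal_gen (fun x : F => exists2 j, nonres j & x = free_e kk j) z ->
  carried u -> dact z u = 0.
Proof.
refine (@act_ideal_gen kk (generator p n) K poly_scal V (fun g => defgen g)
  _ carried (fun u => u = 0) _ _ _ _ _ _ _ z u) => //.
- move=> g v hv; case: g => [[i|r]|r] /=; [exact: carried_defE|exact: carried_defY|].
  exact: carried_defP.
- by move=> g v ->; rewrite linear0.
- move=> c v w hv hw t tT; rewrite addrfctE scalrfctE hv // hw // scaler0 addr0 //.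
- by move=> c v w -> ->; rewrite scaler0 addr0.
- move=> g v [j hj ->] hv; rewrite dact_e.
  apply: (pointwise (carried_defE _ hv)) => // t tT.
  by rewrite /defE; case: eqP => [/hj //|_]; rewrite mul0r.
Qed.

Lemma dact_relations z u :
  ideal_gen (fun x : F => exists a b, qH_rel a b /\ x = a - b) z ->
  lattice u -> varpi_lattice (dact z u).
Proof.
refine (@act_ideal_gen kk (generator p n) K poly_scal V (fun g => defgen g)
  _ lattice varpi_lattice _ _ _ _ _ _ _ z u).
- by move=> g v hv; apply: lattice_gen.
- exact: varpi_lattice_gen.
- exact: lattice0.
- by move=> c v w hv hw; apply: latticeP => //; exact: integral_scal.
- exact: varpi_lattice0.
- by move=> c v w hv hw; apply: varpi_latticeP => //; exact: integral_scal.
- move=> g v [a [b [ab ->]]] hv; rewrite actBl.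
  by have [w hw ->] := dact_rel ab hv; exists w; rewrite // addrAC subrr add0r.
Qed.

Lemma lift_nonres x :
  ideal_gen (fun x : H => exists2 j, nonres j & x = e_ kk j) x ->
  exists2 z, piH z = x &
    ideal_gen (fun x : F => exists2 j, nonres j & x = free_e kk j) z.
Proof.
elim=> [|a g b {}x [j hj ->] _ [z hz Iz]]; first by exists 0; [exact: piH0 | exact: ideal_gen0].
have [a' ha] := piHK a; have [b' hb] := piHK b.
exists (a' * free_e kk j * b' + z).
  exact: (piH_addE (piH_mulE (piH_mulE ha (piH_e kk j)) hb) hz).
by apply: ideal_genD => //; exists j.
Qed.

(** Under the hypothesis e differs by an element of the ideal of relations from an element of the
    free algebra that acts by zero, so e maps the lattice into X times itself. As e fixes [v0],
    which generates the lattice, every vector of the lattice is divisible by X. *)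
Lemma lattice_divisible u :
  ideal_gen (fun x : H => exists2 j, nonres j & x = e_ kk j) (e_ kk (cres t0)) ->
  lattice u -> varpi_lattice u.
Proof.
move=> /lift_nonres [z hz Iz].
have h0 : varpi_lattice v0.
  have hI := piH_eq0 (etrans (piH_subE (piH_e kk (cres t0)) hz) (subrr _)).
  have := dact_relations hI lattice_v0.
  rewrite actBl dact_e (dact_nonres Iz (lattice_carried lattice_v0)) subr0.
  rewrite (_ : defE _ v0 = v0) //; apply/funext => t; rewrite /defE /v0.
  by case: (eqVneq t t0) => [->|]; rewrite ?eqxx ?mul1r ?mulr0.
elim=> {u} [|c u v hc _ hu _ hv|//|g u _ hu].
- exact: varpi_lattice0.
- exact: varpi_latticeP.
- exact: varpi_lattice_gen.
Qed.

(** Letters are natural numbers, as in the word reduction; those out of range act by 0. *)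
Definition nletter (r : nat) (u : V) : V :=
  if insub r is Some r' then defP (r' : 'I_n.-1) u else 0.

Local Notation SP := (short_span integral n.-1 nletter v0).
Local Notation pw := (pword nletter v0).
Local Notation letters := (all (fun r : nat => (r < n.-1)%N)).

Lemma nletterE r (hr : (r < n.-1)%N) u : nletter r u = defP (Ordinal hr) u.
Proof. by rewrite /nletter insubT. Qed.

Lemma pw_carried w : carried (pw w).
Proof.
elim: w => [|r w ih] /=; first exact: lattice_carried lattice_v0.
by rewrite /nletter; case: insubP => // r' _ _; apply: carried_defP.
Qed.

Let SPP l c u v := @short_spanP K integral integralM V n.-1 nletter v0 l c u v.
Let SPZ l c u := @short_spanZ K integral integralM V n.-1 nletter v0 l c u.
Let SPA l u v := @short_spanA K integral integral1 integralM V n.-1 nletter v0 l u v.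
Let SPB l u v := @short_spanB K integral integral1 (integralN integral1) integralM V n.-1 nletter v0 l u v.

Lemma nletter_linear r : (r < n.-1)%N -> linear (nletter r).
Proof.
move=> hr c u v; rewrite !(nletterE hr); exact: (defgen_linear (inr (Ordinal hr))).
Qed.

Let pwordS' r l u (hr : (r < n.-1)%N) : SP l u -> SP l.+1 (nletter r u) :=
  @pwordS K integral V n.-1 nletter v0 nletter_linear r l u hr.

Let defE_lin i : linear (defE i) := defgen_linear (inl (inl i)).
Let defY_lin r : linear (defY r) := defgen_linear (inl (inr r)).

Lemma SP_sum l (I : finType) (P : pred I) (f : I -> V) :
  (forall i, P i -> SP l (f i)) -> SP l (\sum_(i | P i) f i).
Proof.
by move=> h; elim/big_ind: _ => //; [exact: short_span0 | exact: SPA].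
Qed.

Lemma SP_word_linear (g : V -> V) : linear g ->
  (forall w, letters w -> SP (size w).+1 (g (pw w))) ->
  forall l u, SP l u -> SP l (g u).
Proof.
move=> lg hw l u; elim=> {u} [|c w u hc sw aw _ ih].
  have := lg 1 0 0; rewrite !scale1r addr0 => h.
  have -> : g 0 = 0 by apply: (addrI (g 0)); rewrite -h addr0.
  exact: short_span0.
rewrite lg; apply: SPP => //.
by apply: short_span_leq (hw _ aw).
Qed.

Lemma SP_v0 : SP 1 v0.
Proof. exact: (@short_span_word K integral integral1 V n.-1 nletter v0 1 [::]). Qed.

Lemma SP_defE l i u : SP l u -> SP l (defE i u).
Proof.
apply: SP_word_linear; first exact: defE_lin.
move=> w; elim: w i => [|r w ih] i /= aw.
  rewrite (_ : defE i v0 = (cres t0 == i)%:R *: v0).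
    by apply: SPZ SP_v0; exact: integral_bool.
  by apply/funext => t; rewrite /defE /v0 scalrfctE; case: (eqVneq t t0) => [->//|_]; rewrite mulr0 scaler0.
case/andP: aw => hr aw; rewrite (nletterE hr).
rewrite -[i](@swap_resK p n (Ordinal hr)) -defP_defE -nletterE.
by apply: pwordS' => //; apply: ih.
Qed.

Lemma eqpart_sum r u :
  eqpart p r u = \sum_(i : res_seq p n | i (pos r) == i (pos_succ r)) defE i u.
Proof.
apply/funext => t; rewrite fct_sumE big_mkcond (bigD1 (cres t)) //= big1 ?addr0.
  rewrite /defE eqxx mul1r cres_eqr /eqpart.
  by case: ifP; rewrite ?mul1r ?mul0r.
move=> i it; case: ifP => // _.
by rewrite /defE eq_sym (negbTE it) mul0r.
Qed.

Lemma SP_eqpart l r u : SP l u -> SP l (eqpart p r u).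
Proof. by move=> h; rewrite eqpart_sum; apply: SP_sum => i _; apply: SP_defE. Qed.

Lemma SP_defY l s u : SP l u -> SP l (defY s u).
Proof.
apply: SP_word_linear; first exact: defY_lin.
move=> w; elim: w s => [|r w ih] s /= aw.
  rewrite (_ : defY s v0 = (qp (t0 s) - 1) *: v0).
    apply: SPZ SP_v0; apply: integralD; first exact: integral_qpow.
    exact: (integralN integral1).
  by apply/funext => t; rewrite /defY /v0 scalrfctE; case: (eqVneq t t0) => [->//|_]; rewrite mulr0 scaler0.
case/andP: aw => hr aw; rewrite (nletterE hr).
have hw : SP (size w).+1 (pw w).
  exact: (@short_span_word K integral integral1 V n.-1 nletter v0).
have S1 s' : SP (size w).+2 (defP (Ordinal hr) (defY s' (pw w))).
  by rewrite -nletterE; apply: pwordS' => //; apply: ih.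
have S2 : SP (size w).+2 (eqpart p (Ordinal hr) (pw w)).
  by apply: (@short_span_leq K integral V n.-1 nletter v0 _ _ _ (leqnSn _)); apply: SP_eqpart.
have [->|h1] := eqVneq s (pos (Ordinal hr)).
  rewrite (defY_pos_defP p T_swap T_neq) ?pw_carried //; first exact: SPA.
  exact: pw_carried.
have [->|h2] := eqVneq s (pos_succ (Ordinal hr)).
  rewrite (defY_pos_succ_defP p T_swap T_neq) ?pw_carried //; first exact: SPB.
  exact: pw_carried.
by rewrite -defP_defY.
Qed.

Lemma SP_defP_sq l r u : carried u -> SP l u -> SP l (defP r (defP r u)).
Proof.
move=> hc hu.
have -> : defP r (defP r u) = \sum_i defP r (defP r (defE i u)).
  rewrite -[in LHS](_ : \sum_i defE i u = u); last first.
    by apply/funext => t; rewrite fct_sumE; exact: defE_sum.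
  have L : linear (defP r) := defgen_linear (inr r).
  have S (f : res_seq p n -> V) : defP r (\sum_i f i) = \sum_i defP r (f i).
    have := linear_sum_seq (index_enum _) (fun=> 1) f L.
    under eq_bigr do rewrite scale1r.
    by under [RHS]eq_bigr do rewrite scale1r.
  by rewrite !S.
apply: SP_sum => i _; rewrite (defP_sq _ _ hc).
have hw := SP_defE i hu.
have int1 : integral varpi by exists 'X.
have sh s : SP l (varpi *: shiftY s (defE i u)).
  by apply: SPZ => //; apply: SPA => //; apply: SP_defY.
case: ifP => _; first exact: short_span0.
case: ifP => _; first by apply: SPA => //; apply: SPB; apply: SP_defY.
case: ifP => _ //.
by apply: SPA => //; apply: SPB; apply: SP_defY.
Qed.

Lemma SP_defP_braid l (r s : 'I_n.-1) u : s = r.+1 :> nat -> carried u -> SP l u ->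
  SP l (defP r (defP s (defP r u)) - defP s (defP r (defP s u))).
Proof.
move=> rs hc hu.
have -> : defP r (defP s (defP r u)) - defP s (defP r (defP s u)) =
  \sum_i (defP r (defP s (defP r (defE i u))) - defP s (defP r (defP s (defE i u)))).
  rewrite -[in LHS](_ : \sum_i defE i u = u); last first.
    by apply/funext => t; rewrite fct_sumE; exact: defE_sum.
  have S q (f : res_seq p n -> V) : defP q (\sum_i f i) = \sum_i defP q (f i).
    have L : linear (defP q) := defgen_linear (inr q).
    have := linear_sum_seq (index_enum _) (fun=> 1) f L.
    under eq_bigr do rewrite scale1r.
    by under [RHS]eq_bigr do rewrite scale1r.
  by rewrite !S sumrB.
apply: SP_sum => i _; rewrite (defP_braid_res _ rs hc).
have hw := SP_defE i hu.
have int1 : integral varpi by exists 'X.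
case: ifP => _; first by rewrite -scaleN1r; apply: SPZ => //; exact: (integralN integral1).
case: ifP => _; last exact: short_span0.
by apply: SPA => //; apply: SPZ.
Qed.

(** The [e] and [y] pass through a word in the [psi] without lengthening it and act on [v0] by
    integral scalars, so words in the [psi] applied to [v0] span the lattice over kk[X]; the word
    reduction bounds their length. *)
Lemma lattice_short u : lattice u -> SP ('C(n.-1.+1, 2)).+1 u.
Proof.
have bound l v : SP l v -> SP ('C(n.-1.+1, 2)).+1 v.
  apply: (short_span_bound integral1 (integralN integral1) integralM nletter_linear).
  - move=> r w hr aw; rewrite !(nletterE hr).
    apply: SP_defP_sq; first exact: pw_carried.
    exact: (@short_span_word K integral integral1 V n.-1 nletter v0).
  - move=> r w hr aw; have hr' := ltnW hr.
    rewrite !(nletterE hr') !(nletterE hr).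
    apply: SP_defP_braid => //; first exact: pw_carried.
    exact: (@short_span_word K integral integral1 V n.-1 nletter v0).
  - move=> r s w hr hs rs aw; rewrite !(nletterE hr) !(nletterE hs).
    by rewrite defP_far //= rs.
elim=> {u} [|c u v hc _ hu _ hv||g u _ hu].
- exact: short_span0.
- exact: SPP.
- exact: bound SP_v0.
case: g => [[i|r]|r] /=; [exact: SP_defE|exact: SP_defY|].
case: r => r hr; rewrite -(nletterE hr); apply: (bound ('C(n.-1.+1, 2)).+2).
exact: pwordS'.
Qed.

(** The only denominators are the differences of [qpow] at neighbouring entries of members of the
    finite list [T]. One [D] clears them all, and each letter costs one factor [D]. *)
Lemma word_denominator : exists D, [/\ integral D, D != 0 &
  forall w t, letters w -> integral (D ^+ size w * pw w t)].
Proof.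
pose zs := [seq qp (t (pos r)) - qp (t (pos_succ r)) | t <- T, r <- enum 'I_n.-1].
have [D [D1 D2 D3]] : exists D, [/\ integral D, D != 0 &
    {in zs, forall z, integral (D * z^-1)}].
  apply: (common_denominator integral1 integralM) => z /allpairsP [[t r] /= [tT _ ->]]; split.
    apply: integralD; first exact: integral_qpow.
    by apply: integralN; exact: integral_qpow.
  by apply: qpowB_neq0; apply: T_neq.
exists D; split=> // w t; elim: w t => [|r w ih] t /= aw.
  by rewrite expr0 mul1r /v0; exact: integral_bool.
case/andP: aw => hr aw.
have [tT|tT] := boolP (t \in T); last first.
  have /= -> := @pw_carried (r :: w) t tT.
  by rewrite mulr0; exact: integral0.
rewrite (nletterE hr) /defP.
set r' := Ordinal hr; set a := t (pos r'); set b := t (pos_succ r').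
have hi : integral (D * (qp a - qp b)^-1).
  by apply: D3; apply/allpairsP; exists (t, r'); rewrite mem_enum.
have h1 : integral (D * dc a b).
  by rewrite /dcoef; case: ifP => _ //; rewrite mulr0; exact: integral0.
have h2 : integral (D * cc a b).
  rewrite /ccoef; case: ifP => _ //; case: ifP => _; first by rewrite mulr0; exact: integral0.
  case: ifP => _; last by rewrite mulr1.
  apply: integralM => //; apply: integralD; last by apply: integralN; exact: integral_qpow.
  by apply: integralM; exact: integral_qpow.
have -> : D ^+ (size w).+1 * (dc a b * pw w t + cc a b * pw w (fswap r' t)) =
  (D * dc a b) * (D ^+ size w * pw w t) + (D * cc a b) * (D ^+ size w * pw w (fswap r' t)).
  rewrite exprS; move: (D ^+ _) (pw w t : K) (pw w (fswap r' t) : K) (dc a b) (cc a b).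
  have E (R : comNzRingType) (x y u v d c : R) :
    x * y * (d * u + c * v) = x * d * (y * u) + x * c * (y * v) by ring.
  by move=> y u v d c; exact: E.
by apply: integralD; apply: integralM => //; apply: ih.
Qed.

(** Otherwise, for every m, the lattice contains a vector [u] with [v0] equal to X^m [u]. Evaluation
    at [t0] then makes X^m divide the fixed nonzero polynomial [D ^+ B]. *)
Theorem idempotent_survives :
  ~ ideal_gen (fun x : H => exists2 j, nonres j & x = e_ kk j) (e_ kk (cres t0)).
Proof.
move=> hI.
have [D [D1 D2 D3]] := word_denominator.
set B := ('C(n.-1.+1, 2)).+1.
have hB u : lattice u -> forall t, integral (D ^+ B * u t).
  move=> /lattice_short; elim=> {u} [|c w u hc sw aw _ ih] t.
    by rewrite mulr0; exact: integral0.
  have E (R : comNzRingType) (x y z a v b : R) : x * y = z -> z * (a * v + b) =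
      a * (x * (y * v)) + z * b by move=> <-; ring.
  have hp : D ^+ (B - size w) * D ^+ size w = D ^+ B.
    by rewrite -exprD subnK // ltnW.
  rewrite (_ : D ^+ B * (c *: pw w + u) t =
    c * (D ^+ (B - size w) * (D ^+ size w * pw w t)) + D ^+ B * u t); last exact: (E _ _ _ _ _ _ _ hp).
  apply: integralD => //; apply: integralM => //; apply: integralM; last exact: D3.
  elim: (B - size w)%N => [|m ihm]; first exact: integral1.
  by rewrite exprS; apply: integralM.
have hm m : exists2 u, lattice u & v0 = varpi ^+ m *: u.
  elim: m => [|m [u hu E]]; first by exists v0; [exact: lattice_v0 | rewrite expr0 scale1r].
  have [w hw Ew] := lattice_divisible hI hu.
  by exists w => //; rewrite E Ew scalerA exprSr.
have [q hq] : integral (D ^+ B).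
  by have := hB _ lattice_v0 t0; rewrite /v0 eqxx mulr1.
have q0 : q != 0.
  have : D ^+ B != 0 by rewrite expf_eq0 (negbTE D2) andbF.
  by rewrite hq tofrac_eq0.
(* The exponent [size q] exceeds the degree of [q], so this power of X cannot divide it. *)
have [u hu E] := hm (size q).
have [o ho] := hB _ hu t0.
have : q = 'X^(size q) * o.
  apply/eqP; rewrite -tofrac_eq -hq tofracM -ho tofracXn.
  have := congr1 (fun f => D ^+ B * f t0) E; rewrite /v0 eqxx mulr1 => {1}->.
  by rewrite mulrCA.
move=> Eq; have o0 : o != 0 by apply: contraNneq q0 => o0; rewrite Eq o0 mulr0.
have := congr1 (size \o (@polyseq kk)) Eq => /=.
rewrite size_monicM ?monicXn // size_polyXn => h.
have : (0 < size o)%N by rewrite lt0n size_poly_eq0.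
by move: h; lia.
Qed.

End DeformedLattice.

(** * Lattice paths and their residues *)

Lemma Zp_intr_eq0 p (z : int) : (1 < p)%N ->
  (z%:~R == 0 :> 'Z_p) = (p %| `|z|)%N.
Proof.
move=> p1; have N (m : nat) : (m%:R == 0 :> 'Z_p) = (p %| m)%N.
  by rewrite -(inj_eq val_inj) /= val_Zp_nat // /dvdn.
case: z => m; first by rewrite N.
by rewrite NegzE mulrNz oppr_eq0 N abszN.
Qed.

Lemma Zp_intr_eqP p (z : int) : (1 < p)%N ->
  reflect (exists r : int, z = r * p%:Z) (z%:~R == 0 :> 'Z_p).
Proof.
move=> p1; rewrite Zp_intr_eq0 //; apply: (iffP idP) => [|[r ->]].
  by move=> h; exists (z %/ p)%Z; rewrite divzK // dvdzE.
by rewrite abszM dvdn_mull.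
Qed.

(** * Walls and reflections in integer coordinates *)

Section Paths.
Variables (R : realType) (p n h : nat).
Local Notation path := (lattice_path n h).
Local Notation E := 'rV[R]_h.
Implicit Types (s t : path) (a b c : 'I_h) (r : int).

Definition hgt s (k : nat) c : nat := (\sum_(j < n | (j < k)%N) (s j == c))%N.

Lemma hgtS s (j : 'I_n) c : hgt s j.+1 c = (hgt s j c + (s j == c))%N.
Proof.
rewrite /hgt (bigD1 j) //= addnC; congr addn.
by apply: eq_bigl => i; rewrite ltnS ltn_neqAle andbC.
Qed.

Lemma hgt_eq s t k : (forall j : 'I_n, (j < k)%N -> s j = t j) ->
  forall c, hgt s k c = hgt t k c.
Proof. by move=> st c; apply: eq_bigr => j /st ->. Qed.

Lemma pointE s k c : point R s k 0 c = (hgt s k c)%:R.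
Proof.
rewrite /point summxE /hgt natr_sum; apply: eq_bigr => j _.
by rewrite /eps mxE eqxx /= eq_sym.
Qed.

Lemma point_eqP s t k l : point R s k = point R t l <-> forall c, hgt s k c = hgt t l c.
Proof.
split=> [/rowP e c|e]; last by apply/rowP => c; rewrite !pointE e.
by have := e c; rewrite !pointE => /eqP; rewrite eqr_nat => /eqP.
Qed.

Lemma inner_root (x : E) a b : inner x (root_vec R a b) = x 0 a - x 0 b.
Proof.
rewrite /inner /root_vec /eps.
under eq_bigr => c _ do rewrite !mxE eqxx /= mulrBr.
rewrite sumrB (bigD1 a) //= big1 => [|c]; last by move/negbTE => ca; rewrite eq_sym eq_sym ca mulr0.
rewrite (bigD1 b) //= big1 => [|c]; last by move/negbTE => ca; rewrite ca mulr0.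
by rewrite !eqxx !mulr1 !addr0.
Qed.

(* Up to the shift [p], common to all columns, the [c]-th coordinate of
   [s(k) + rho]. *)
Definition zc s k c : int := (hgt s k c)%:Z - c%:Z.

Lemma wall_formE a b r s k :
  wall_form p (root_vec R a b) r (point R s k) = (zc s k a - zc s k b - r * p%:Z)%:~R.
Proof.
rewrite /wall_form inner_root !mxE !pointE /wall_level /zc !rmorphB /= -!pmulrn.
by move: (_ *~ (r * _)) => w; ring.
Qed.

Lemma wall_form0 a b r : wall_form p (root_vec R a b) r 0 = (b%:Z - a%:Z - r * p%:Z)%:~R.
Proof.
rewrite /wall_form inner_root !mxE /wall_level !rmorphB /= -!pmulrn.
by move: (_ *~ (r * _)) => w; ring.
Qed.

Lemma on_wallE a b r s k :
  on_wall p (root_vec R a b) r (point R s k) <-> zc s k a - zc s k b = r * p%:Z.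
Proof.
rewrite /on_wall wall_formE; split=> [/eqP|->]; last by rewrite subrr.
by rewrite intr_eq0 subr_eq0 => /eqP.
Qed.

Lemma below_wallE a b r s k : below_wall p (root_vec R a b) r (point R s k) <->
  0 < (zc s k a - zc s k b - r * p%:Z) * (b%:Z - a%:Z - r * p%:Z).
Proof. by rewrite /below_wall wall_formE wall_form0 -intrM ltr0z. Qed.

Lemma above_wallE a b r s k : above_wall p (root_vec R a b) r (point R s k) <->
  (zc s k a - zc s k b - r * p%:Z) * (b%:Z - a%:Z - r * p%:Z) < 0.
Proof. by rewrite /above_wall wall_formE wall_form0 -intrM ltrz0. Qed.

Lemma dominantE s k : dominant p (point R s k) <->
  forall a b, (a < b)%N -> zc s k b < zc s k a.
Proof.
split=> [d a b ab|d a b ab].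
  have ab' : a != b by rewrite -(inj_eq val_inj) /= neq_ltn ab.
  have /below_wallE := d a b ab'; rewrite mul0r !subr0 pmulr_lgt0 ?subr_gt0 //.
apply/below_wallE; rewrite mul0r !subr0.
have : (a : nat) != b by rewrite (inj_eq val_inj).
rewrite neq_ltn => /orP[lt|lt]; first by rewrite pmulr_lgt0 ?subr_gt0 ?d.
by rewrite nmulr_lgt0 ?subr_lt0 ?d.
Qed.

Lemma dot_reflE a b r (x : E) c : dot_refl p (root_vec R a b) r x 0 c =
  x 0 c - wall_form p (root_vec R a b) r x * ((c == a)%:R - (c == b)%:R).
Proof.
rewrite /dot_refl /wall_form /root_vec /eps !mxE eqxx /=.
set w := inner _ _ - _; by ring.
Qed.

(** The residue of the box added by step [j]: its column is [s j], and its row is the height of that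
    column before the step. *)
Definition pres s (j : 'I_n) : 'Z_p := (s j)%:R - (hgt s j (s j))%:R.

Lemma presE s j : pres s j = - (zc s j (s j))%:~R.
Proof. by rewrite /pres /zc rmorphB /= opprB !pmulrn. Qed.

Section Reflect.
Variables (s : path) (a b : 'I_h) (k l : nat).
Hypothesis kl : (k <= l)%N.

(** For a path on a wall of the root of [a] and [b] at time [k], the case of [l] equal to [n] is the
    reflection at [k]. If the path is on the same wall again at [l], this is the composite of two
    reflections, and the end point does not move. *)
Definition swap_between : path :=
  [ffun j : 'I_n => if (k <= j < l)%N then tperm a b (s j) else s j].

Lemma swap_between_before i c : (i <= k)%N -> hgt swap_between i c = hgt s i c.
Proof.
move=> ik; apply: hgt_eq => j ji; rewrite ffunE leqNgt (leq_trans ji ik) //.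
Qed.

Lemma swap_between_mid i c : (k <= i <= l)%N -> (i <= n)%N ->
  (hgt swap_between i c + hgt s k (tperm a b c) =
   hgt s k c + hgt s i (tperm a b c))%N.
Proof.
elim: i => [|i ih] /andP[ki il] iN.
  by move: ki; rewrite leqn0 => /eqP E; rewrite swap_between_before ?E // addnC.
move: ki; rewrite leq_eqVlt => /orP[/eqP E|ki].
  by rewrite swap_between_before ?E // addnC.
have := ih _ (ltnW iN); rewrite -ltnS ki (ltnW il) => /(_ isT) {}ih.
rewrite (hgtS swap_between (Ordinal iN)) (hgtS s (Ordinal iN)) /= ffunE /=.
rewrite -ltnS ki il addnAC ih -addnA; congr (_ + (_ + _))%N.
by rewrite -{1}(tpermK a b c) (inj_eq perm_inj).
Qed.

Lemma swap_between_after i c : (l <= i <= n)%N ->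
  (hgt swap_between i c + hgt s l c = hgt swap_between l c + hgt s i c)%N.
Proof.
elim: i => [|i ih] /andP[li iN].
  by move: li; rewrite leqn0 => /eqP ->; rewrite addnC.
move: li; rewrite leq_eqVlt => /orP[/eqP <-|li]; first by rewrite addnC.
have {}ih := ih (introT andP (conj li (ltnW iN))).
rewrite (hgtS swap_between (Ordinal iN)) (hgtS s (Ordinal iN)) /= ffunE /=.
have -> : (i < l)%N = false by rewrite ltnNge; apply/negbF.
by rewrite andbF addnAC ih addnA.
Qed.

End Reflect.

Lemma swap_between_zc s a b k l i r : (k <= i <= l)%N -> (i <= n)%N ->
  zc s k a - zc s k b = r * p%:Z ->
  let f := zc s i a - zc s i b - r * p%:Z in
  forall c, zc (swap_between s a b k l) i c = zc s i c - f * ((c == a)%:Z - (c == b)%:Z).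
Proof.
move=> kil iN w f c.
have := swap_between_mid s a b c kil iN; rewrite /zc /f /zc in w *.
have [->|ca] := eqVneq c a.
  rewrite tpermL; have [E|ab] := eqVneq a b; first by rewrite E; lia.
  by lia.
have [->|cb] := eqVneq c b; first by rewrite tpermR; lia.
by rewrite tpermD 1?eq_sym //; lia.
Qed.

Lemma swap_between_return s a b k l r : (k <= l <= n)%N ->
  zc s k a - zc s k b = r * p%:Z -> zc s l a - zc s l b = r * p%:Z ->
  forall i, (l <= i <= n)%N -> forall c, hgt (swap_between s a b k l) i c = hgt s i c.
Proof.
move=> /andP[kl ln] wk wl i li c; apply/eqP.
have := swap_between_after s a b k c li.
have := @swap_between_zc s a b k l l r; rewrite kl leqnn => /(_ isT ln wk c) /=.
rewrite wl subrr mul0r subr0 /zc => /(addIr _) [->].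
by rewrite [RHS]addnC => /addIn ->.
Qed.

Hypothesis p1 : (1 < p)%N.

Lemma same_class s k a b :
  reflect (exists r, zc s k a - zc s k b = r * p%:Z)
    ((zc s k a)%:~R == (zc s k b)%:~R :> 'Z_p).
Proof. by rewrite -subr_eq0 -rmorphB; apply: Zp_intr_eqP. Qed.

(** Reflection exchanges the coordinates [a] and [b] up to a multiple of p, and a swapped step adds
    to the exchanged coordinate, so its residue is unchanged. *)
Lemma swap_between_pres s a b k l r :
  (k <= l <= n)%N -> zc s k a - zc s k b = r * p%:Z ->
  l = n \/ zc s l a - zc s l b = r * p%:Z ->
  forall j, pres (swap_between s a b k l) j = pres s j.
Proof.
move=> kln wk wl j; rewrite !presE; congr (- _).
have [kl ln] := andP kln.
have [jk|kj] := ltnP j k.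
  by rewrite ffunE leqNgt jk /= /zc swap_between_before // ltnW.
have [jl|lj] := ltnP j l.
  have jj : (k <= j <= l)%N by rewrite kj ltnW.
  rewrite (swap_between_zc jj (ltnW (ltn_ord j)) wk) ffunE kj jl /=.
  apply/eqP; rewrite -subr_eq0 -rmorphB; apply/Zp_intr_eqP => //.
  case: tpermP => [->|->|/eqP ca /eqP cb].
  - rewrite eqxx; have [->|ab] := eqVneq b a; first by exists 0; lia.
    by exists (- r); lia.
  - rewrite eqxx; have [->|ab] := eqVneq a b; first by exists 0; lia.
    by exists r; lia.
  - by exists 0; rewrite (negbTE ca) (negbTE cb); lia.
case: wl => [E|wl]; first by move: lj; rewrite E leqNgt ltn_ord.
rewrite ffunE [(j < l)%N]ltnNge lj andbF /zc.
by rewrite (swap_between_return kln wk wl) // lj ltnW.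
Qed.

End Paths.

Section Linkage.
Variables (R : realType) (p n h : nat).
Hypotheses (p3 : (2 < p)%N) (hp : (h < p)%N).
Local Notation path := (lattice_path n h).
Local Notation E := 'rV[R]_h.
Implicit Types (s t : path) (a b c : 'I_h) (r : int).

Let p1 : (1 < p)%N. Proof. exact: ltnW. Qed.

(** Two steps of equal residue from a common point add to coordinates that are congruent modulo p,
    which is to say that the point lies on a wall of the corresponding root. *)
Lemma same_pres_wall s t (j : 'I_n) : (forall i : 'I_n, (i < j)%N -> s i = t i) ->
  pres p s j = pres p t j ->
  exists r, zc s j (s j) - zc s j (t j) = r * p%:Z.
Proof.
move=> st; rewrite !presE => /oppr_inj.
have -> : zc t j (t j) = zc s j (t j) by rewrite /zc (hgt_eq st).
by move/eqP/(same_class p1).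
Qed.

Lemma pres_path_reflection s t : path_reflection R p s t ->
  forall j, pres p s j = pres p t j.
Proof.
case=> k [a [b [r [kn ab w t1 t2]]]] j.
have wk : zc s k a - zc s k b = r * p%:Z by apply/(on_wallE R).
have kln : (k <= n <= n)%N by rewrite kn leqnn.
suff -> : t = swap_between s a b k n.
  by rewrite (swap_between_pres p1 kln wk) //; left.
have ht i : (i <= n)%N -> forall c, hgt t i c = hgt (swap_between s a b k n) i c.
  move=> iN c; have [ik|ki] := leqP i k.
    have /(point_eqP R) -> := t1 i ik.
    by rewrite swap_between_before.
  have ki' : (k <= i <= n)%N by rewrite ltnW.
  have := @swap_between_zc p n h s a b k n i r ki' iN wk c.
  have /rowP /(_ c) := t2 i ki'.
  rewrite dot_reflE (wall_formE R p) !pointE => E1.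
  rewrite /= => E2; apply/eqP; rewrite -(eqr_nat R) E1.
  move/(congr1 (fun z : int => z%:~R : R)): E2.
  rewrite /zc !rmorphB /= rmorphM /= !rmorphB /= -!pmulrn => E2.
  apply/eqP; apply: (addIr (- (c : nat)%:R)); rewrite E2.
  by rewrite addrAC.
apply/ffunP => i; have /= := fun c => esym (hgtS t i c).
move=> h1; have h2 := h1 (t i); rewrite eqxx addn1 in h2.
have := hgtS (swap_between s a b k n) i (t i).
rewrite -!ht ?ltn_ord // ?(ltnW (ltn_ord i)) // -h2.
by rewrite -addn1 => /addnI; case: eqP.
Qed.

Lemma pres_path_equiv s t : path_equiv R p s t -> forall j, pres p s j = pres p t j.
Proof.
case/connectP => q; elim: q s => [s _ -> //|u q ih s /= /andP[/asboolP su qt] lt] j.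
by rewrite (pres_path_reflection su) (ih _ qt lt).
Qed.

Lemma point_swap_between s a b k r i : (k <= i <= n)%N ->
  zc s k a - zc s k b = r * p%:Z ->
  point R (swap_between s a b k n) i = dot_refl p (root_vec R a b) r (point R s i).
Proof.
move=> ki wk; have iN : (i <= n)%N by case/andP: ki.
apply/rowP => c; rewrite dot_reflE wall_formE !pointE.
have := @swap_between_zc p n h s a b k n i r ki iN wk c.
move/(congr1 (fun z : int => z%:~R : R)).
rewrite /zc !rmorphB /= rmorphM /= !rmorphB /= -!pmulrn => E2.
by apply: (addIr (- (c : nat)%:R)); rewrite E2 addrAC.
Qed.

Lemma path_reflectionP s a b k r : (k <= n)%N -> a != b ->
  zc s k a - zc s k b = r * p%:Z -> path_reflection R p s (swap_between s a b k n).
Proof.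
move=> kn ab wk; exists k, a, b, r; split=> //.
- exact/on_wallE.
- by move=> i ik; apply/point_eqP => c; rewrite swap_between_before.
- by move=> i ki; apply: point_swap_between.
Qed.

Lemma wall_form_root a b r (x : E) : wall_form p (root_vec R a b) r x =
  x 0 a + rho R p h 0 a - (x 0 b + rho R p h 0 b) - wall_level R p r.
Proof. by rewrite /wall_form inner_root !mxE. Qed.

Lemma dot_reflK a b r (x : E) : a != b ->
  dot_refl p (root_vec R a b) r (dot_refl p (root_vec R a b) r x) = x.
Proof.
move=> ab; apply/rowP => c; rewrite !dot_reflE.
have -> : wall_form p (root_vec R a b) r (dot_refl p (root_vec R a b) r x) =
   - wall_form p (root_vec R a b) r x.
  have ba : b == a = false by rewrite eq_sym (negbTE ab).
  rewrite wall_form_root !dot_reflE !eqxx (negbTE ab) ba !wall_form_root.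
  move: (x 0 a) (x 0 b) (rho _ _ _ _ _) (rho _ _ _ _ _) (wall_level _ _ _).
  by move=> xa xb ra rb w /=; ring.
by rewrite mulNr opprK subrK.
Qed.

Lemma first_disagreement s t m : (forall j : 'I_n, (j < n - m.+1)%N -> s j = t j) ->
  (m < n)%N -> {j : 'I_n | [/\ (j + m.+1 = n)%N, forall i : 'I_n, (i < j)%N -> s i = t i &
     s j = t j -> forall i : 'I_n, (i < n - m)%N -> s i = t i]}.
Proof.
move=> st mn; have jn : (n - m.+1 < n)%N by lia.
exists (Ordinal jn); split=> /=; [lia|by []|].
move=> e i; rewrite (_ : (n - m = (n - m.+1).+1)%N); last lia.
rewrite ltnS leq_eqVlt => /orP[/eqP E|/st //].
by have -> : i = Ordinal jn by apply: val_inj.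
Qed.

Lemma same_pres_equiv s t : (forall j, pres p s j = pres p t j) -> path_equiv R p s t.
Proof.
(* The number [m] bounds how many of the last steps may still differ. *)
suff H m : forall s, (forall j : 'I_n, (j < n - m)%N -> s j = t j) ->
    (forall j, pres p s j = pres p t j) -> path_equiv R p s t.
  by move=> e; apply: (H n) => // j; rewrite subnn.
elim: m => [|m ih] {}s st e.
  have -> : s = t by apply/ffunP => j; apply: st; rewrite subn0.
  exact: connect0.
have [nm|mn] := leqP n m; first by apply: ih => // j; rewrite (eqP (_ : n - m == 0)%N) // subn_eq0.
have [j [jm sj stj]] := first_disagreement st mn.
have [/eqP E|ne] := boolP (s j == t j); first exact: ih (stj E) e.
have [r w] := same_pres_wall sj (e j).
have jn : (j <= n <= n)%N by rewrite leqnn andbT ltnW.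
apply: (connect_trans (y := swap_between s (s j) (t j) j n)).
  by apply: connect1; apply/asboolP; apply: path_reflectionP w => //; case/andP: jn.
apply: ih => [i im|i].
  rewrite ffunE; have [ji|ij] := leqP j i.
    have -> : i = j by apply: val_inj => /=; lia.
    by rewrite ltn_ord tpermL.
  exact: sj.
by rewrite (swap_between_pres p1 jn w) //; left.
Qed.

(* Every step of the path moves the topmost bead of its residue class. *)
Definition topmost t := forall (j : 'I_n) a, a != t j ->
  (zc t j a)%:~R = (zc t j (t j))%:~R :> 'Z_p ->
  (t j < a)%N /\ zc t j a < zc t j (t j).

(** Since [r] is positive and h < p, the origin is on the negative side of this wall. The end point
    of [s] is there too, so its reflection is above the wall. *)
Lemma linked_reflect s a b k r : (k <= n)%N -> 0 < r -> a != b ->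
  zc s n b - zc s n a < r * p%:Z -> zc s k b - zc s k a = r * p%:Z ->
  linked_step p (point R s n) (point R (swap_between s b a k n) n).
Proof.
move=> kn r0 ab below w; have ba : b != a by rewrite eq_sym.
have kn' : (k <= n <= n)%N by rewrite kn leqnn.
have Z c := @swap_between_zc p n h s b a k n n r kn' (leqnn _) w c.
have pr : p%:Z <= r * p%:Z by rewrite ler_peMl // -gtz0_ge1.
have ha := ltn_ord a; have hb := ltn_ord b.
exists b, a, r; split=> //.
- have knn : (k <= n <= n)%N by rewrite kn leqnn.
  by rewrite (point_swap_between knn w) dot_reflK.
- by apply/below_wallE; rewrite nmulr_lgt0; lia.
- apply/above_wallE; rewrite !Z !eqxx (negbTE ab) (negbTE ba).
  by rewrite pmulr_rlt0; lia.
Qed.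

Lemma zc_step s (j : 'I_n) c : zc s j.+1 c = zc s j c + (s j == c)%:Z.
Proof. by rewrite /zc hgtS PoszD addrAC. Qed.

(** At the first disagreement [t] raises the higher of two congruent coordinates and [s] the lower,
    so [s] drops below a wall with positive [r]. If [s] meets that wall again, swapping between the
    two meetings keeps its end point; if not, it ends below the wall, and reflecting the tail makes
    one linkage step upwards. Either way the agreement with [t] grows. *)
Lemma same_pres_linked s t : topmost t -> (forall j, pres p s j = pres p t j) ->
  strongly_linked p (point R s n) (point R t n).
Proof.
move=> top.
suff H m : forall s, (forall j : 'I_n, (j < n - m)%N -> s j = t j) ->
    (forall j, pres p s j = pres p t j) ->
    strongly_linked p (point R s n) (point R t n).
  by move=> e; apply: (H n) => // j; rewrite subnn.
elim: m => [|m ih] {}s st e.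
  have -> : s = t by apply/ffunP => j; apply: st; rewrite subn0.
  exact: rt_refl.
have [nm|mn] := leqP n m; first by apply: ih => // j; rewrite (eqP (_ : n - m == 0)%N) // subn_eq0.
have [j [jm sj stj]] := first_disagreement st mn.
have [/eqP E|ne] := boolP (s j == t j); first exact: ih (stj E) e.
set a := s j in ne; set b := t j in ne.
have zst c : zc s j c = zc t j c by rewrite /zc (hgt_eq sj).
have [r' w'] := same_pres_wall sj (e j).
have [ba zab] : (b < a)%N /\ zc s j a < zc s j b.
  rewrite !zst; apply: top => //; apply/eqP/(same_class p1).
  by exists r'; rewrite -!zst.
pose r := - r'; have w : zc s j b - zc s j a = r * p%:Z by rewrite /r mulNr -[LHS]opprB; congr (- _).
have p0 : 0 < p%:Z by rewrite ltz_nat ltnW.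
have r0 : 0 < r by rewrite -(pmulr_lgt0 _ p0) -w subr_gt0.
have agree l : forall i : 'I_n, (j < l)%N -> (i < n - m)%N -> swap_between s b a j l i = t i.
  move=> i jl im; rewrite ffunE; have [ji|ij] := leqP j i; last by rewrite sj.
  have -> : i = j by apply: val_inj => /=; lia.
  by rewrite jl tpermR.
have jn : (j <= n)%N by rewrite ltnW.
have [|nret] := pselect (exists l, (j < l <= n)%N /\ zc s l b - zc s l a = r * p%:Z).
  case=> l [/andP[jl ln] wl].
  have jln : (j <= l <= n)%N by rewrite ltnW.
  have <- : point R (swap_between s b a j l) n = point R s n.
    by apply/point_eqP => c; apply: (swap_between_return jln w wl); rewrite ln leqnn.
  apply: ih => [i|i]; first exact: agree.
  by rewrite (swap_between_pres p1 jln w) //; right.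
apply: (rt_trans _ _ _ (point R (swap_between s b a j n) n)).
  apply: rt_step; apply: (linked_reflect jn r0 ne _ w).
  (* The difference of the two coordinates changes by at most one in a step, so without meeting the
     wall again the path stays on its lower side. *)
  have below i : (j < i <= n)%N -> zc s i b - zc s i a < r * p%:Z.
    elim: i => // i ihi /andP[]; rewrite ltnS leq_eqVlt => /orP[/eqP <-|ji] iN.
      by rewrite !zc_step eqxx [s j == b](negbTE ne); lia.
    have := ihi (introT andP (conj ji (ltnW iN))).
    have ne' : zc s i.+1 b - zc s i.+1 a <> r * p%:Z.
      by move=> E; apply: nret; exists i.+1; rewrite E iN ltnS ltnW.
    move: ne'; rewrite !(zc_step s (Ordinal iN)) /=.
    by case: (_ == b); case: (_ == a) => /=; lia.
  by apply: below; rewrite ltn_ord leqnn.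
have jnn : (j <= n <= n)%N by rewrite jn leqnn.
apply: ih => [i|i]; first by apply: agree.
by rewrite (swap_between_pres p1 jnn w) //; left.
Qed.

Definition energy (x : E) : R := \sum_c (x 0 c + rho R p h 0 c) ^+ 2.

(** Reflecting lowers the squared length by twice the wall form times the wall level. As h < p, the
    sign of a nonzero [r] decides the side of the origin, and since [y] is on the other side, the
    form and the level have the same sign. *)
Lemma linked_step_energy (x y : E) : linked_step p x y -> energy x <= energy y.
Proof.
case=> a [b [r [ab -> below above]]].
set f := wall_form p (root_vec R a b) r y.
have E2 : energy (dot_refl p (root_vec R a b) r y) = energy y - 2 * f * wall_level R p r.
  rewrite /energy (bigD1 a) //= (bigD1 b) 1?eq_sym //= [in RHS](bigD1 a) //= [in RHS](bigD1 b) 1?eq_sym //=.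
  have -> : \sum_(i < h | (i != a) && (i != b)) (dot_refl p (root_vec R a b) r y 0 i + rho R p h 0 i) ^+ 2
    = \sum_(i < h | (i != a) && (i != b)) (y 0 i + rho R p h 0 i) ^+ 2.
    by apply: eq_bigr => i /andP[/negbTE ia /negbTE ib]; rewrite dot_reflE ia ib subrr mulr0 subr0.
  rewrite !dot_reflE !eqxx (negbTE ab) [b == a]eq_sym (negbTE ab) -/f.
  have : f = _ := wall_form_root a b r y.
  move: (f) (y 0 a) (y 0 b) (rho _ _ _ _ a) (rho _ _ _ _ b) (wall_level _ _ _) (\sum_(i < h | _) _).
  by move=> g ya yb ra rb w S -> /=; ring.
rewrite E2 gerBl -mulrA mulr_ge0 //.
move: above; rewrite /above_wall -/f wall_form0 /wall_level.
have := ltn_ord a; have := ltn_ord b => hb ha.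
have [r0|r0|->] := ltrgt0P r.
- have pr : p%:Z <= r * p%:Z by rewrite ler_peMl // -gtz0_ge1.
  rewrite nmulr_llt0 => [f0|]; last by rewrite ltrz0; lia.
  by apply: mulr_ge0; [exact: ltW | rewrite ler0z; lia].
- have pr : r * p%:Z <= - p%:Z by rewrite -mulN1r ler_pM2r; lia.
  rewrite pmulr_llt0 => [f0|]; last by rewrite ltr0z; lia.
  by apply: mulr_le0; [exact: ltW | rewrite lerz0; lia].
- by rewrite mul0r mulr0.
Qed.

Lemma strongly_linked_energy (x y : E) : strongly_linked p x y -> energy x <= energy y.
Proof.
elim=> {x y} [x y|x|x y z _ xy _ yz]; [exact: linked_step_energy | by [] |].
exact: le_trans yz.
Qed.

End Linkage.

(** * Degrees of dominant paths *)

Section PathDegree.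
Variables (R : realType) (p n h : nat).
Hypotheses (p3 : (2 < p)%N) (hp : (h < p)%N).
Local Notation path := (lattice_path n h).
Implicit Types (s t : path) (a b c : 'I_h).

Let p1 : (1 < p)%N. Proof. exact: ltnW. Qed.

Definition hop_deg (d : int) : int :=
  if d%:~R == 0 :> 'Z_p then 1 else if d%:~R == 1 :> 'Z_p then -1 else 0.

Definition hop s (j : 'I_n) : int :=
  \sum_(a < h | (a < s j)%N) hop_deg (zc s j a - zc s j (s j)).

(** The difference of the coordinates [a] and [b] stays positive, so only walls with [r > 0] are
    met, with the origin on the lower side. Only a step in direction [b] lowers the difference: it
    leaves a wall downwards if the difference is 0 modulo p, and reaches one from above if it is
    1. *)
Lemma step_degreeE s (j : 'I_n) a b : (a < b)%N -> zc s j b < zc s j a ->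
  zc s j.+1 b < zc s j.+1 a ->
  step_degree p (root_vec R a b) (point R s j) (point R s j.+1) =
  if s j == b then hop_deg (zc s j a - zc s j b) else 0.
Proof.
move=> ab d0 d1; rewrite /step_degree.
have hb := ltn_ord b.
have rpos (r x : int) : 0 < x -> x = r * p%:Z -> p%:Z <= r * p%:Z.
  move=> x0 xr; have p0 : 0 < p%:Z by rewrite ltz_nat ltnW.
  have r0 : 0 < r by rewrite -(pmulr_lgt0 _ p0) -xr.
  by rewrite ler_peMl // -gtz0_ge1.
have x0 : 0 < zc s j a - zc s j b by rewrite subr_gt0.
have x1 : 0 < zc s j.+1 a - zc s j.+1 b by rewrite subr_gt0.
have Z c : zc s j.+1 c = zc s j c + (s j == c)%:Z by apply: zc_step.
have nab : (a == b) = false by apply/negbTE; rewrite -(inj_eq val_inj) /= neq_ltn ab.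
have A : `[< exists r : int, on_wall p (root_vec R a b) r (point R s j) /\
      below_wall p (root_vec R a b) r (point R s j.+1) >] =
    (s j == b) && ((zc s j a - zc s j b)%:~R == 0 :> 'Z_p).
  apply/asboolP/andP => [[r [/on_wallE w /below_wallE]]|[sb /(Zp_intr_eqP _ p1) [r w]]].
    have hr := rpos _ _ x0 w; rewrite nmulr_lgt0; last by lia.
    rewrite !Z => h1; split; last by apply/Zp_intr_eqP => //; exists r.
    by move: h1; case: (s j == b) => //=; case: (s j == a) => /=; lia.
  have hr := rpos _ _ x0 w; exists r; split; first exact/on_wallE.
  apply/below_wallE; rewrite nmulr_lgt0; last by lia.
  by rewrite !Z (eqP sb) eqxx eq_sym nab; lia.
have B : `[< exists r : int, above_wall p (root_vec R a b) r (point R s j) /\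
      on_wall p (root_vec R a b) r (point R s j.+1) >] =
    (s j == b) && ((zc s j a - zc s j b)%:~R == 1 :> 'Z_p).
  have E1 : ((zc s j a - zc s j b)%:~R == 1 :> 'Z_p) =
      ((zc s j a - zc s j b - 1)%:~R == 0 :> 'Z_p) by rewrite [in RHS]rmorphB subr_eq0.
  rewrite E1.
  apply/asboolP/andP => [[r [/above_wallE ha /on_wallE w]]|[sb /(Zp_intr_eqP _ p1) [r w]]].
    have hr := rpos _ _ x1 w; rewrite nmulr_llt0 in ha; last by lia.
    have sb : s j == b.
      by move: ha w; rewrite !Z; case: (s j == b) => //=; case: (s j == a) => /=; lia.
    split=> //; apply/Zp_intr_eqP => //; exists r.
    by rewrite -w !Z (eqP sb) eqxx eq_sym nab; lia.
  have w' : zc s j.+1 a - zc s j.+1 b = r * p%:Z.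
    by rewrite !Z (eqP sb) eqxx eq_sym nab; lia.
  have hr := rpos _ _ x1 w'; exists r; split; last exact/on_wallE.
  apply/above_wallE; rewrite nmulr_llt0; last by lia.
  by lia.
by rewrite A B /hop_deg; case: (s j == b).
Qed.

Lemma path_degreeE s : (forall k, (k <= n)%N -> dominant p (point R s k)) ->
  path_degree R p s = \sum_j hop s j.
Proof.
move=> dom; rewrite /path_degree; apply: eq_bigr => j _; rewrite /hop.
have D k : (k <= n)%N -> forall a b, (a < b)%N -> zc s k b < zc s k a.
  by move=> kn; apply/dominantE/dom.
transitivity (\sum_(a < h) \sum_(b < h | (a < b)%N)
    (if s j == b then hop_deg (zc s j a - zc s j b) else 0)).
  apply: eq_bigr => a _; apply: eq_bigr => b ab; apply: step_degreeE => //.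
    by apply: D => //; apply: ltnW.
  exact: D.
rewrite [RHS]big_mkcond; apply: eq_bigr => a _; rewrite -big_mkcondr /=.
case: ifP => asj; last first.
  by rewrite big_pred0 // => b; case: eqP => [<-|]; rewrite ?asj ?andbF.
rewrite (big_pred1 (s j)) // => b /=; rewrite eq_sym.
by case: eqP => [->|]; rewrite ?andbF ?asj.
Qed.

Lemma hgt_fswap (r : 'I_n.-1) s k c : k != r.+1 ->
  hgt (fswap r s) k c = hgt s k c.
Proof.
move=> kr; rewrite /hgt [RHS](reindex_inj (@perm_inj _ (tperm (pos r) (pos_succ r)))) /=.
apply: eq_big => [j|j _]; last by rewrite ffunE.
case: tpermP => [->|->|//] /=; apply/idP/idP; move/eqP: kr; lia.
Qed.

Lemma hop_degS d : hop_deg (d + 1) - hop_deg d =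
  if d%:~R == 0 :> 'Z_p then - 2
  else if (d%:~R == 1 :> 'Z_p) || (d%:~R == -1 :> 'Z_p) then 1 else 0.
Proof.
rewrite /hop_deg rmorphD /=; set x : 'Z_p := d%:~R.
have o : (1 : 'Z_p) == 0 = false by rewrite oner_eq0.
have tw : (1 + 1 : 'Z_p) == 0 = false.
  apply/eqP => /(congr1 (@nat_of_ord _)); rewrite -[1 + 1]/(2%:R : 'Z_p).
  by rewrite val_Zp_nat // modn_small.
have e1 : (x + 1 == 1) = (x == 0) by rewrite -{2}[1 in LHS]add0r (inj_eq (addIr _)).
have e2 : (x + 1 == 0) = (x == -1) by rewrite addr_eq0.
rewrite e1 e2.
have [->|x0] := eqVneq x 0; first by rewrite eq_sym oppr_eq0 o.
have [->|x1] := eqVneq x 1; last by case: eqP.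
by rewrite -addr_eq0 tw.
Qed.

Definition path_res s : res_seq p n := [ffun j => pres p s j].

(** Exchanging two consecutive steps exchanges their hops, except for the term that compares the two
    columns with each other, where the difference has grown by one. By [hop_degS] the increment is
    the degree of [psi_r], so path degrees can be followed along reduced words. *)
Lemma hop_fswap (r : 'I_n.-1) s : (s (pos_succ r) < s (pos r))%N ->
  \sum_j hop (fswap r s) j = psi_deg r (path_res s) + \sum_j hop s j.
Proof.
move=> lt; set s' := fswap r s.
have npr : pos_succ r != pos r by rewrite -(inj_eq val_inj) /= neq_ltn ltnSn orbT.
rewrite (bigD1 (pos r)) //= (bigD1 (pos_succ r)) //=.
rewrite [in RHS](bigD1 (pos r)) //= [in RHS](bigD1 (pos_succ r)) //=.
have -> : \sum_(j < n | (j != pos r) && (j != pos_succ r)) hop s' j =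
          \sum_(j < n | (j != pos r) && (j != pos_succ r)) hop s j.
  apply: eq_bigr => j /andP[j1 j2]; rewrite /hop /s' fswap_other //.
  by apply: eq_bigr => a _; rewrite /zc !hgt_fswap.
set b0 := s (pos r) in lt *; set a0 := s (pos_succ r) in lt *.
set S := \sum_(_ | _) _.
have zp c : zc s' (pos r) c = zc s (pos r) c.
  by rewrite /zc hgt_fswap //= neq_ltn ltnSn.
have zs c : zc s (pos_succ r) c = zc s (pos r) c + (b0 == c)%:Z by apply: (zc_step s (pos r)).
have zs' c : zc s' (pos_succ r) c = zc s (pos r) c + (a0 == c)%:Z.
  by rewrite -zp /a0 -(fswap_pos r s); apply: (zc_step s' (pos r)).
have ab : (b0 == a0) = false by apply/negbTE; rewrite -(inj_eq val_inj) /= neq_ltn lt orbT.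
have E1 : hop s' (pos r) = hop s (pos_succ r).
  rewrite /hop /s' fswap_pos -/s' -/a0; apply: eq_bigr => a aa.
  by rewrite !zp !zs ab addr0 (_ : (b0 == a) = false) ?addr0 //; apply/negbTE; rewrite -(inj_eq val_inj) /= neq_ltn (ltn_trans aa lt) orbT.
have E2 : hop s' (pos_succ r) = hop s (pos r) +
    (hop_deg (zc s (pos r) a0 - zc s (pos r) b0 + 1) - hop_deg (zc s (pos r) a0 - zc s (pos r) b0)).
  rewrite /hop /s' fswap_pos_succ -/s' -/b0 (bigD1 a0) //= [in RHS](bigD1 a0) //=.
  have -> : \sum_(a < h | (a < b0)%N && (a != a0)) hop_deg (zc s' (pos_succ r) a - zc s' (pos_succ r) b0) =
      \sum_(a < h | (a < b0)%N && (a != a0)) hop_deg (zc s (pos r) a - zc s (pos r) b0).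
    apply: eq_bigr => a /andP[_ aa]; rewrite !zs' eq_sym (negbTE aa) addr0 [a0 == b0]eq_sym ab addr0 //.
  rewrite !zs' eqxx [a0 == b0]eq_sym ab addr0 [zc _ _ a0 + _ - _]addrAC.
  have AB (x y z : int) : x + z = y + z + (x - y) by lia.
  exact: AB.
rewrite E1 E2 hop_degS /psi_deg !ffunE !presE -/a0 -/b0 zs ab addr0.
rewrite rmorphB /=; set x : 'Z_p := (zc s (pos r) a0)%:~R; set y : 'Z_p := (zc s (pos r) b0)%:~R.
have -> : (- y == - x) = (x - y == 0) by rewrite subr_eq0 eqr_opp eq_sym.
have -> : (- y == - x + 1) = (x - y == 1).
  by rewrite -[LHS]subr_eq0 -[RHS]subr_eq0; congr (_ == _); ring.
have -> : (- y == - x - 1) = (x - y == -1).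
  by rewrite -[LHS]subr_eq0 -[RHS]subr_eq0; congr (_ == _); ring.
have AB (u v w z : int) : u + (v + z + w) = z + (v + (u + w)) by lia.
set Z := if _ then _ else _; exact: AB.
Qed.

End PathDegree.

Local Open Scope nat_scope.

(** * Standard tableaux *)

Lemma down_closed_mem (rs : seq nat) : uniq rs ->
  (forall r r', r \in rs -> r' <= r -> r' \in rs) ->
  forall r, (r \in rs) = (r < size rs).
Proof.
move=> u down r; apply/idP/idP => [hr|lt].
  rewrite -[r.+1](size_iota 0); apply: uniq_leq_size; first exact: iota_uniq.
  by move=> x; rewrite mem_iota add0n /= ltnS; apply: down.
apply/negPn/negP => nr; move: lt; rewrite ltnNge -{1}[r](size_iota 0) uniq_leq_size //.
move=> x hx; rewrite mem_iota add0n /=; rewrite ltnNge; apply/negP => rx.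
by case/negP: nr; apply: down hx rx.
Qed.

Lemma more_dominant_north_east (b b' : box) :
  b.1 < b'.1 -> b'.2 < b.2 -> more_dominant b b'.
Proof. by case: b b' => r c [r' c']; rewrite /more_dominant /= => h1 h2; apply/orP; left; lia. Qed.

Lemma more_dominant_asym (b b' : box) : more_dominant b b' -> more_dominant b' b -> False.
Proof. by rewrite /more_dominant; case: ltgtP => //= _; case: ltngtP. Qed.

(** * Boxes in reading order and the tableau [t^la] *)

Section PartitionBoxes.
Variables (n h : nat) (la : seq nat).
Hypothesis hla : is_partition n h la.

Lemma partition_nth_leq i j : i <= j -> nth 0 la j <= nth 0 la i.
Proof.
move=> ij; case/and4P: hla => so _ _ _.
have [jl|lj] := ltnP j (size la); last by rewrite nth_default.
have tr : transitive geq by move=> y x z /= xy yz; apply: leq_trans yz xy.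
apply: (sorted_leq_nth tr (fun x => leqnn x) 0 so) => //.
by rewrite inE; apply: leq_ltn_trans jl.
Qed.

Lemma partition_nth_h i : nth 0 la i <= h.
Proof.
case/and4P: hla => _ _ _ /allP ah.
have [il|li] := ltnP i (size la); last by rewrite nth_default.
by apply: ah; apply: mem_nth.
Qed.

Lemma boxesP (b : box) : (b \in boxes la) = (b.2 < nth 0 la b.1).
Proof.
case: b => r c /=; apply/allpairsPdep/idP => [[r' [c' [h1 h2 [-> ->]]]]|lt].
  by move: h2; rewrite mem_iota.
exists r, c; split=> //; rewrite mem_iota //= add0n.
by have [//|le] := ltnP r (size la); rewrite nth_default in lt.
Qed.

Lemma boxes_uniq : uniq (boxes la).
Proof.
apply: allpairs_uniq_dep; first exact: iota_uniq.
- by move=> r _; apply: iota_uniq.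
by move=> [r c] [r' c'] _ _ /= [-> ->].
Qed.

Lemma size_boxes : size (boxes la) = n.
Proof.
case/and4P: hla => _ _ /eqP <- _; rewrite size_allpairs_dep.
congr sumn; apply: (@eq_from_nth _ 0); first by rewrite size_map size_iota.
move=> i; rewrite size_map size_iota => il.
by rewrite (nth_map 0) ?size_iota // nth_iota // size_iota.
Qed.

Lemma column_lengthP r c : (r < column_length la c) = (c < nth 0 la r).
Proof.
have E : column_length la c = size [seq r <- iota 0 (size la) | c < nth 0 la r].
  rewrite size_filter -(count_map (nth 0 la) (fun x => c < x)).
  by rewrite map_nth_iota0 // take_size.
rewrite E -down_closed_mem; first last.
- move=> x y; rewrite !mem_filter => /andP[h1 h2] yx.
  have h3 := leq_trans h1 (partition_nth_leq yx); rewrite h3 /=.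
  by move: h2; rewrite !mem_iota add0n /= => h2; apply: leq_ltn_trans h2.
- by apply: filter_uniq; apply: iota_uniq.
rewrite mem_filter mem_iota add0n /=.
by have [//|le] := ltnP r (size la); rewrite ?andbT // nth_default.
Qed.

Definition lex_lt (b b' : box) := (b.1 < b'.1) || (b.1 == b'.1) && (b.2 < b'.2).

Lemma lex_lt_irr b : lex_lt b b = false.
Proof. by rewrite /lex_lt !ltnn andbF. Qed.

Lemma lex_lt_total b b' : b != b' -> lex_lt b b' || lex_lt b' b.
Proof.
case: b b' => r c [r' c']; rewrite /lex_lt /= xpair_eqE [r' == r]eq_sym.
by case: (ltngtP r r') => //= _; case: (ltngtP c c').
Qed.

Lemma lex_lt_asym b b' : lex_lt b b' -> lex_lt b' b = false.
Proof. by rewrite /lex_lt; case: (ltngtP b.1 b'.1) => //= _; case: ltngtP. Qed.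

Lemma boxes_pairwise : pairwise lex_lt (boxes la).
Proof.
have row r k c : pairwise lex_lt [seq (r, x) | x <- iota c k].
  elim: k c => //= k ih c; rewrite ih andbT; apply/allP => b /mapP [x].
  by rewrite mem_iota => /andP[h1 _] ->; rewrite /lex_lt /= eqxx h1 orbT.
suff G m i : pairwise lex_lt [seq (r, c) | r <- iota i m, c <- iota 0 (nth 0 la r)].
  exact: G.
elim: m i => //= m ih i; rewrite pairwise_cat ih row !andbT.
apply/allrelP => x y /mapP [c _ ->] /allpairsPdep [r [c' [h1 _ ->]]].
by rewrite /lex_lt /=; move: h1; rewrite mem_iota => /andP[->].
Qed.

Lemma index_lex_lt b b' : b \in boxes la -> b' \in boxes la ->
  lex_lt b b' -> index b (boxes la) < index b' (boxes la).
Proof.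
move=> hb hb' lt; rewrite ltnNge leq_eqVlt; apply/negP => /orP[/eqP E|lt'].
  by have := congr1 (nth b (boxes la)) E; rewrite !nth_index // => E'; rewrite E' lex_lt_irr in lt.
have /(pairwiseP (0, 0)) P := boxes_pairwise.
have := P _ _ _ _ lt'; rewrite !nth_index // lex_lt_asym // => H.
by have := H; rewrite !inE !index_mem hb hb' => /(_ isT isT).
Qed.

(** Among the first boxes in reading order the last one is the least dominant removable box: any
    other removable box lies in an earlier row and further to the right, hence is more dominant. So
    [t^la] is filled row by row. *)
Lemma fill_take m : m <= n -> fill_least_dominant m (take m (boxes la)) = take m (boxes la).
Proof.
elim: m => [|m ih] mn; first by rewrite take0.
have ms : m < size (boxes la) by rewrite size_boxes.
set bs := boxes la in ms ih *; set x := nth (0, 0) bs m.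
have TE : take m.+1 bs = rcons (take m bs) x by rewrite (take_nth (0, 0)).
have ubs := boxes_uniq; have xbs : x \in bs by apply: mem_nth.
have ix : index x bs = m by rewrite index_uniq.
have inD y : y \in bs -> ~~ lex_lt x y -> y \in take m.+1 bs.
  move=> yb xy; rewrite in_take // ltnS -ix leqNgt; apply: contra xy => lt.
  have /(pairwiseP (0, 0)) P := boxes_pairwise.
  by have := P _ _ _ _ lt; rewrite !inE !index_mem xbs yb !nth_index //; apply.
have Dlex y : y \in take m.+1 bs -> y \in bs /\ ~~ lex_lt x y.
  move=> yD; have yb := mem_take yD; split=> //.
  apply/negP => lt; have := index_lex_lt xbs yb lt; rewrite ix ltnNge.
  by move: yD; rewrite in_take // ltnS => ->.
have LD : least_dominant (removable_boxes (take m.+1 bs)) = x.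
  set L := removable_boxes _.
  have xL : x \in L.
    rewrite mem_filter [x \in take _ _]inD ?lex_lt_irr // andbT.
    apply/andP; split; apply/negP => /Dlex[_]; rewrite /lex_lt /=.
      by rewrite ltnSn.
    by rewrite eqxx ltnSn orbT.
  have Px b : b \in L -> (b == x) || more_dominant b x.
    rewrite mem_filter => /andP[/andP[n1 n2] bD]; have [bb xb] := Dlex _ bD.
    have [//|bx] := eqVneq b x; rewrite /=.
    have := lex_lt_total bx; rewrite (negbTE xb) orbF {1}/lex_lt.
    have xr : x.2 < nth 0 la x.1 by rewrite -boxesP.
    case/orP=> [lt|/andP[/eqP e1 lt]]; last first.
      case/negP: n2; apply: inD; first by rewrite boxesP /= e1; apply: leq_ltn_trans xr.
      by rewrite /lex_lt /= e1 ltnn eqxx /= -leqNgt.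
    have [lt2|le2] := ltnP x.2 b.2; first exact: more_dominant_north_east.
    case/negP: n1; apply: inD.
      by rewrite boxesP /=; apply: leq_trans (partition_nth_leq lt); apply: leq_ltn_trans xr.
    by rewrite /lex_lt /= negb_or -leqNgt lt /= negb_and -leqNgt le2 orbT.
  rewrite /least_dominant; set P := fun b => all _ L.
  have PxL : P x by apply/allP => b; apply: Px.
  have uni b : b \in [seq b <- L | P b] -> b = x.
    rewrite mem_filter => /andP[/allP /(_ x xL) /orP[/eqP //|h1] /Px /orP[/eqP //|h2]].
    by case: (more_dominant_asym h1 h2).
  have : x \in [seq b <- L | P b] by rewrite mem_filter PxL.
  case E : [seq b <- L | P b] => [//|y l] _ /=.
  by apply: uni; rewrite E mem_head.
rewrite /= LD TE rem_filter; last by rewrite -TE take_uniq.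
rewrite filter_rcons /= eqxx /=.
have -> : [seq y <- take m bs | y != x] = take m bs.
  apply/all_filterP/allP => y yt; apply/eqP => E; move: yt.
  by rewrite E in_take // ix ltnn.
by rewrite ih // ltnW.
Qed.

Lemma dom_tabE : dom_tab la = boxes la.
Proof. by have := fill_take (leqnn n); rewrite -{2 3}size_boxes take_size /dom_tab size_boxes. Qed.

End PartitionBoxes.

(** * Standard tableaux as functions of their entries *)

Section StandardFillings.
Variables (n h : nat) (la : seq nat).
Hypotheses (hla : is_partition n h la) (h0 : 0 < h).
Local Notation F := {ffun 'I_n -> box}.
Implicit Types (f g : F) (k l : 'I_n) (r : 'I_n.-1).

Definition le_box (b b' : box) := (b.1 <= b'.1) && (b.2 <= b'.2).

(** Increase along rows and columns is replaced by monotonicity on all comparable boxes, the form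
    needed for arguments about boxes between two others. *)
Record std_fun f : Prop := StdFun {
  std_fun_mem : forall k, f k \in boxes la;
  std_fun_surj : forall b, b \in boxes la -> exists k, f k = b;
  std_fun_le : forall k l, le_box (f k) (f l) -> k <= l }.

Lemma std_fun_inj f : std_fun f -> injective f.
Proof.
move=> sf k l E; apply: val_inj; apply/eqP; rewrite eqn_leq.
by rewrite !(std_fun_le sf) // E /le_box !leqnn.
Qed.

Definition tab_fun (s : tableau) : F := [ffun k : 'I_n => nth (0, 0) s k].

Lemma std_mem s : s \in std la -> perm_eq s (boxes la) /\ is_standard s.
Proof. by rewrite mem_filter mem_permutations => /andP[]. Qed.

Lemma std_size s : s \in std la -> size s = n.
Proof. by case/std_mem => /perm_size ->; rewrite (size_boxes hla). Qed.

Lemma std_uniq s : s \in std la -> uniq s.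
Proof. by case/std_mem => /perm_uniq -> _; apply: boxes_uniq. Qed.

Lemma std_tab_fun s : s \in std la -> std_fun (tab_fun s).
Proof.
move=> hs; have [ps ss] := std_mem hs; have sz := std_size hs; have us := std_uniq hs.
have ms k : nth (0, 0) s k \in s \/ n <= k.
  by have [lt|le] := ltnP k n; [left; rewrite mem_nth ?sz | right].
have adj b b' : b \in s -> b' \in s ->
    (b.1 == b'.1) && (b.2 < b'.2) || (b.2 == b'.2) && (b.1 < b'.1) -> index b s < index b' s.
  by move=> hb hb'; move/allP: ss => /(_ _ hb) /allP /(_ _ hb') /implyP.
split=> [k|b|k l]; rewrite ?ffunE.
- by rewrite -(perm_mem ps) mem_nth // sz.
- rewrite -(perm_mem ps) => hb; have ib : index b s < n by rewrite -sz index_mem.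
  by exists (Ordinal ib); rewrite ffunE /= nth_index.
have kn : k < size s by rewrite sz. have ln : l < size s by rewrite sz.
have hk := mem_nth (0, 0) kn; have hl := mem_nth (0, 0) ln.
rewrite -{2}(index_uniq (0, 0) kn us) -{2}(index_uniq (0, 0) ln us).
move: hk hl; case: (nth _ s k) => a b; case: (nth _ s l) => a' b' hk hl /andP[/= aa bb].
(* Comparable boxes are joined through the corner in the row of the first and the column of the
   second. *)
have hm : (a, b') \in s.
  move: hl; rewrite !(perm_mem ps) !(boxesP) /= => lt.
  exact: leq_trans lt (partition_nth_leq hla aa).
apply: (@leq_trans (index (a, b') s)).
  move: bb; rewrite leq_eqVlt => /orP[/eqP -> //|bb].
  by apply: ltnW; apply: adj; rewrite //= eqxx bb.
move: aa; rewrite leq_eqVlt => /orP[/eqP -> //|aa].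
by apply: ltnW; apply: adj; rewrite //= eqxx aa orbT.
Qed.

Lemma tab_fun_inj s s' : s \in std la -> s' \in std la -> tab_fun s = tab_fun s' -> s = s'.
Proof.
move=> hs hs' /ffunP E; apply: (@eq_from_nth _ (0, 0)); first by rewrite !std_size.
move=> i; rewrite (std_size hs) => lt.
by have := E (Ordinal lt); rewrite !ffunE.
Qed.

Lemma std_fun_tab f : std_fun f -> exists2 s, s \in std la & tab_fun s = f.
Proof.
move=> sf; pose s := [seq f k | k <- enum 'I_n].
have sz : size s = n by rewrite size_map size_enum_ord.
have ns (k : 'I_n) : nth (0, 0) s k = f k.
  by rewrite (nth_map k) ?size_enum_ord // nth_ord_enum.
have ms b : b \in s -> exists k, f k = b.
  by case/mapP => k _ ->; exists k.
have us : uniq s by rewrite map_inj_uniq ?enum_uniq //; apply: std_fun_inj.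
have ix k : index (f k) s = k by rewrite -(ns k) index_uniq // sz.
exists s; last by apply/ffunP => k; rewrite ffunE ns.
rewrite mem_filter mem_permutations; apply/andP; split.
  apply/allP => b /ms [k <-]; apply/allP => b' /ms [l <-]; apply/implyP => hc.
  rewrite !ix ltn_neqAle; apply/andP; split.
    by apply/eqP => /val_inj E; move: hc; rewrite E !ltnn !andbF.
  apply: (std_fun_le sf); rewrite /le_box.
  by case/orP: hc => /andP[/eqP -> /ltnW ->]; rewrite leqnn.
apply: uniq_perm => //; first exact: boxes_uniq.
move=> b; apply/idP/idP => [/ms [k <-]|/(std_fun_surj sf) [k <-]].
  exact: std_fun_mem.
by apply: map_f; rewrite mem_enum.
Qed.

Definition f_init : F := tab_fun (boxes la).

Lemma f_init_mem k : f_init k \in boxes la.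
Proof. by rewrite ffunE mem_nth // (size_boxes hla). Qed.

Lemma f_init_lex k l : k < l -> lex_lt (f_init k) (f_init l).
Proof.
move=> kl; rewrite !ffunE.
by have /(pairwiseP (0, 0)) P := boxes_pairwise la; apply: P; rewrite // !inE (size_boxes hla).
Qed.

Lemma le_box_lex b b' : le_box b b' -> lex_lt b' b = false.
Proof. by rewrite /le_box /lex_lt => /andP[]; case: ltngtP => //= _ _; rewrite leqNgt => /negbTE. Qed.

Lemma std_f_init : std_fun f_init.
Proof.
split=> [k|b|k l]; first exact: f_init_mem.
  move=> hb; have ib : index b (boxes la) < n by rewrite -(size_boxes hla) index_mem.
  by exists (Ordinal ib); rewrite ffunE /= nth_index.
by move/le_box_lex => E; rewrite leqNgt; apply/negP => /f_init_lex; rewrite E.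
Qed.

Lemma boxes_std : boxes la \in std la.
Proof.
have [s hs E] := std_fun_tab std_f_init.
suff -> : boxes la = s by [].
apply: (@eq_from_nth _ (0, 0)); first by rewrite (std_size hs) (size_boxes hla).
move=> i; rewrite (size_boxes hla) => lt.
by have /ffunP /(_ (Ordinal lt)) := E; rewrite !ffunE.
Qed.

Lemma fswap_std f r : std_fun f -> ~~ le_box (f (pos r)) (f (pos_succ r)) ->
  std_fun (fswap r f).
Proof.
move=> sf nle; split=> [k|b|k l]; rewrite ?ffunE; first exact: std_fun_mem.
  move/(std_fun_surj sf) => [k <-]; exists (tperm (pos r) (pos_succ r) k).
  by rewrite ffunE tpermK.
move=> hle; have := std_fun_le sf hle; move: hle.
case: tpermP => [->|->|k1 k2]; case: tpermP => [->|->|l1 l2] //= hle.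
- by move/ltnW.
- by rewrite hle in nle.
- by move=> rl; rewrite ltn_neqAle rl andbT; apply/eqP => E; apply: l1; apply: val_inj.
- by move=> kr; rewrite -ltnS ltn_neqAle kr andbT; apply/eqP => E; apply: k2; apply: val_inj.
- exact: leqW.
Qed.

Definition fill_path f : lattice_path n h :=
  [ffun k => insubd (Ordinal h0) (f k).2].

Lemma fill_pathE f k : std_fun f -> fill_path f k = (f k).2 :> nat.
Proof.
move=> sf; rewrite ffunE val_insubd.
have := std_fun_mem sf k; rewrite (boxesP) => lt.
by rewrite (leq_trans lt (partition_nth_h hla _)).
Qed.

Lemma fill_path_fswap f r : fill_path (fswap r f) = fswap r (fill_path f).
Proof. by apply/ffunP => k; rewrite !ffunE. Qed.

(** In a standard tableau the boxes of a column with small entries form an initial segment of its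
    rows, so their number decides which rows occur. *)
Lemma hgt_fill_path f (i r : nat) (c : 'I_h) : std_fun f ->
  (r < hgt (fill_path f) i c) = [exists j : 'I_n, (j < i) && (f j == (r, c : nat))].
Proof.
move=> sf; pose rs := [seq (f j).1 | j : 'I_n <- enum 'I_n & (j < i) && (fill_path f j == c)].
have sz : size rs = hgt (fill_path f) i c.
  rewrite size_map size_filter /hgt -sum1_count big_enum_cond /=.
  rewrite big_mkcondr /= [RHS]big_mkcond [LHS]big_mkcond; apply: eq_bigr => j _.
  by case: (j < i) => //=; case: (_ == _).
have mr x : (x \in rs) = [exists j : 'I_n, (j < i) && (f j == (x, c : nat))].
  apply/mapP/existsP => [[j]|[j /andP[ji /eqP E]]].
    rewrite mem_filter => /andP[/andP[ji /eqP jc] _] ->; exists j; rewrite ji /=.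
    by rewrite -jc (fill_pathE _ sf) -surjective_pairing.
  exists j; last by rewrite E.
  by rewrite mem_filter mem_enum ji -val_eqE /= (fill_pathE _ sf) E eqxx.
rewrite -sz -mr -down_closed_mem //.
  rewrite map_inj_in_uniq; first by apply: filter_uniq; exact: enum_uniq.
  move=> j j'; rewrite !mem_filter => /andP[/andP[_ /eqP jc] _] /andP[/andP[_ /eqP jc'] _] E.
  apply: (std_fun_inj sf); rewrite [f j]surjective_pairing [f j']surjective_pairing E.
  by rewrite -!(fill_pathE _ sf) jc jc'.
move=> x x'; rewrite !mr => /existsP [j /andP[ji /eqP E]] xx.
have hx : (x', c : nat) \in boxes la.
  have := std_fun_mem sf j; rewrite E !(boxesP) /= => lt.
  exact: leq_trans lt (partition_nth_leq hla xx).
have [j' E'] := std_fun_surj sf hx; apply/existsP; exists j'; rewrite E' eqxx andbT.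
by apply: leq_ltn_trans ji; apply: (std_fun_le sf); rewrite E E' /le_box /= xx leqnn.
Qed.

Lemma std_fun_row f k : std_fun f -> (f k).1 = hgt (fill_path f) k (fill_path f k).
Proof.
move=> sf; apply/eqP; rewrite eqn_leq leqNgt [X in _ && X]leqNgt; apply/andP; split.
  apply/negP => lt.
  set r := hgt _ _ _ in lt.
  have := ltnn r; rewrite {2}/r hgt_fill_path // => /existsP; apply.
  have hr : (r, fill_path f k : nat) \in boxes la.
    have := std_fun_mem sf k; rewrite !(boxesP) /= (fill_pathE _ sf) => lt'.
    by apply: leq_trans lt' _; apply: (partition_nth_leq hla); apply: ltnW.
  have [j E] := std_fun_surj sf hr; exists j; rewrite E eqxx andbT.
  have : j <= k by apply: (std_fun_le sf); rewrite E /le_box /= (fill_pathE _ sf) leqnn andbT ltnW.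
  rewrite leq_eqVlt => /orP[/eqP /val_inj jk|//].
  by move: lt; rewrite -jk E /= ltnn.
apply/negP; rewrite hgt_fill_path // => /existsP [j /andP[jk /eqP E]].
have /(std_fun_inj sf) jk' : f j = f k by rewrite E (fill_pathE _ sf) -surjective_pairing.
by rewrite jk' ltnn in jk.
Qed.

Lemma hgt_fill_path_mono f i (a b : 'I_h) : std_fun f -> a <= b ->
  hgt (fill_path f) i b <= hgt (fill_path f) i a.
Proof.
move=> sf ab; rewrite leqNgt hgt_fill_path //; apply/negP => /existsP [j /andP[ji /eqP E]].
have := ltnn (hgt (fill_path f) i a); rewrite hgt_fill_path // => /existsP; apply.
have hx : (hgt (fill_path f) i a, a : nat) \in boxes la.
  have := std_fun_mem sf j; rewrite E !(boxesP) /=; exact: leq_ltn_trans.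
have [j' E'] := std_fun_surj sf hx; exists j'; rewrite E' eqxx andbT.
by apply: leq_ltn_trans ji; apply: (std_fun_le sf); rewrite E E' /le_box /= leqnn.
Qed.

Lemma hgt_fill_path_end f (c : 'I_h) : std_fun f -> hgt (fill_path f) n c = column_length la c.
Proof.
move=> sf.
have E (r : nat) : (r < hgt (fill_path f) n c) = (r < column_length la c).
  rewrite hgt_fill_path // (column_lengthP hla).
  apply/existsP/idP => [[j /andP[_ /eqP E]]|lt].
    by have := std_fun_mem sf j; rewrite E (boxesP).
  have hx : (r, c : nat) \in boxes la by rewrite (boxesP).
  by have [j E] := std_fun_surj sf hx; exists j; rewrite ltn_ord E eqxx.
by apply/eqP; rewrite eqn_leq leqNgt E ltnn leqNgt -E ltnn.
Qed.

Lemma fill_path_inj f g : std_fun f -> std_fun g -> fill_path f = fill_path g -> f = g.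
Proof.
move=> sf sg E; apply/ffunP => k.
rewrite [f k]surjective_pairing [g k]surjective_pairing !std_fun_row // E.
by rewrite -!fill_pathE // E.
Qed.

End StandardFillings.

(** * Paths of standard tableaux *)

Section FillingPaths.
Variables (R : realType) (p n h : nat) (la : seq nat).
Hypotheses (hla : is_partition n h la) (h0 : 0 < h).
Local Notation F := {ffun 'I_n -> box}.
Local Notation fill_path := (@fill_path n h h0).
Local Notation f_init := (f_init n la).
Implicit Types (f g : F) (k l : 'I_n) (r : 'I_n.-1).

Lemma fill_path_dominant f (i : nat) : std_fun la f -> dominant p (point R (fill_path f) i).
Proof.
move=> sf; apply/dominantE => a b ab.
have := hgt_fill_path_mono hla h0 i sf (ltnW ab).
rewrite /zc; lia.
Qed.

Lemma fill_path_weight f : std_fun la f -> point R (fill_path f) n = weight R h la.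
Proof.
by move=> sf; apply/rowP => c; rewrite pointE (hgt_fill_path_end hla) // mxE.
Qed.

Definition fres f : res_seq p n := [ffun k => residue p (f k)].

Lemma fill_path_res f : std_fun la f -> path_res p (fill_path f) = fres f.
Proof.
move=> sf; apply/ffunP => k; rewrite !ffunE /pres /residue.
by rewrite (std_fun_row hla h0 _ sf) -(fill_pathE hla h0 _ sf).
Qed.

Lemma tab_resE s : tab_res p n s = fres (tab_fun n s).
Proof. by apply/ffunP => k; rewrite !ffunE. Qed.

Lemma is_dom_pathE t : is_dom_path la t <-> t = fill_path f_init.
Proof.
have sf := std_f_init hla; have E k := fill_pathE hla h0 k sf.
split=> [d|-> k]; last by rewrite E ffunE (dom_tabE hla).
apply/ffunP => k; apply: val_inj => /=.
by rewrite d E ffunE (dom_tabE hla).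
Qed.

Lemma hgt_f_init (j : 'I_n) (a : 'I_h) x : (x < hgt (fill_path f_init) j a) =
  ((x, a : nat) \in boxes la) && lex_lt (x, a : nat) (f_init j).
Proof.
have sf := std_f_init hla.
rewrite (hgt_fill_path hla) //; apply/existsP/andP => [[i /andP[ij /eqP E]]|[hx lt]].
  by rewrite -E (f_init_mem hla) (f_init_lex hla).
have [i E] := std_fun_surj sf hx; exists i; rewrite E eqxx andbT.
case: (ltngtP i j) => // [ji|/val_inj ij].
  by move: lt; rewrite -E (lex_lt_asym (f_init_lex hla ji)).
by move: lt; rewrite -E ij lex_lt_irr.
Qed.

Lemma zc_f_init_left (j : 'I_n) (a : 'I_h) : a < (f_init j).2 ->
  (zc (fill_path f_init) j a - zc (fill_path f_init) j (fill_path f_init j) =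
  ((f_init j).2 - a).+1%:Z)%R.
Proof.
have sf := std_f_init hla => ac.
rewrite /zc -(std_fun_row hla h0 _ sf) (fill_pathE hla h0 _ sf).
suff -> : hgt (fill_path f_init) j a = (f_init j).1.+1 by lia.
have := f_init_mem hla j; rewrite boxesP => hb.
have B x : x <= (f_init j).1 -> (x, a : nat) \in boxes la.
  move=> hx; rewrite boxesP /=; apply: leq_trans (partition_nth_leq hla hx).
  exact: ltn_trans hb.
apply/eqP; rewrite eqn_leq hgt_f_init B // /lex_lt /= eqxx ac orbT andbT.
rewrite leqNgt hgt_f_init /lex_lt /=; apply/negP => /andP[_]; lia.
Qed.

Lemma zc_f_init_right (j : 'I_n) (a : 'I_h) : (f_init j).2 < a ->
  (zc (fill_path f_init) j a < zc (fill_path f_init) j (fill_path f_init j))%R.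
Proof.
have sf := std_f_init hla => ac.
rewrite /zc -(std_fun_row hla h0 _ sf) (fill_pathE hla h0 _ sf).
suff : hgt (fill_path f_init) j a <= (f_init j).1 by lia.
rewrite leqNgt hgt_f_init /lex_lt /=; apply/negP => /andP[_]; lia.
Qed.

Hypotheses (p3 : 2 < p) (hp : h < p).

Lemma small_Zp (z : nat) : 0 < z < p -> (z%:Z%:~R == 0 :> 'Z_p)%R = false.
Proof.
move=> /andP[z0 zp]; rewrite Zp_intr_eq0 ?(ltnW p3) //.
by apply/negP => /(dvdn_leq z0); rewrite leqNgt zp.
Qed.

(** When [t^la] adds a box to column c, a column a < c is already one box higher, so the coordinates
    differ by c - a + 1. This lies between 2 and h, hence is neither 0 nor 1 modulo p; thus the path
    of [t^la] has degree 0. *)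
Lemma hop_f_init j : (hop p (fill_path f_init) j = 0)%R.
Proof.
rewrite /hop big1 // => a; have sf := std_f_init hla.
rewrite (fill_pathE hla h0 _ sf) => ac; rewrite zc_f_init_left //.
have lt : (f_init j).2 < h.
  by have := f_init_mem hla j; rewrite boxesP => /leq_trans; apply; apply: partition_nth_h hla _.
rewrite /hop_deg small_Zp; last lia.
rewrite -subr_eq0 -[X in (_ - X)%R]/(1%:~R)%R -intrB.
rewrite (_ : (_ - 1)%R = Posz ((f_init j).2 - a)); last lia.
by rewrite small_Zp //; lia.
Qed.

(** Columns to the left have coordinates larger by at least 2 and at most h, so they are not
    congruent modulo p; columns to the right have smaller coordinates. *)
Lemma topmost_f_init : topmost p (fill_path f_init).
Proof.
move=> j a an /eqP; have sf := std_f_init hla.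
rewrite -subr_eq0 -intrB.
have lt : (f_init j).2 < h.
  by have := f_init_mem hla j; rewrite boxesP => /leq_trans; apply; apply: partition_nth_h hla _.
case: (ltngtP a (f_init j).2) => [ac|ac|ac].
- by rewrite zc_f_init_left // small_Zp //; lia.
- by rewrite (fill_pathE hla h0 _ sf) zc_f_init_right.
by case/eqP: an; apply: val_inj; rewrite /= ac (fill_pathE hla h0 _ sf).
Qed.

End FillingPaths.

(** * Inversions and reduced expressions *)

Section Inversions.
Variables (n h : nat) (la : seq nat).
Hypothesis hla : is_partition n h la.
Local Notation F := {ffun 'I_n -> box}.
Local Notation f_init := (f_init n la).
Implicit Types (f g : F) (k l : 'I_n) (r : 'I_n.-1).

Lemma lex_lt_trans : transitive lex_lt.
Proof. by move=> [a b] [c d] [e f]; rewrite /lex_lt /=; lia. Qed.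

Definition inversions f := #|[set ij : 'I_n * 'I_n | (ij.1 < ij.2) && lex_lt (f ij.2) (f ij.1)]|.

Lemma inversions_fswap f r : lex_lt (f (pos_succ r)) (f (pos r)) -> inversions f = (inversions (fswap r f)).+1.
Proof.
move=> lt; pose s := tperm (pos r) (pos_succ r).
rewrite /inversions (cardsD1 (pos r, pos_succ r)) inE /= ltnSn lt add1n; congr _.+1.
have sK : involutive s by move=> x; apply: tpermK.
have mono i j : (i, j) != (pos r, pos_succ r) -> i < j -> s i < s j /\ (s i, s j) != (pos r, pos_succ r).
  rewrite /s !xpair_eqE -!val_eqE /=.
  by case: tpermP => [->|->|/eqP i1 /eqP i2]; case: tpermP => [->|->|/eqP j1 /eqP j2] /=; move: i1 i2 j1 j2 || move: i1 i2 || move: j1 j2 || idtac; rewrite -?val_eqE /=; lia.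
rewrite -(card_imset _ (f := fun ij : 'I_n * 'I_n => (s ij.1, s ij.2))); last first.
  by move=> [i j] [i' j'] /= [/(can_inj sK) -> /(can_inj sK) ->].
apply: eq_card => -[i j]; apply/imsetP/idP => [[[i' j']]|].
  rewrite !inE /= => /and3P[ne lt' lx] [-> ->].
  have [-> _] := mono _ _ ne lt'.
  by rewrite !ffunE -/s !sK.
rewrite inE /= !ffunE -/s => /andP[ij lx].
have ne : (i, j) != (pos r, pos_succ r).
  apply/eqP => -[E1 E2]; move: lx; rewrite E1 E2 /s tpermL tpermR.
  by rewrite (lex_lt_asym lt).
have [h1 h2] := mono _ _ ne ij.
by exists (s i, s j); rewrite ?inE /= ?h1 ?h2 ?sK.
Qed.

Definition wfun (w : seq 'I_n.-1) f : F := foldr (fun r g => fswap r g) f w.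

Lemma wfun_act w f k : wfun w f (word_act w k) = f k.
Proof. by elim: w => //= r w ih; rewrite ffunE tpermK. Qed.

Lemma word_act_inj (w : seq 'I_n.-1) : injective (word_act w).
Proof. by elim: w => //= r w ih k l /perm_inj /ih. Qed.

Lemma wfun_inj w f : injective f -> injective (wfun w f).
Proof. by elim: w => //= r w ih fi k l; rewrite !ffunE => /(ih fi) /perm_inj. Qed.

Lemma increasing_f_init f : std_fun la f -> inversions f = 0 -> f = f_init.
Proof.
move=> sf /eqP; rewrite cards_eq0 => /eqP /setP i0.
have [s hs E] := std_fun_tab sf; rewrite -E; congr tab_fun.
apply: (irr_sorted_eq lex_lt_trans (fun x => lex_lt_irr x)).
- rewrite sorted_pairwise; last exact: lex_lt_trans.
  apply/(pairwiseP (0, 0)) => i j; rewrite !inE (std_size hla hs) => hi hj ij.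
  have := i0 (Ordinal hi, Ordinal hj); rewrite !inE /= ij /= -E !ffunE /= => nl.
  have : nth (0, 0) s i != nth (0, 0) s j.
    by rewrite nth_uniq ?(std_size hla hs) ?(std_uniq hs) // neq_ltn ij.
  by move/lex_lt_total; rewrite nl orbF.
- by rewrite sorted_pairwise; [apply: boxes_pairwise | apply: lex_lt_trans].
by move=> b; have [/perm_mem -> _] := std_mem hs.
Qed.

Lemma descent_exists f : std_fun la f -> 0 < inversions f ->
  exists r, lex_lt (f (pos_succ r)) (f (pos r)).
Proof.
move=> sf i0; apply/existsP; apply: contraLR i0 => /existsPn nd.
rewrite -leqNgt leqn0 cards_eq0; apply/eqP/setP => -[i j]; rewrite !inE /=.
apply/negbTE; rewrite negb_and -leqNgt; case: leqP => //= ij.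
have up (k l : 'I_n) : l = k.+1 :> nat -> lex_lt (f k) (f l).
  move=> lk; have kn : k < n.-1 by have := ltn_ord l; rewrite lk; lia.
  have := nd (Ordinal kn).
  rewrite (_ : pos _ = k); last exact: val_inj.
  rewrite (_ : pos_succ _ = l); last by apply: val_inj; rewrite /= lk.
  have : f k != f l by apply/eqP => /(std_fun_inj sf) E; move: lk; rewrite E; lia.
  by case/lex_lt_total/orP => // ->.
suff /lex_lt_asym -> : lex_lt (f i) (f j) by [].
have [m jm] : exists m, j = m :> nat by exists j.
elim: m j jm ij => [|m ih] j jm; rewrite jm // ltnS leq_eqVlt => /orP[/eqP E|im]; first by apply: up; rewrite jm E.
have mn : m < n by have := ltn_ord j; rewrite jm; lia.
apply: (lex_lt_trans (y := f (Ordinal mn))); first exact: ih.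
exact: up.
Qed.

Lemma lex_not_le b b' : lex_lt b' b -> ~~ le_box b b'.
Proof. by move=> lt; apply/negP => /le_box_lex; rewrite lt. Qed.

Lemma inversions_word f : std_fun la f -> exists2 w, size w = inversions f & wfun w f_init = f.
Proof.
have [m E] : exists m, inversions f = m by exists (inversions f).
elim: m f E => [|m ih] f E sf.
  by exists [::] => //=; rewrite -(increasing_f_init sf E).
have [|r lt] := descent_exists sf; first by rewrite E.
have [|w sw wf] := ih (fswap r f) _ (fswap_std sf (lex_not_le lt)).
  by apply: succn_inj; rewrite -E (inversions_fswap lt).
by exists (r :: w); rewrite /= ?sw ?wf ?fswapK // (inversions_fswap lt).
Qed.

(** Descents can be removed one at a time within standard tableaux, which yields an expression with
    as many letters as inversions; a reduced one is not longer. *)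
Lemma reduced_exprE s w : s \in std la -> reduced_expr (dom_tab la) s w ->
  wfun w f_init = tab_fun n s /\ size w <= inversions (tab_fun n s).
Proof.
move=> hs [hw min]; have sf := std_tab_fun hla hs.
have E : wfun w f_init = tab_fun n s.
  apply/ffunP => x; have /codomP [k ->] : x \in codom (word_act w).
    by apply: injF_onto; apply: word_act_inj.
  by rewrite wfun_act !ffunE hw (dom_tabE hla).
split=> //; have [w' <- E'] := inversions_word sf.
apply: min => k; apply: (std_fun_inj sf).
by rewrite -{1}E' -E !wfun_act.
Qed.

Lemma inversions_wfun w : inversions (wfun w f_init) <= size w.
Proof.
elim: w => [|r w ih] /=.
  rewrite leqn0 cards_eq0; apply/eqP/setP => -[i j]; rewrite !inE /=.
  by case: ltnP => //= /(f_init_lex hla) /lex_lt_asym.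
have fi := wfun_inj (w := w) (std_fun_inj (std_f_init hla)).
have : wfun w f_init (pos r) != wfun w f_init (pos_succ r).
  by rewrite (inj_eq fi) -val_eqE /= neq_ltn ltnSn.
case/lex_lt_total/orP => lt; last by move: ih; rewrite (inversions_fswap lt); lia.
by rewrite (inversions_fswap (r := r)) ?fswapK // !ffunE tpermL tpermR.
Qed.

(** A letter changes the number of inversions by one, so in a word no longer than the number of
    inversions each letter creates one. Undoing such a letter keeps the tableau standard, hence all
    suffixes lead to standard tableaux. The condition on columns is the one that [hop_fswap] asks
    for. *)
Lemma reduced_ind (P : seq 'I_n.-1 -> Prop) : P [::] ->
  (forall r w, let g := wfun w f_init in std_fun la g -> std_fun la (fswap r g) ->
     (g (pos_succ r)).2 < (g (pos r)).2 -> P w -> P (r :: w)) ->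
  forall w, std_fun la (wfun w f_init) -> size w <= inversions (wfun w f_init) -> P w.
Proof.
move=> P0 PS; elim=> [//|r w ih] /= sf sz.
set g := wfun w f_init in ih sf sz PS *.
have ig : inversions g <= size w := inversions_wfun w.
have lt : lex_lt (g (pos r)) (g (pos_succ r)).
  have fi : injective g := wfun_inj (w := w) (std_fun_inj (std_f_init hla)).
  have : g (pos r) != g (pos_succ r).
    by rewrite (inj_eq fi) -val_eqE /= neq_ltn ltnSn.
  case/lex_lt_total/orP => // lt; move: sz ig; rewrite (inversions_fswap lt); lia.
have lt' : lex_lt (fswap r g (pos_succ r)) (fswap r g (pos r)).
  by rewrite !ffunE tpermL tpermR.
have sg : std_fun la g by rewrite -(fswapK r g); apply: fswap_std sf (lex_not_le lt').
apply: PS => //.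
  have nl : ~~ le_box (g (pos r)) (g (pos_succ r)).
    apply/negP => hle; have := std_fun_le sf (k := pos_succ r) (l := pos r).
    by rewrite !ffunE tpermL tpermR => /(_ hle) /=; rewrite ltnn.
  by move: nl lt; rewrite /le_box /lex_lt; case: (g (pos r)) => a b; case: (g _) => c d /=; lia.
apply: ih => //.
by move: sz; rewrite (inversions_fswap lt') fswapK.
Qed.

Lemma dom_tab_word (w : seq 'I_n.-1) : reduced_expr (dom_tab la) (dom_tab la) w -> w = [::].
Proof.
rewrite {2}(dom_tabE hla) => /(reduced_exprE (boxes_std hla)) [_].
have /= := inversions_wfun [::]; rewrite leqn0 => /eqP ->.
by rewrite leqn0 => /nilP.
Qed.

End Inversions.

(** * Dominance of shapes *)

Section ShapeEnergy.
Variables (n h : nat).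
Local Notation part := (is_partition n h).
Implicit Types (la mu nu : seq nat).

Lemma box_row_bound la b : part la -> b \in boxes la -> b.1 < n.
Proof.
move=> hla; rewrite boxesP => hb; rewrite -(size_boxes hla).
have := @uniq_leq_size _ [seq (i, 0) | i <- iota 0 b.1.+1] (boxes la).
rewrite size_map size_iota; apply; first by rewrite map_inj_uniq ?iota_uniq // => i j [].
move=> x /mapP [i]; rewrite mem_iota => /andP[_ hi] ->; rewrite boxesP /=.
apply: leq_trans (partition_nth_leq hla (_ : i <= b.1)); last by rewrite -ltnS.
exact: leq_ltn_trans hb.
Qed.

Lemma box_column_bound la b : part la -> b \in boxes la -> b.2 < n.
Proof.
move=> hla; rewrite boxesP => hb; rewrite -(size_boxes hla).
have := @uniq_leq_size _ [seq (b.1, i) | i <- iota 0 b.2.+1] (boxes la).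
rewrite size_map size_iota; apply; first by rewrite map_inj_uniq ?iota_uniq // => i j [].
move=> x /mapP [i]; rewrite mem_iota => /andP[_ hi] ->; rewrite boxesP /=.
exact: leq_trans hb.
Qed.

Lemma boxes_inj la nu : part la -> part nu -> boxes la =i boxes nu -> la = nu.
Proof.
move=> hla hnu E.
have En r : nth 0 la r = nth 0 nu r.
  have H c : (c < nth 0 la r) = (c < nth 0 nu r).
    by have := E (r, c); rewrite !boxesP.
  by apply/eqP; rewrite eqn_leq leqNgt H ltnn leqNgt -H ltnn.
have sz la' nu' : part la' -> (forall r, nth 0 la' r = nth 0 nu' r) -> size la' <= size nu'.
  move=> h' E'; rewrite leqNgt; apply/negP => lt.
  have := mem_nth 0 lt; rewrite E' nth_default // => z.
  by case/and4P: h' => _ /negP; case.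
apply: (@eq_from_nth _ 0) => [|r _]; last exact: En.
by apply/eqP; rewrite eqn_leq !sz // => r; rewrite En.
Qed.

Lemma big_boxes_columns (V : nmodType) (G : box -> V) la : part la ->
  (\sum_(b <- boxes la) G b = \sum_(c < h) \sum_(r < column_length la c) G (nat_of_ord r, nat_of_ord c))%R.
Proof.
move=> hla.
have P : perm_eq (boxes la) [seq (r, c) | c <- iota 0 h, r <- iota 0 (column_length la c)].
  apply: uniq_perm; first exact: boxes_uniq.
    apply: allpairs_uniq_dep; first exact: iota_uniq.
      by move=> c _; apply: iota_uniq.
    by move=> [c r] [c' r'] _ _ /= [-> ->].
  move=> [r c]; rewrite boxesP /= -(column_lengthP hla).
  apply/idP/allpairsPdep => [lt|[c' [r' [h1 h2 [-> ->]]]]]; last first.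
    by move: h2; rewrite mem_iota.
  exists c, r; rewrite !mem_iota /= !add0n; split=> //.
  move: lt; rewrite (column_lengthP hla) => lt.
  exact: leq_trans lt (partition_nth_h hla _).
have I k (H : nat -> V) : (\sum_(i <- iota 0 k) H i = \sum_(i < k) H i)%R.
  by rewrite -(big_mkord xpredT) /index_iota subn0.
rewrite (perm_big _ P) big_allpairs_dep /= I.
by apply: eq_bigr => c _; rewrite I.
Qed.

(* Truncation is harmless: rows of boxes are smaller than [n]. *)
Definition csum la := \sum_(b <- boxes la) (n + b.2 - b.1).

(** The boxes on an initial set of diagonals in the dominance order, counted over all residues;
    [csum] is the sum of these counts. *)
Definition layer la d := \sum_(b <- boxes la) (b.1 + n <= b.2 + d).

Lemma csum_layers la : part la -> csum la = \sum_(d < 2 * n) layer la d.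
Proof.
move=> hla; rewrite exchange_big /= /csum !big_seq; apply: eq_bigr => b hb.
have := box_row_bound hla hb; have := box_column_bound hla hb => hc hr.
case: b hb hc hr => x y _ /= hy hx.
have H m : \sum_(d < m) (x + n <= y + d) = m - (x + n - y).
  elim: m => [|m ih]; first by rewrite big_ord0.
  by rewrite big_ord_recr /= ih; case: leqP; lia.
rewrite H; lia.
Qed.

Section Energy.
Variables (R : realType) (p : nat).

(** The square of each coordinate is summed box by box: the box in row r and column c adds 2r + 1 +
    2(p - c). Hence only the sum of the contents varies with the shape. *)
Lemma weight_energy la : part la ->
  (energy p (weight R h la) = \sum_(c < h) (p%:R - c%:R) ^+ 2
     + ((2 * n + 2 * p + 1) * n)%:R - 2 * (csum la)%:R :> R)%R.
Proof.
move=> hla; rewrite /energy.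
have sq (l : nat) (x : R) : ((l%:R + x) ^+ 2 = x ^+ 2 + \sum_(r < l) (2 * r%:R + 1 + 2 * x))%R.
  elim: l => [|l ih]; first by rewrite big_ord0 add0r addr0.
  by rewrite big_ord_recr /= addrA -ih -natr1; ring.
transitivity ((\sum_(c < h) (p%:R - c%:R) ^+ 2 +
    \sum_(b <- boxes la) (2 * b.1%:R + 1 + 2 * (p%:R - b.2%:R))) : R)%R.
  rewrite (big_boxes_columns _ hla) -big_split; apply: eq_bigr => c _ /=.
  by rewrite !mxE sq.
rewrite -addrA; congr (_ + _)%R.
have nE : (n%:R = \sum_(b <- boxes la) 1%:R :> R)%R.
  by rewrite -{1}(size_boxes hla) -sum1_size natr_sum.
rewrite natrM nE mulr_sumr /csum natr_sum mulr_sumr -sumrB.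
rewrite !big_seq; apply: eq_bigr => b hb.
have hr := box_row_bound hla hb.
rewrite natrB; last exact: leq_trans (ltnW hr) (leq_addr _ _).
by rewrite !natrD; ring.
Qed.

End Energy.

(** For each residue, let [b] be the least dominant box of [la] in the layer. Every such box of [la]
    in the layer equals [b] or is more dominant, while every box of [nu] equal to [b] or more
    dominant is in the layer; the inequality at [b] therefore compares the two counts. *)
Lemma dominates_layer p la nu d : part la -> part nu ->
  dominates p nu la -> layer la d <= layer nu d.
Proof.
move=> hla hnu /allP hd.
pose N mu (i : 'Z_p) := count (fun b => (residue p b == i) && (b.1 + n <= b.2 + d)) (boxes mu).
have LN mu : layer mu d = \sum_i N mu i.
  rewrite /layer; transitivity (\sum_(b <- boxes mu) \sum_i ((residue p b == i) && (b.1 + n <= b.2 + d))).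
    apply: eq_bigr => b _; rewrite (bigD1 (residue p b)) //= eqxx big1 ?addn0 //.
    by move=> i; rewrite eq_sym => /negbTE ->.
  rewrite exchange_big; apply: eq_bigr => i _ /=.
  by rewrite /N -sum1_count [RHS]big_mkcond; apply: eq_bigr => b _; case: (_ && _).
rewrite !LN; apply: leq_sum => i _.
pose L := [seq b <- boxes la | (residue p b == i) && (b.1 + n <= b.2 + d)].
have NL : N la i = size L by rewrite size_filter.
(* A numerical encoding of the dominance order: row minus column, shifted by 2n, and as tie-break
   row plus column, which is less than 2n + 1. Its maximum is attained at the least dominant box. *)
pose key (b : box) := (b.1 + n + n - b.2) * (2 * n).+1 + (b.1 + b.2).
have mL b : b \in L -> b \in boxes la /\ (residue p b == i) && (b.1 + n <= b.2 + d).
  by rewrite mem_filter => /andP[].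
case: (posnP (size L)) => [|sL]; first by rewrite NL => ->.
have [b0 b0L] : exists b0, b0 \in L by exists (nth (0,0) L 0); rewrite mem_nth.
pose s0 := SeqSub b0L.
pose m := [arg max_(s > s0) key (val s)].
have mmax b : b \in L -> key b <= key (val m).
  move=> bL; rewrite /m; case: arg_maxnP => // s _ hs.
  exact: (hs (SeqSub bL) isT).
set b := val m in mmax; have bL : b \in L := valP m.
have [bla /andP[/eqP bi bd]] := mL _ bL.
have H := hd _ bla; rewrite /count_dominant in H; apply: leq_trans (leq_trans _ H) _.
  rewrite NL -size_filter; apply: uniq_leq_size => [|x xL].
    by rewrite filter_uniq ?boxes_uniq.
  have [hx /andP[/eqP xi xd]] := mL _ xL; rewrite mem_filter hx andbT.
  rewrite xi bi eqxx /=; have := mmax _ xL.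
  have := box_row_bound hla hx; have := box_column_bound hla hx.
  have := box_row_bound hla bla; have := box_column_bound hla bla.
  rewrite /key /more_dominant; move: (x) (b) => [a a'] [c c'] /= hc' hc ha' ha hk.
  have uv : a + n + n - a' <= c + n + n - c'.
    rewrite leqNgt; apply/negP => lt.
    have := leq_mul2r (2 * n).+1 (c + n + n - c').+1 (a + n + n - a').
    rewrite lt orbT mulSn; lia.
  rewrite xpair_eqE; move: uv; rewrite leq_eqVlt => /orP[/eqP uv|]; last lia.
  by move: hk; rewrite uv leq_add2l; lia.
apply: sub_count => x /andP[xi]; rewrite -bi xi /= => hx.
case/orP: hx => [/eqP -> //|]; move: bd; rewrite /more_dominant.
by move: (b) x {xi} => [c c'] [a a'] /=; lia.
Qed.

Lemma minn_diag a b r c : a + c = b + r -> minn a b + (r - c) = a /\ minn a b + (c - r) = b.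
Proof. by case: leqP; case: (leqP r c); lia. Qed.

(** The boxes of a partition on one diagonal form an initial segment, in which a box is located by
    the smaller of its coordinates. So the lengths of the diagonals determine the shape. *)
Lemma diagonal_mem la r c : part la ->
  ((r, c) \in boxes la) = (minn r c < count (fun b => b.1 + c == b.2 + r) (boxes la)).
Proof.
move=> hla; pose rs := [seq minn b.1 b.2 | b <- boxes la & b.1 + c == b.2 + r].
have mr x : (x \in rs) = ((x + (r - c), x + (c - r)) \in boxes la).
  apply/mapP/idP => [[[a b]]|hx].
    by rewrite mem_filter => /andP[/eqP /minn_diag [/= e1 e2] hb] ->; rewrite e1 e2.
  exists (x + (r - c), x + (c - r)); rewrite ?mem_filter ?hx /= ?andbT.
    by apply/eqP; case: (leqP r c); lia.
  by case: (leqP r c); lia.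
have <- : size rs = count (fun b => b.1 + c == b.2 + r) (boxes la).
  by rewrite size_map size_filter.
rewrite -down_closed_mem.
- by rewrite mr; have [-> ->] := minn_diag (addnC r c).
- rewrite map_inj_in_uniq ?filter_uniq ?boxes_uniq // => -[a b] [a' b'].
  rewrite !mem_filter /= => /andP[/eqP /minn_diag [e1 e2] _] /andP[/eqP /minn_diag [e3 e4] _] E.
  by congr pair; [rewrite -e1 E | rewrite -e2 E].
move=> x x'; rewrite !mr !boxesP /= => hx xx.
have xx' : x' + (r - c) <= x + (r - c) by rewrite leq_add2r.
by have := partition_nth_leq hla xx'; lia.
Qed.

(** Dominance makes every layer of [nu] at least that of [la], and the inequality between the sums
    forces equality throughout. Successive differences of layers are the lengths of the
    diagonals. *)
Lemma dominates_csum_eq p la nu : part la -> part nu ->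
  dominates p nu la -> csum nu <= csum la -> nu = la.
Proof.
move=> hla hnu dom le.
have LE d : d < 2 * n -> layer la d = layer nu d.
  move=> hd; apply/eqP; move: le; rewrite !csum_layers //.
  rewrite (bigD1 (Ordinal hd)) //= [X in _ <= X](bigD1 (Ordinal hd)) //=.
  have l1 := dominates_layer d hla hnu dom; rewrite eqn_leq l1 /=.
  have : \sum_(i < 2 * n | i != Ordinal hd) layer la i <= \sum_(i < 2 * n | i != Ordinal hd) layer nu i.
    by apply: leq_sum => i _; apply: dominates_layer dom.
  move: (\sum_(i < _ | _) _) (\sum_(i < _ | _) _) => x y xy.
  by move=> e; rewrite -(leq_add2r x); apply: leq_trans e _; rewrite leq_add2l.
have DL mu d : layer mu d.+1 = layer mu d + count (fun b => b.1 + n == b.2 + d.+1) (boxes mu).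
  rewrite /layer -sum1_count [X in _ + X]big_mkcond -big_split; apply: eq_bigr => b _ /=.
  by case: eqP; lia.
have Lbig mu d : part mu -> (d = 0) \/ (2 * n <= d.+1) -> layer mu d = if d == 0 then 0 else n.
  move=> hmu hd; rewrite -[X in if _ then _ else X](size_boxes hmu) -sum1_size.
  transitivity (\sum_(b <- boxes mu) (if d == 0 then 0 else 1)); last by case: ifP; rewrite ?big1_eq.
  rewrite /layer !big_seq; apply: eq_bigr => b hb.
  have := box_row_bound hmu hb; have := box_column_bound hmu hb.
  move: (b.1) (b.2) => x y hy hx; case: hd => [->|hd] /=; first by rewrite leqNgt; lia.
  by case: eqP; lia.
have LA d : layer la d = layer nu d.
  have [/LE //|le'] := ltnP d (2 * n).
  by rewrite !Lbig //; right; lia.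
have C mu r c : part mu -> c < n -> count (fun b => b.1 + c == b.2 + r) (boxes mu) =
   layer mu (n + r - c) - layer mu (n + r - c).-1.
  move=> hmu cn; rewrite -(prednK (n := n + r - c)); last lia.
  rewrite DL addKn /=; apply: eq_in_count => b _.
  by rewrite prednK; lia.
apply: boxes_inj => // -[r c].
have [cn|cn] := ltnP c n; first by rewrite !diagonal_mem // !C // !LA.
by apply/idP/idP => /(fun hb => box_column_bound _ hb) H;
   [have := H hnu | have := H hla]; rewrite ltnNge cn.
Qed.

Variables (R : realType) (p : nat).
Hypotheses (p3 : 2 < p) (hp : h < p) (h0 : 0 < h).

Lemma residues_dominant_excluded la nu f : part la -> part nu ->
  strictly_dominates p nu la -> std_fun la f -> fres p f != fres p (f_init n nu).
Proof.
move=> hla hnu /andP[ne dom] sf; apply/eqP => E.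
have sn := std_f_init hnu.
have P j : pres p (fill_path h0 f) j = pres p (fill_path h0 (f_init n nu)) j.
  have /ffunP /(_ j) : path_res p (fill_path h0 f) = path_res p (fill_path h0 (f_init n nu)).
    by rewrite (fill_path_res p hla) // (fill_path_res p hnu).
  by rewrite !ffunE.
have := same_pres_linked R p3 hp (topmost_f_init hnu p3 hp) P.
rewrite (fill_path_weight R hla) // (fill_path_weight R hnu) //.
move/(strongly_linked_energy p3 hp); rewrite !weight_energy // lerD2l lerN2.
rewrite ler_pM2l // ler_nat => /(dominates_csum_eq hla hnu dom) E'.
by rewrite E' eqxx in ne.
Qed.

End ShapeEnergy.

Lemma ideal_gen_mono (A : pzRingType) (G G' : A -> Prop) x :
  (forall g, G g -> ideal_gen G' g) -> ideal_gen G x -> ideal_gen G' x.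
Proof.
move=> GG; elim=> [|a g b x' hg _ ih]; first exact: ideal_gen0.
by apply: ideal_gen_add ih; apply/ideal_gen_mulr/ideal_gen_mull/GG.
Qed.

(** * Contents of standard tableaux *)

Section Contents.
Variables (p n h : nat) (la : seq nat).
Hypotheses (hla : is_partition n h la).
Local Notation F := {ffun 'I_n -> box}.
Local Notation f_init := (f_init n la).
Implicit Types (f g : F) (k l : 'I_n) (r s : 'I_n.-1).

(** Adding [p * n] keeps column minus row nonnegative and does not change it modulo p. *)
Definition contents f : {ffun 'I_n -> nat} := [ffun k => (f k).2 + p * n - (f k).1].

Hypothesis p3 : 2 < p.

Lemma contents_box f k : std_fun la f -> contents f k + (f k).1 = (f k).2 + p * n.
Proof.
move=> sf; rewrite ffunE subnK //.
have := box_row_bound hla (std_fun_mem sf k) => hr.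
apply: leq_trans (leq_addl _ _); apply: leq_trans (ltnW hr) _.
by rewrite leq_pmull // ltnW // ltnW.
Qed.

Lemma cres_contents f : std_fun la f -> cres p (contents f) = fres p f.
Proof.
move=> sf; apply/ffunP => k; rewrite /cres /fres !ffunE /residue.
apply/eqP; rewrite eq_sym subr_eq; apply/eqP.
have := congr1 (fun m => m%:R : 'Z_p)%R (contents_box k sf).
rewrite ffunE !natrD natrM pchar_Zp ?(ltnW p3) // mul0r addr0 => <-.
by [].
Qed.

Lemma contents_fswap f r : contents (fswap r f) = fswap r (contents f).
Proof. by apply/ffunP => k; rewrite !ffunE. Qed.

Lemma std_fun_between f k l b : std_fun la f -> le_box (f k) b -> le_box b (f l) ->
  exists2 j : 'I_n, f j = b & k <= j <= l.
Proof.
move=> sf kb bl; have hb : b \in boxes la.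
  have := std_fun_mem sf l; rewrite !boxesP => lt.
  case/andP: bl => b1 b2; apply: leq_ltn_trans b2 _.
  exact: leq_trans lt (partition_nth_leq hla b1).
have [j E] := std_fun_surj sf hb; exists j => //.
by rewrite !(std_fun_le sf) ?E.
Qed.

(** A box between two comparable ones would carry an entry strictly between two consecutive numbers,
    so the two boxes are adjacent. *)
Lemma contents_consecutive f r : std_fun la f -> le_box (f (pos r)) (f (pos_succ r)) ->
  contents f (pos r) = (contents f (pos_succ r)).+1 \/
  contents f (pos_succ r) = (contents f (pos r)).+1.
Proof.
move=> sf le; have fi := std_fun_inj sf.
have mid b : le_box (f (pos r)) b -> le_box b (f (pos_succ r)) ->
    b = f (pos r) \/ b = f (pos_succ r).
  move=> h1 h2; have [j <- /andP[rj jr]] := std_fun_between sf h1 h2.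
  case: (ltngtP r j) rj => // [rj|rj] _; last by left; congr (f _); apply: val_inj.
  by right; congr (f _); apply: val_inj; apply/eqP; rewrite eqn_leq jr.
have ne : f (pos r) <> f (pos_succ r) by move/fi/(congr1 val) => /=; lia.
have := contents_box (pos r) sf; have := contents_box (pos_succ r) sf.
move: (contents f (pos r)) (contents f (pos_succ r)) => x y.
move: (f (pos r)) (f (pos_succ r)) le mid ne => [a b] [c d]; rewrite /le_box /= => /andP[ac bd] mid ne.
move=> hy hx; have [ac'|ca] := ltnP a c; have [bd'|db] := ltnP b d.
- have := mid (a, d); rewrite /= !leqnn (ltnW ac') (ltnW bd') => /(_ isT isT) [] []; lia.
- have := mid (a.+1, b); rewrite /= leqnn leqnSn bd ac' => /(_ isT isT) [] []; lia.
- have := mid (a, b.+1); rewrite /= leqnn leqnSn ac bd' => /(_ isT isT) [] []; lia.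
- by case: ne; congr pair; apply/eqP; rewrite eqn_leq ?ac ?bd.
Qed.

Lemma contents_eq_le f k l : std_fun la f -> contents f k = contents f l ->
  le_box (f k) (f l) \/ le_box (f l) (f k).
Proof.
move=> sf; have := contents_box k sf; have := contents_box l sf.
move: (contents f k) (contents f l) => x y.
by case: (f k) => a b; case: (f l) => c d; rewrite /le_box /=; lia.
Qed.

Lemma contents_neq f r : std_fun la f -> contents f (pos r) != contents f (pos_succ r).
Proof.
move=> sf; apply/eqP => E; case: (contents_eq_le sf E) => [le|/(std_fun_le sf)].
  by case: (contents_consecutive sf le); lia.
by rewrite /= ltnn.
Qed.

(** If two distinct boxes have the same content, both the lower and the right neighbour of the upper
    left one lie between them, but only one entry is available. *)
Lemma contents_neq2 f r s : std_fun la f -> s = r.+1 :> nat ->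
  contents f (pos r) != contents f (pos_succ s).
Proof.
move=> sf rs; apply/eqP => E; have fi := std_fun_inj sf.
have ne : f (pos r) <> f (pos_succ s) by move/fi/(congr1 val) => /=; lia.
case: (contents_eq_le sf E) => [le|/(std_fun_le sf)] /=; last by rewrite rs; lia.
have c1 := contents_box (pos r) sf; have c2 := contents_box (pos_succ s) sf.
have mid b : le_box (f (pos r)) b -> le_box b (f (pos_succ s)) ->
    b <> f (pos r) -> b <> f (pos_succ s) -> b = f (pos_succ r).
  move=> h1 h2; have [j <- /andP[rj jr]] := std_fun_between sf h1 h2 => n1 n2.
  congr (f _); apply: val_inj => /=; move: rj jr; rewrite /= rs => rj jr.
  have j1 : j <> r :> nat by move=> e; apply: n1; congr (f _); apply: val_inj.
  have j2 : j <> r.+2 :> nat by move=> e; apply: n2; congr (f _); apply: val_inj; rewrite /= rs.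
  lia.
rewrite E in c1; move: c1 c2 ne le mid.
move: (contents _ _) (f (pos r)) (f (pos_succ s)) (f (pos_succ r)) => x [a b] [c d] [a' b'].
rewrite /le_box /= => c1 c2 ne /andP[ac bd] mid.
have ac' : a < c by rewrite ltnNge; apply/negP => ca; apply: ne; congr pair; lia.
have h1 : (a.+1, b) = (a', b') by apply: mid => /=; try case; lia.
have h2 : (a, b.+1) = (a', b') by apply: mid => /=; try case; lia.
by case: h1 h2 => <- <- [] /=; lia.
Qed.

Lemma std_fun_first f k : std_fun la f -> k = 0 :> nat -> f k = (0, 0).
Proof.
move=> sf k0; have [j E] : exists j, f j = (0, 0).
  apply: (std_fun_surj sf); have := std_fun_mem sf k; rewrite !boxesP /= => lt.
  apply: leq_trans (partition_nth_leq hla (leq0n (f k).1)).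
  exact: leq_ltn_trans lt.
have : j <= k by apply: (std_fun_le sf); rewrite E.
rewrite k0 leqn0 => /eqP j0; rewrite -E; congr (f _); apply: val_inj.
by rewrite /= k0 j0.
Qed.

Definition content_seqs := [seq contents (tab_fun n u) | u <- std la].

Lemma content_seqsP t : reflect (exists2 f, std_fun la f & t = contents f) (t \in content_seqs).
Proof.
apply: (iffP mapP) => [[u hs ->]|[f sf ->]].
  by exists (tab_fun n u) => //; exact: (std_tab_fun hla hs).
by have [u hu <-] := std_fun_tab sf; exists u.
Qed.

Hypotheses (hp : h < p).

(** As long as the entries fill the first row, the next one is in the next box of that row or in (1,
    0). The latter has residue -1, which differs from the prescribed residue k because 0 < k + 1 <
    p. *)
Lemma killed_first_row f : std_fun la f -> killed_idem h (fres p f) ->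
  forall k, k < h -> f k = (0, nat_of_ord k).
Proof.
move=> sf [hn kill].
have val_res k : k <= h -> fres p f k = (nat_of_ord k)%:R%R.
  have [m km] : exists m, k = m :> nat by exists k.
  elim: m k km => [|m ih] k km kh.
    by rewrite ffunE (std_fun_first sf km) /residue subrr km.
  have mn : m < n by have := ltn_ord k; rewrite km; exact: ltnW.
  rewrite (kill (Ordinal mn) k) // ih //=; last by rewrite -ltnS -km leqW.
  by rewrite km -natr1.
move=> k; have [m km] : exists m, k <= m by exists (nat_of_ord k).
elim: m k km => [|m ih] k km kh.
  by move: km; rewrite leqn0 => /eqP k0; rewrite (std_fun_first sf k0) k0.
have before (j : 'I_n) : j < k -> f j = (0, nat_of_ord j).
  by move=> jk; apply: ih; [rewrite -ltnS; exact: leq_trans jk km | apply: ltn_trans kh].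
have last b (j : 'I_n) : f j = b -> j <= k -> (forall i, i < k -> (0, i) <> b) -> f k = b.
  move=> E; rewrite leq_eqVlt => /orP[/eqP /val_inj <- //|jk] H.
  by case: (H j jk); rewrite -E before.
have hb := std_fun_mem sf k; rewrite boxesP in hb.
case E: (f k) => [a b]; rewrite E /= in hb.
case: a => [|a] in E hb *.
  have bk : k <= b.
    rewrite leqNgt; apply/negP => lt; have bn : b < n by apply: ltn_trans lt _.
    have := before (Ordinal bn) lt; rewrite -E => /(std_fun_inj sf) /(congr1 val) /= bk.
    by rewrite bk ltnn in lt.
  have [|j Ej] := std_fun_surj sf (b := (0, nat_of_ord k)).
    by rewrite boxesP /=; apply: leq_ltn_trans hb.
  rewrite -E; apply: (last _ j) => // [|i ik []]; last by move=> e; rewrite e ltnn in ik.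
  by apply: (std_fun_le sf); rewrite E Ej.
have [|j Ej] := std_fun_surj sf (b := (1, 0)).
  rewrite boxesP /=; apply: leq_trans (partition_nth_leq hla (ltn0Sn a)).
  exact: leq_ltn_trans hb.
have fk : f k = (1, 0).
  apply: (last _ j) => //; by apply: (std_fun_le sf); rewrite E Ej.
have := val_res k (ltnW kh); rewrite ffunE fk /residue /= sub0r => /esym /eqP.
rewrite -addr_eq0 natr1 -[X in X == _]/((k.+1%:Z)%:~R)%R (small_Zp p3) //.
exact: leq_trans hp.
Qed.

Lemma after_first_row f k : std_fun la f -> (forall j : 'I_n, j < h -> f j = (0, nat_of_ord j)) ->
  k = h :> nat -> f k = (1, 0).
Proof.
move=> sf row kh; case E: (f k) => [a b].
have hb := std_fun_mem sf k; rewrite boxesP E /= in hb.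
have bh : b < h := leq_trans hb (partition_nth_h hla a).
case: a => [|a] in E hb *.
  have bn : b < n by apply: ltn_trans bh _; rewrite -kh.
  have := row (Ordinal bn) bh; rewrite -E => /(std_fun_inj sf) /(congr1 val) /= bk.
  by move: bh; rewrite bk kh ltnn.
have [|j Ej] := std_fun_surj sf (b := (1, 0)).
  rewrite boxesP /=; apply: leq_trans (partition_nth_leq hla (ltn0Sn a)).
  exact: leq_ltn_trans hb.
have : j <= k by apply: (std_fun_le sf); rewrite E Ej.
rewrite leq_eqVlt => /orP[/eqP /val_inj jk|]; first by rewrite -E -jk.
by rewrite kh => /row; rewrite Ej.
Qed.

(** A killed residue sequence fixes the first h + 1 boxes: a full first row, then (1, 0). The row
    reading begins with the same boxes. So if the sequence of the dominant tableau is not killed,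
    that of no standard tableau of the same shape is. *)
Lemma killed_f_init f : std_fun la f -> killed_idem h (fres p f) ->
  killed_idem h (fres p f_init).
Proof.
move=> sf kf; have [hn kill] := kf; have row := killed_first_row sf kf.
have row0 (k : 'I_n) : k < h -> f_init k = (0, nat_of_ord k).
  move=> kh; have hpos : 0 < h := leq_ltn_trans (leq0n _) kh.
  have h1n : h.-1 < n by apply: leq_ltn_trans (leq_pred h) hn.
  have := std_fun_mem sf (Ordinal h1n); rewrite row /=; last by rewrite prednK.
  rewrite boxesP ffunE /boxes /=; case: (la) => [|x l] //= hx.
  have kx : k < x by apply: leq_trans kh _; rewrite -(prednK hpos).
  by rewrite nth_cat size_map size_iota kx (nth_map 0) ?size_iota // nth_iota.
split=> // k l lk lh.
have E (j : 'I_n) : j <= h -> fres p f_init j = fres p f j.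
  have resE g : fres p g j = residue p (g j) by rewrite ffunE.
  rewrite !resE leq_eqVlt => /orP[/eqP jh|jh]; last by rewrite row ?row0.
  by rewrite (after_first_row sf row jh) (after_first_row (std_f_init hla) row0 jh).
have kh : k < h by rewrite -lk.
by rewrite (E l lh) (E k (ltnW kh)); apply: kill.
Qed.

End Contents.

(** * The idempotent of [t^mu] modulo the lower cells *)

Section DominantIdempotent.
Variables (kk : fieldType) (p n h : nat).
Hypotheses (p3 : 2 < p) (hp : h < p) (h0 : 0 < h).
Variables (R : realType) (mu : seq nat) (rex : tableau -> seq 'I_n.-1).
Hypothesis hmu : is_partition n h mu.
Local Notation res0 := (tab_res p n (dom_tab mu)).
Local Notation nonres := (fun j => forall t, t \in content_seqs p n mu -> cres p t <> j).

Lemma tab_res_dom la : is_partition n h la -> tab_res p n (dom_tab la) = fres p (f_init n la).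
Proof. by move=> hla; rewrite tab_resE (dom_tabE hla). Qed.

(** All of [cell_lower] lies in the ideal of the idempotents that are not attached to standard
    tableaux of shape [mu]: those generating the kernel onto Q by [killed_f_init], and a cell of
    shape [nu] because it contains the idempotent of [t^nu] as a factor. *)
Lemma idempotent_lower : ~ killed_idem h res0 -> ~ cell_lower h rex mu (e_ kk res0).
Proof.
move=> nk; rewrite tab_res_dom // in nk *.
have E0 := cres_contents hmu p3 (std_f_init hmu).
(* The value [p * n] is the shifted content of the box (0, 0), the first box of every standard
   tableau. *)
move=> low; apply: (@idempotent_survives kk p n p3 (content_seqs p n mu) _ _ _ (p * n) _ _ (contents p (f_init n mu)) _).
- move=> t r /(content_seqsP p hmu) [f sf ->] n1 n2.
  apply/(content_seqsP p hmu); exists (fswap r f); last by rewrite contents_fswap.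
  apply: (fswap_std sf); apply/negP => /(contents_consecutive hmu p3 sf) [] E.
    by rewrite E eqxx in n1.
  by rewrite E eqxx in n2.
- by move=> t r /(content_seqsP p hmu) [f sf ->]; apply: (contents_neq hmu).
- by move=> t r s /(content_seqsP p hmu) [f sf ->]; apply: (contents_neq2 hmu).
- by rewrite natrM pchar_Zp ?mul0r // ltnW.
- move=> t r /(content_seqsP p hmu) [f sf ->] r0.
  by rewrite ffunE (std_fun_first hmu sf r0) subn0.
- by apply/(content_seqsP p hmu); exists (f_init n mu); rewrite //; apply: std_f_init hmu.
rewrite E0; elim: low => [|c b x hb _ ih]; first exact: ideal_gen0.
apply: ideal_gen_add ih.
have scale (z : qH kk p n) : ideal_gen (fun x : qH kk p n => exists2 j, nonres j & x = e_ kk j) z ->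
    ideal_gen (fun x : qH kk p n => exists2 j, nonres j & x = e_ kk j) (c *: z)%R.
  move=> hz; have -> : (c *: z = ((c *: (1 : qH kk p n)) : qH kk p n) * z)%R.
    exact: (etrans (f_equal (fun w => c *: w)%R (esym (mul1r z))) (qHZl c 1%R z)).
  exact: ideal_gen_mull.
apply: scale.
have gen j : nonres j -> ideal_gen (fun x : qH kk p n => exists2 j, nonres j & x = e_ kk j) (e_ kk j).
  move=> hj; have := ideal_genD (G := fun x : qH kk p n => exists2 j, nonres j & x = e_ kk j) 1%R 1%R (ex_intro2 _ _ j hj erefl) (ideal_gen0 _).
  have -> : (1 * e_ kk j * 1 + 0 = e_ kk j)%R.
    exact: (etrans (addr0 _) (etrans (mulr1 _) (mul1r _))).
  by [].
case: hb => [ker|[nu [s [t [hnu dom hs ht ->]]]]].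
  apply: ideal_gen_mono ker => _ [i ki ->]; apply: gen => t /(content_seqsP p hmu) [f sf ->] E.
  apply: nk; apply: (killed_f_init hmu p3 hp sf).
  by rewrite -(cres_contents hmu p3 sf) E.
apply: ideal_gen_mulr; apply: ideal_gen_mull; apply: gen => u /(content_seqsP p hmu) [f sf ->] E.
have := residues_dominant_excluded R p3 hp h0 hmu hnu dom sf.
by rewrite -(cres_contents hmu p3 sf) E tab_res_dom // eqxx.
Qed.

End DominantIdempotent.

Local Open Scope ring_scope.

(** * Cell modules and decomposition numbers *)

Lemma free_alg_ind (kk : fieldType) (X : choiceType) (P : free_alg kk X -> Prop) :
  P 0 -> (forall c u v, P u -> P v -> P (c *: u + v)) -> P 1 ->
  (forall x u, P u -> P (free_var kk x * u)) -> forall u, P u.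
Proof.
move=> P0 PP P1 PX u.
have PU m : P (<< m >> : {malg kk[{fmonom X}]}).
  case: m => w; elim: w => [|x w ih].
    by have : P 1 := P1; rewrite (_ : 1 = << fmone X >> :> {malg kk[{fmonom X}]}) // fmoneE.
  have := PX x _ ih.
  rewrite (_ : _ * _ = << FMonom (x :: w) >> :> {malg kk[{fmonom X}]}) //.
  by apply: etrans (fgmulUU _ _ _ _) _; rewrite mulr1 /mmul /= fmmulE fmuE.
rewrite [u]monalgE; elim: (finmap.enum_fset _) => [|m s ih]; first by rewrite big_nil.
rewrite big_cons (_ : << _ *g m >> = (u : {malg kk[{fmonom X}]})@_m *: << m >>).
  exact: PP.
by apply/malgP => m'; rewrite mcoeffZ !mcoeffU mulrnAr mulr1.
Qed.

Lemma scale_combine (kk : fieldType) (V : lmodType kk) (c c' : kk) (b x v : V) :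
  c *: (c' *: b + x) + v = (c * c') *: b + (c *: x + v).
Proof. by rewrite scalerDr scalerA addrA. Qed.

Lemma submod_preim (kk : fieldType) (V W : lmodType kk) (f : V -> W) (L : W -> Prop) :
  linear f -> is_submod L -> is_submod (fun u => L (f u)).
Proof.
move=> lf [L0 LP]; split=> [|c u v hu hv]; last by rewrite lf; apply: LP.
have := lf 1 0 0; rewrite !scale1r addr0 => E.
by rewrite (_ : f 0 = 0) //; apply: (addrI (f 0)); rewrite -E addr0.
Qed.

(** * Homogeneous spanning elements and the kernel onto Q *)

Section QuiverHeckeSpan.
Variables (kk : fieldType) (p n : nat).
Local Notation H := (qH kk p n).
Local Notation e := (@e_ kk p n).
Local Notation psi := (@psi_ kk p n).
Implicit Types (B L : H -> Prop) (u v a : H).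

Lemma mull_linear a : linear (fun u : H => a * u).
Proof.
move=> c u v.
exact: (etrans (mulrDr a _ v) (f_equal (fun w => w + a * v) (esym (qHZr c a u)))).
Qed.

Lemma mulr_linear a : linear (fun u : H => u * a).
Proof.
move=> c u v.
exact: (etrans (mulrDl _ v a) (f_equal (fun w => w + v * a) (esym (qHZl c u a)))).
Qed.

Lemma star_linear : linear (@star kk p n).
Proof.
move=> c u v; exact: (etrans (starD _ v) (f_equal (fun w => w + star v) (starZ c u))).
Qed.

Lemma lin_span_base B b : B b -> lin_span B b.
Proof.
move=> hb; have E : 1 *: b + 0 = b := etrans (addr0 _) (scale1r _).
by have := lin_spanD 1 hb (lin_span0 B); rewrite E.
Qed.

Lemma lin_span_submod B : is_submod (lin_span B).
Proof.
split=> [|c u v hu hv]; first exact: lin_span0.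
elim: hu => [|c' b x hb _ ih].
  have E : c *: 0 + v = v := etrans (f_equal (fun w => w + v) (scaler0 _ c)) (add0r v).
  by rewrite E.
have E := scale_combine c c' b x v; rewrite E; exact: lin_spanD.
Qed.

Lemma lin_span_sub B L : is_submod L -> (forall b, B b -> L b) ->
  forall u, lin_span B u -> L u.
Proof.
by move=> [L0 LP] BL u; elim=> [//|c b x /BL hb _ ih]; apply: LP.
Qed.

Definition homog_elt u := exists d, homogeneous d u.

(** The idempotents sum to 1, which cuts each [psi_r] into homogeneous pieces. *)
Lemma homog_span u : lin_span homog_elt u.
Proof.
have S := lin_span_submod homog_elt.
have M a v : lin_span homog_elt a -> lin_span homog_elt v -> lin_span homog_elt (a * v).
  move=> ha hv; move: a ha; apply: lin_span_sub; first exact: (submod_preim (mulr_linear v) S).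
  move=> a [d hd]; move: v hv; apply: lin_span_sub; first exact: (submod_preim (mull_linear a) S).
  by move=> v [d' hd']; apply: lin_span_base; exists (d + d'); apply: homog_mul.
have he i : lin_span homog_elt (e i).
  by apply: lin_span_base; exists 0; apply: homog_e.
have h1 : lin_span homog_elt 1.
  rewrite -(qH_sum_e kk p n); apply: submod_sum S _ => i _; exact: he.
have hg (g : generator p n) : lin_span homog_elt (piH (free_var kk g)).
  case: g => [[i|r]|r]; first exact: he.
    by apply: lin_span_base; exists 2; apply: homog_y.
  have E : psi r = \sum_i psi r * e i.
    exact: (etrans (esym (mulr1 _)) (etrans (f_equal (fun w => psi r * w) (esym (qH_sum_e kk p n))) (mulr_sumr _ _ _ _))).
  change (lin_span homog_elt (psi r)); rewrite E; apply: submod_sum S _ => i _.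
  by apply: lin_span_base; exists (psi_deg r i); apply: homog_psi.
have [x <-] := piHK u.
elim/free_alg_ind: x => [|c x z hx hz||g x hx].
- by rewrite piH0; apply: lin_span0.
- by rewrite piHD piHZ; case: S => _; apply.
- by rewrite piH1.
- by rewrite piHM; apply: M.
Qed.

Section KernelQ.
Variable h : nat.
Local Notation ker := (@ker_Q kk p n h).

Lemma ideal_submod (G : H -> Prop) : is_submod (ideal_gen G).
Proof.
split=> [|c u v hu hv]; first exact: ideal_gen0.
apply: ideal_gen_add hv.
have E : c *: u = (c *: (1 : H) : H) * u.
  exact: (etrans (f_equal (fun w => c *: w) (esym (mul1r u))) (qHZl c 1 u)).
by rewrite E; apply: ideal_gen_mull.
Qed.

Lemma ker_base i a b : killed_idem h i -> ker (a * e i * b).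
Proof.
move=> ki; have G : exists2 j, killed_idem h j & e i = e j by exists i.
have := ideal_genD (G := fun x => exists2 j, killed_idem h j & x = e j) a b G (ideal_gen0 _).
by have E := addr0 (a * e i * b); rewrite E.
Qed.

Lemma ker_star u : ker u -> ker (star u).
Proof.
elim=> [|a g b x [i ki ->] _ ih]; first by rewrite star_0; apply: ideal_gen0.
have E0 : star (a * e i) = star (e i) * star a by exact: starM.
have E1 : star (e i) = e i by exact: star_e.
have E2 : star (a * e i) = e i * star a := etrans E0 (f_equal (fun w => w * star a) E1).
have E3 : star (a * e i * b) = star b * star (a * e i) by exact: starM.
have E4 : star b * (e i * star a) = star b * e i * star a by exact: mulrA.
have E5 : star (a * e i * b) = star b * e i * star a :=
  etrans E3 (etrans (f_equal (fun w => star b * w) E2) E4).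
have E6 : star (a * e i * b + x) = star (a * e i * b) + star x by exact: starD.
have E : star (a * e i * b + x) = star b * e i * star a + star x :=
  etrans E6 (f_equal (fun w => w + star x) E5).
rewrite E; apply: ideal_gen_add ih; exact: ker_base.
Qed.

(** The generating idempotents have degree 0, and by [homog_span] the factors on either side of them
    may be taken homogeneous. *)
Lemma ker_proj d u : ker u -> ker (proj d u).
Proof.
have lp := @projP kk p n d.
have S := submod_preim lp (ideal_submod (fun x => exists2 i, killed_idem h i & x = e i)).
elim=> [|a g b x [i ki ->] _ ih]; first by case: S.
refine (submodD (u := a * e i * b) (v := x) S _ ih).
have sub1 := submod_preim (mulr_linear (e i)) (submod_preim (mulr_linear b) S).
move: a {ih} (homog_span a); apply: (lin_span_sub sub1) => a [da ha] /=.
have sub2 := submod_preim (mull_linear (a * e i)) S.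
clear sub1; move: b (homog_span b); apply: (lin_span_sub sub2) => b [db hb] /=.
have h1 : homogeneous (da + 0) (a * e i) by apply: homog_mul ha _; apply: homog_e.
have hh : homogeneous (da + 0 + db) (a * e i * b) by apply: homog_mul h1 hb.
rewrite (proj_homogeneous d hh); case: ifP => _; last exact: ideal_gen0.
exact: ker_base.
Qed.

End KernelQ.
End QuiverHeckeSpan.

Lemma sub_scale (kk : fieldType) (V : lmodType kk) b (x z : V) :
  x - b *: z = (- b) *: z + x.
Proof. by rewrite addrC scaleNr. Qed.

Lemma antimorph_prod (A : pzRingType) (I : Type) (f : A -> A) (g : I -> A) w :
  f 1 = 1 -> (forall u v, f (u * v) = f v * f u) -> (forall i, f (g i) = g i) ->
  f (\prod_(i <- w) g i) = \prod_(i <- rev w) g i.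
Proof.
move=> f1 fM fg; elim: w => [|i w ih]; first by rewrite /rev !big_nil.
by rewrite big_cons fM ih fg rev_cons -cats1 big_cat big_seq1.
Qed.

Section KlrWords.
Variables (p n : nat) (A : pzRingType).
Variables (e : res_seq p n -> A) (y : 'I_n -> A) (psi : 'I_n.-1 -> A).
Hypothesis K : klr e y psi.

Lemma klr_word_step r i x : e i * x = x ->
  psi r * x = psi r * e i * x /\ e (swap_res r i) * (psi r * x) = psi r * x.
Proof.
move=> ex; have E : psi r * x = psi r * e i * x by rewrite -mulrA ex.
by split=> //; rewrite mulrA -(klr_psie K).
Qed.

Lemma klr_cell_split i a b : a * e i * b = (a * e i) * (e i * b).
Proof. by rewrite -mulrA [in RHS]mulrA -[a * e i * e i]mulrA (klr_eE K) mulrA. Qed.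

Lemma klr_weight i j x : e i * x = x -> e j * x = if j == i then x else 0.
Proof. by move=> ex; rewrite -ex mulrA (klr_eM K); case: eqP => [->|]; rewrite ?mul0r ?ex. Qed.

Lemma weight_mulr i (x b : A) : e i * x = x -> e i * (x * b) = x * b.
Proof. by move=> ex; rewrite mulrA ex. Qed.

Lemma klr_unit_word i : 1 * e i * 1 = e i.
Proof. by rewrite mulr1 mul1r. Qed.

End KlrWords.

(** * Residues and degrees of the cellular elements *)

Section Cells.
Variables (kk : fieldType) (p n h : nat) (rex : tableau -> seq 'I_n.-1).
Hypotheses (p3 : (2 < p)%N) (hp : (h < p)%N) (h0 : (0 < h)%N).
Hypothesis hrex : valid_red n h rex.
Local Notation H := (qH kk p n).
Local Notation e := (@e_ kk p n).
Local Notation psi := (@psi_ kk p n).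
Local Notation K := (klr_qH kk p n).
Local Notation part := (is_partition n h).
Local Notation res0 la := (tab_res p n (dom_tab la)).
Local Notation cell := (psi_cell kk p rex).
Local Notation lower := (@cell_lower kk p n h rex).

Definition wordX la (w : seq 'I_n.-1) : H := \prod_(r <- w) psi r * e (fres p (f_init n la)).

Definition fill_degree (f : {ffun 'I_n -> box}) : int := \sum_j hop p (fill_path h0 f) j.

(** Along a reduced word each letter adds [psi_deg] to the degree of the product and, by
    [hop_fswap], the same amount to the degree of the path; both start at 0. *)
Lemma word_homogeneous la w : part la -> std_fun la (wfun w (f_init n la)) ->
  (size w <= inversions (wfun w (f_init n la)))%N ->
  homogeneous (fill_degree (wfun w (f_init n la))) (wordX la w) /\
  e (fres p (wfun w (f_init n la))) * wordX la w = wordX la w.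
Proof.
move=> hla; move: w; apply: (reduced_ind hla).
  have E : wordX la [::] = e (fres p (f_init n la)).
    by rewrite /wordX big_nil; exact: mul1r.
  rewrite E /= (_ : fill_degree _ = 0); last by rewrite /fill_degree big1 // => j _; apply: hop_f_init.
  split; [exact: homog_e | exact: klr_eE K _].
move=> r w; set g := wfun w _; rewrite /= -/g => sg sg' col [hg eg].
have E : wordX la (r :: w) = psi r * wordX la w.
  by rewrite /wordX big_cons; exact: (esym (mulrA _ _ _)).
have [E1 E2] := klr_word_step K r eg; split; last first.
  have -> : fres p (fswap r g) = swap_res r (fres p g).
    by apply/ffunP => k; rewrite !ffunE.
  by rewrite E; exact: E2.
have D : fill_degree (fswap r g) = psi_deg r (fres p g) + fill_degree g.
  rewrite /fill_degree fill_path_fswap -(fill_path_res p hla h0 sg).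
  by apply: (hop_fswap p3 hp); rewrite !(fill_pathE hla).
rewrite D E E1; apply: homog_mul hg; exact: homog_psi.
Qed.

Section Shape.
Variable la : seq nat.
Hypothesis hla : part la.
Local Notation cellX s := (psi_tab kk p rex s * e (res0 la)).

Lemma cellX_homogeneous s : s \in std la ->
  homogeneous (fill_degree (tab_fun n s)) (cellX s) /\
  e (fres p (tab_fun n s)) * cellX s = cellX s.
Proof.
move=> hs; have [E sz] := reduced_exprE hla hs (hrex hla hs).
rewrite (tab_res_dom p hla) -E; apply: word_homogeneous => //; rewrite E //.
exact: (std_tab_fun hla hs).
Qed.

Lemma star_mulE (u v u' v' : H) : star u = u' -> star v = v' -> star (u * v) = v' * u'.
Proof. by move=> <- <-; exact: starM. Qed.

Lemma star_psi_tab s : star (psi_tab kk p rex s) = psi_tab_star kk p rex s.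
Proof. exact: antimorph_prod (@star_1 kk p n) (@starM kk p n) (@star_psi kk p n). Qed.

Lemma star_psi_tab_star s : star (psi_tab_star kk p rex s) = psi_tab kk p rex s.
Proof.
rewrite /psi_tab -[in RHS](revK (rex s)).
exact: antimorph_prod (@star_1 kk p n) (@starM kk p n) (@star_psi kk p n).
Qed.

Lemma star_cellX s : star (cellX s) = e (res0 la) * psi_tab_star kk p rex s.
Proof. exact: (star_mulE (star_psi_tab s) (star_e kk (res0 la))). Qed.

Lemma cellE s t : cell la s t = cellX s * star (cellX t).
Proof. by rewrite star_cellX; exact: (klr_cell_split K). Qed.

Lemma star_cell s t : cell la s t = star (cell la t s).
Proof.
have E : star (cell la t s) = psi_tab kk p rex s * (e (res0 la) * psi_tab_star kk p rex t).
  exact: (star_mulE (star_cellX t) (star_psi_tab_star s)).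
by rewrite E; exact: (esym (mulrA _ _ _)).
Qed.

Lemma cell_homogeneous s t : s \in std la -> t \in std la ->
  homogeneous (fill_degree (tab_fun n s) + fill_degree (tab_fun n t)) (cell la s t).
Proof.
move=> hs ht; rewrite cellE.
have [h1 _] := cellX_homogeneous hs; have [h2 _] := cellX_homogeneous ht.
exact: homog_mul h1 (homogeneous_star h2).
Qed.

Lemma cell_weight s t i : s \in std la ->
  e i * cell la s t = if i == fres p (tab_fun n s) then cell la s t else 0.
Proof.
move=> hs; have [_ E] := cellX_homogeneous hs; apply: (klr_weight K).
rewrite cellE; exact: weight_mulr E.
Qed.

Lemma rex_dom_tab : rex (dom_tab la) = [::].
Proof.
apply: (dom_tab_word hla); apply: (hrex hla).
by rewrite (dom_tabE hla); exact: (boxes_std hla).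
Qed.

Lemma cell_dom : cell la (dom_tab la) (dom_tab la) = e (res0 la).
Proof.
rewrite /psi_cell /psi_tab /psi_tab_star rex_dom_tab /rev /= !big_nil; exact: klr_unit_word.
Qed.

Lemma dom_tab_std : dom_tab la \in std la.
Proof. by rewrite (dom_tabE hla); exact: (boxes_std hla). Qed.

Lemma fill_degree_dom : fill_degree (tab_fun n (dom_tab la)) = 0.
Proof.
rewrite (dom_tabE hla); rewrite /fill_degree big1 // => j _; apply: hop_f_init => //.
Qed.

End Shape.

Section Lower.
Variable mu : seq nat.
Hypothesis hmu : part mu.
Local Notation L := (lower mu).

Lemma lower_submod : is_submod L. Proof. exact: lin_span_submod. Qed.

Lemma ker_lower u : ker_Q h u -> L u.
Proof. by move=> ku; apply: lin_span_base; left. Qed.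

Lemma lower_stable (f : H -> H) : linear f -> (forall u, ker_Q h u -> ker_Q h (f u)) ->
  (forall nu s t, part nu -> strictly_dominates p nu mu -> s \in std nu -> t \in std nu ->
    L (f (cell nu s t))) ->
  forall u, L u -> L (f u).
Proof.
move=> lf kf cf; apply: lin_span_sub; first exact: submod_preim lf lower_submod.
move=> b [kb|[nu [s [t [hnu dom hs ht ->]]]]]; last exact: cf.
by apply/ker_lower/kf.
Qed.

Lemma lower_cell nu s t : part nu -> strictly_dominates p nu mu -> s \in std nu ->
  t \in std nu -> L (cell nu s t).
Proof. by move=> *; apply: lin_span_base; right; exists nu, s, t. Qed.

Lemma lower_weight i u : L u -> L (e i * u).
Proof.
move: u; apply: lower_stable; first exact: mull_linear.
  by move=> u; apply: ideal_gen_mull.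
move=> nu s t hnu dom hs ht; rewrite cell_weight //.
by case: ifP => _; [apply: lower_cell | apply: lin_span0].
Qed.

Lemma lower_star u : L u -> L (star u).
Proof.
move: u; apply: lower_stable; first exact: star_linear.
  by move=> u; apply: ker_star.
by move=> nu s t hnu dom hs ht; rewrite -star_cell //; apply: lower_cell.
Qed.

Lemma lower_proj d u : L u -> L (proj d u).
Proof.
move: u; apply: lower_stable; first exact: projP.
  by move=> u; apply: ker_proj.
move=> nu s t hnu dom hs ht; rewrite (proj_homogeneous d (cell_homogeneous hnu hs ht)).
by case: ifP => _; [apply: lower_cell | apply: lin_span0].
Qed.

(** With the other three tableaux equal to [t^mu], the congruence of the form says that the cell
    element of (t^mu, s), multiplied by e on the right, is [B s t] times e, where t is [t^mu]. The
    anti-involution turns it into a statement on e times the cell element of (s, t^mu), and on a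
    combination in the radical the scalars add up to 0. *)
Lemma radical_weight u : cell_radical h rex mu u -> L (e (res0 mu) * u).
Proof.
case=> B [a [hB hu hb]]; have t0 := dom_tab_std hmu.
apply: (rad_killed (w := fun s => cell mu s (dom_tab mu)) (ts := std mu)
  (e0 := e (res0 mu)) lower_submod (mull_linear _) (@lower_weight _) _ hu (hb _ t0)) => s hs.
have := lower_star (hB _ _ _ _ hs t0 t0 t0).
rewrite cell_dom //.
set b := B s _; set c := cell mu _ s; set e0 := e _.
have S (x z : H) : x - b *: z = (- b) *: z + x by exact: sub_scale.
have E1 : star ((- b) *: e0 + c * e0) = (- b) *: star e0 + star (c * e0) by exact: star_linear.
have E2 : star e0 = e0 by exact: star_e.
have E4 : star c = cell mu s (dom_tab mu) by exact: (esym (star_cell _ _ _)).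
have E3 : star (c * e0) = e0 * cell mu s (dom_tab mu) by exact: (star_mulE E4 E2).
have E5 : (- b) *: star e0 + star (c * e0) = (- b) *: e0 + e0 * cell mu s (dom_tab mu).
  exact: (f_equal2 (fun v w => (- b) *: v + w) E2 E3).
have E6 : star (c * e0 - b *: e0) = e0 * cell mu s (dom_tab mu) - b *: e0.
  exact: (etrans (f_equal _ (S _ _)) (etrans E1 (etrans E5 (esym (S _ _))))).
by rewrite E6.
Qed.

End Lower.
End Cells.

Section Expansion.
Variables (kk : fieldType) (V : lmodType kk) (L : V -> Prop) (hL : is_submod L).
Variables (G : V -> V) (m : nat) (w : 'I_m -> V).
Hypothesis lG : linear G.

Lemma expansion_submod :
  is_submod (fun x => exists c : 'I_m -> kk, L (G x - \sum_i c i *: w i)).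
Proof.
split=> [|a u v [c hc] [d hd]].
  have [L0 _] := submod_preim lG hL.
  by exists (fun=> 0); rewrite big1 ?subr0 // => i _; rewrite scale0r.
exists (fun i => a * c i + d i); rewrite lG.
have -> : \sum_i (a * c i + d i) *: w i = a *: \sum_i c i *: w i + \sum_i d i *: w i.
  rewrite scaler_sumr -big_split; apply: eq_bigr => i _ /=.
  by rewrite scalerDl scalerA.
rewrite opprD addrACA -scalerBr; case: hL => _; exact.
Qed.

Lemma expansion_lower x : L (G x) -> exists c : 'I_m -> kk, L (G x - \sum_i c i *: w i).
Proof.
by move=> h; exists (fun=> 0); rewrite big1 ?subr0 // => i _; rewrite scale0r.
Qed.

Lemma expansion_basis x i : G x = w i -> exists c : 'I_m -> kk, L (G x - \sum_i c i *: w i).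
Proof.
move=> ->; exists (fun j => (j == i)%:R).
rewrite (bigD1 i) //= eqxx scale1r big1 ?addr0 ?subrr; first by case: hL.
by move=> j /negbTE ->; rewrite scale0r.
Qed.

End Expansion.

(** * Composition factors and matching tableaux *)

Section Multiplicity.
Variables (kk : fieldType) (p n h : nat) (rex : tableau -> seq 'I_n.-1) (R : realType).
Hypotheses (p3 : (2 < p)%N) (hp : (h < p)%N) (h0 : (0 < h)%N).
Hypothesis hrex : valid_red n h rex.
Variables (la mu : seq nat).
Hypotheses (hla : is_partition n h la) (hmu : is_partition n h mu).
Local Notation H := (qH kk p n).
Local Notation e0 := (e_ kk (tab_res p n (dom_tab mu))).
Local Notation cell := (psi_cell kk p rex).
Local Notation lower := (@cell_lower kk p n h rex).
Local Notation upper := (@cell_upper kk p n h rex).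
Local Notation radical := (@cell_radical kk p n h rex).
Local Notation t0 := (dom_tab mu).

Lemma graded_submodule_submod (X : H -> Prop) : graded_submodule X -> is_submod X.
Proof.
case=> X0 XD XM _; split=> // c u v hu hv; apply: XD => //.
have E : c *: u = (c *: (1 : H) : H) * u.
  exact: (etrans (f_equal (fun w => c *: w) (esym (mul1r u))) (qHZl c 1 u)).
by rewrite E; apply: XM.
Qed.

(** The killed case does occur, for h = p - 1 and a full first row. All cell elements of shape [mu]
    are then in the kernel onto Q, so the zero form is a cell form and its radical is everything; no
    simple factor can be isomorphic to the zero module. *)
Lemma killed_radical x : killed_idem h (tab_res p n t0) -> upper mu x -> radical mu x.
Proof.
move=> kt; have S := lower_submod kk p h rex mu.
have kc s t : lower mu (cell mu s t) by apply/ker_lower/ker_base.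
have up : upper mu x -> lower mu x.
  by apply: lin_span_sub S _ x => b [//|[s hs ->]].
move/up => hx; exists (fun _ _ => 0), (fun=> 0); split.
- move=> s t u v _ _ _ _; apply: (submodB S).
    exact/ker_lower/ideal_gen_mulr/ker_base.
  by apply: submodZ.
- apply: (submodB S hx); apply: (submod_sum_in S) => s _; exact: submodZ.
- by move=> t _; rewrite big1 // => s _; rewrite mul0r.
Qed.

Lemma upper_dom : upper mu e0.
Proof.
apply: lin_span_base; right; exists t0; first exact: dom_tab_std hmu.
by rewrite (cell_dom kk p hrex hmu).
Qed.

Lemma simple_factor_generator (V V' : H -> Prop) k :
  graded_submodule V' -> graded_simple (SubQuo V' V) ->
  graded_iso_shift (SubQuo V' V) (simple_module kk p h rex mu) k ->
  exists x, [/\ V' x, homogeneous k x, e0 * x = x & ~ V x].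
Proof.
move=> gV [VV nVV _] [f [fden fM fsurj fill_degree]].
have K := klr_qH kk p n.
have e0L : ~ lower mu e0.
  apply: (idempotent_lower p3 hp h0 R hmu) => kt; apply: nVV => x hx.
  by have [h1 h2] := fden x hx; apply/h2; apply: killed_radical kt h1.
have [V0 VD VM Vspan] := gV.
refine (graded_generator (L := lower mu) (numM := V') (denM := V) (numN := upper mu)
  (denN := radical mu) (hom := @homogeneous kk p n) (E := fun u => e0 * u)
  (pr := fun d u => proj d u) (f := f) (e0 := e0) (k := k)
  (lower_submod kk p h rex mu) (graded_submodule_submod gV) (mull_linear _)
  _ _ (fun d => @projP kk p n d) _ _ _ (@homog_0 kk p n) (@homog_lin kk p n) _
  upper_dom (@homog_e kk p n _) (klr_eE K _) e0L _ _ _ _ fill_degree).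
- move=> u; exact: (etrans (mulrA _ _ _) (f_equal (fun w => w * u) (klr_eE K _))).
- by move=> u; apply: VM.
- by move=> d u; apply: lower_proj.
- move=> d u; have E := proj_homogM u d (@homog_e kk p n (tab_res p n t0)).
  by rewrite subr0 in E.
- by move=> d u d' hu; apply: proj_homogeneous.
- by move=> u; apply: radical_weight.
- move=> x /Vspan hx P P0 PS; elim: hx => [//|c b z [hb hd] _ ih].
  exact: PS.
- by move=> x /fden [].
- by move=> x; apply: fM.
- exact: fsurj.
Qed.

Definition matching_tableaux k := [seq s <- std la |
  (fres p (tab_fun n s) == tab_res p n t0) && (fill_degree p h0 (tab_fun n s) == k)].

(** Each factor counted supplies a vector of degree [k] fixed by the idempotent. Modulo the lower
    cells such a vector is a combination of the basis vectors of the Specht module of the same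
    residues and degree, so [chain_count] applies with one vector per matching tableau. *)
Lemma multiplicity_bound k m :
  graded_mult (Specht kk p h rex la) (simple_module kk p h rex mu) k m ->
  (m <= size (matching_tableaux k))%N.
Proof.
case=> l [V [[V0 Vl Vg Vs] ->]].
set S := matching_tableaux k.
pose w (i : 'I_(size S)) : H := cell la (nth [::] S i) (dom_tab la).
apply: (chain_count (W := V) (w := w)) => [j jl|j jl x|j].
- exact/graded_submodule_submod/Vg.
- by have [VV _ _] := Vs j jl; apply: VV.
rewrite inE => /asboolP iso.
have [x [Vx xk ex nVx]] := simple_factor_generator (Vg _ (ltn_ord j)) (Vs _ (ltn_ord j)) iso.
have Ux : upper la x.
  apply/Vl; have inc i : (j < i <= l)%N -> V i x.
    elim: i => // i ih /andP[ji il]; move: ji; rewrite ltnS leq_eqVlt => /orP[/eqP <- //|ji].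
    by have [VV _ _] := Vs i il; apply: VV; apply: ih; rewrite ji ltnW.
  by apply: inc; rewrite ltn_ord leqnn.
(* This map fixes [x], preserves the lower cells, and sends each spanning cell element either to
   itself or to 0, according to residues and degree. *)
pose G (u : H) : H := proj k (e0 * u).
have lG : linear G.
  move=> c u v; exact: (etrans (f_equal _ (mull_linear e0 c u v)) (projP k c _ _)).
have Gx : G x = x.
  by rewrite /G ex (proj_homogeneous k xk) eqxx.
have [c hc] : exists c : 'I_(size S) -> kk, lower la (G x - \sum_i c i *: w i).
  have SL := lower_submod kk p h rex la.
  move: x {Vx xk ex nVx Gx} Ux; apply: lin_span_sub; first exact: expansion_submod.
  have Gl b : lower la b -> lower la (G b).
    by move=> hb; apply: lower_proj => //; apply: lower_weight.
  move=> b [hb|[s hs ->]]; first by apply: expansion_lower; apply: Gl.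
  have := cell_weight kk p3 hp h0 hrex hla (dom_tab la) (tab_res p n t0) hs.
  have hom := cell_homogeneous kk p3 hp h0 hrex hla hs (dom_tab_std hla).
  rewrite (fill_degree_dom p3 hp h0 hla) addr0 in hom.
  case: ifP => [/eqP rs E|_ E]; last first.
    by apply: expansion_lower; rewrite /G E; apply: lower_proj => //; apply: lin_span0.
  have EG : G (cell la s (dom_tab la)) =
      if k == fill_degree p h0 (tab_fun n s) then cell la s (dom_tab la) else 0.
    by rewrite /G E; exact: (proj_homogeneous k hom).
  have [ks|ks] := eqVneq k (fill_degree p h0 (tab_fun n s)); last first.
    by apply: expansion_lower; rewrite EG (negbTE ks); apply: lin_span0.
  have sS : s \in S by rewrite mem_filter hs -rs ks !eqxx.
  have iS : (index s S < size S)%N by rewrite index_mem.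
  apply: (expansion_basis SL (i := Ordinal iS)).
  apply: (etrans EG); have -> : (k == fill_degree p h0 (tab_fun n s)) = true by apply/eqP.
exact: (f_equal (fun t => cell la t (dom_tab la)) (esym (nth_index [::] sS))).
exists x, c; split=> //; apply/V0 => /=.
by rewrite Gx in hc.
Qed.

End Multiplicity.

(** * From tableaux to paths and linkage *)

Section Conclusion.
Variables (R : realType) (p n h : nat).
Hypotheses (p3 : (2 < p)%N) (hp : (h < p)%N) (h0 : (0 < h)%N).
Variables (la mu : seq nat).
Hypotheses (hla : is_partition n h la) (hmu : is_partition n h mu).

Lemma tableau_path k s : s \in matching_tableaux p n h0 la mu k ->
  fill_path h0 (tab_fun n s) \in [set s in dom_paths R p n h la mu | path_degree R p s == k].
Proof.
rewrite mem_filter => /andP[/andP[/eqP rs /eqP <-] hs].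
have sf := std_tab_fun hla hs; have dom i := fill_path_dominant R p hla h0 i sf.
rewrite !inE; apply/andP; split; last first.
  apply/eqP; apply: (path_degreeE p3 hp) => i _; exact: dom.
apply/asboolP; split; [|exact: fill_path_weight|by move=> i _; apply: dom].
exists (fill_path h0 (f_init n mu)); first exact/(is_dom_pathE hmu h0).
apply: (same_pres_equiv R p3 hp) => j.
have /ffunP /(_ j) : path_res p (fill_path h0 (tab_fun n s)) = path_res p (fill_path h0 (f_init n mu)).
  by rewrite (fill_path_res p hla h0 sf) (fill_path_res p hmu h0 (std_f_init hmu)) rs (tab_res_dom p hmu).
by rewrite !ffunE.
Qed.

Lemma matching_tableaux_paths k :
  (size (matching_tableaux p n h0 la mu k) <=
   #|[set s in dom_paths R p n h la mu | path_degree R p s == k]|)%N.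
Proof.
rewrite -(size_map (fun s => fill_path h0 (tab_fun n s))) cardE; apply: uniq_leq_size.
  rewrite map_inj_in_uniq ?filter_uniq ?permutations_uniq // => s s'.
  rewrite mem_filter => /andP[_ hs]; rewrite mem_filter => /andP[_ hs'].
  move/(fill_path_inj hla (std_tab_fun hla hs) (std_tab_fun hla hs')).
  exact: (tab_fun_inj hla hs hs').
by move=> x /mapP [s hs ->]; rewrite mem_enum; apply: tableau_path.
Qed.

(** Equivalent paths have the same residues, and the path of [t^mu] raises the topmost coordinate of
    a residue class at every step, so the comparison of [same_pres_linked] applies. *)
Lemma dom_path_linked s : s \in dom_paths R p n h la mu ->
  strongly_linked p (weight R h la) (weight R h mu).
Proof.
rewrite inE => /asboolP [[t /(is_dom_pathE hmu h0) -> st] <- _].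
rewrite -(fill_path_weight R hmu h0 (std_f_init hmu)).
exact: (same_pres_linked R p3 hp (topmost_f_init hmu p3 hp) (pres_path_equiv p3 st)).
Qed.

End Conclusion.

Theorem theoremA (R : realType) (kk : fieldType) (p n h : nat)
    (hp3 : (3 <= p)%N) (hchar : p \in [pchar kk]) (hph : (h < p)%N)
    (hh : (1 <= h)%N) (hn : (1 <= n)%N)
    (la mu : seq nat)
    (hla : is_partition n h la) (hmu : is_partition n h mu)
    (rex : tableau -> seq 'I_n.-1) (hrex : valid_red n h rex) :
  (forall (k : int) (m : nat),
     graded_mult (Specht kk p h rex la) (simple_module kk p h rex mu) k m ->
     (m <= #|[set s in dom_paths R p n h la mu | path_degree R p s == k]|)%N) /\
  ((exists (k : int) (m : nat),
      graded_mult (Specht kk p h rex la) (simple_module kk p h rex mu) k m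
      /\ m <> 0%N) ->
   strongly_linked p (weight R h la) (weight R h mu)).
Proof.
have bound k m : graded_mult (Specht kk p h rex la) (simple_module kk p h rex mu) k m ->
    (m <= #|[set s in dom_paths R p n h la mu | path_degree R p s == k]|)%N.
  move/(multiplicity_bound R hp3 hph hh hrex hla hmu) => le.
  exact: leq_trans le (matching_tableaux_paths R hp3 hph hh hla hmu k).
split=> // -[k [m [/bound le m0]]].
(* A nonzero multiplicity leaves at least one path, and any such path implies the linkage. *)
have [|[s]] := set_0Vmem [set s in dom_paths R p n h la mu | path_degree R p s == k].
  by move=> E; move: le; rewrite E cards0 leqn0 => /eqP.
rewrite inE => /andP[hs _]; exact: dom_path_linked hs.
Qed.
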